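(* Let $X=X(K,U)$ be an Oeljeklaus–Toma (OT) manifold of type $(s,t)$ and of complex dimension $m=s+t$, let $n=s+2t$, and let $\theta=\sum_{k=1}^s a_k\, d\ln v_k$ be a closed one-form on $X(K,U)$, where $a_1,\ldots,a_s\in\mathbb{C}$. Then for any $l\in\{0,\ldots,2m\}$ we have $$H^l_\theta(X,\mathbb{C})\cong\bigoplus_{\substack{p+q=l\\ |I|=q\\ \rho^\theta\otimes\sigma_I=1}}\textstyle\bigwedge^p\mathbb{C}\{d\ln v_1,\ldots,d\ln v_s\}\wedge (v_1^{a_1}\cdots v_s^{a_s})\,e_I .$$ In particular, the corresponding twisted Betti numbers are given by $$b_l^\theta=\sum_{p+q=l}\binom{s}{p}\cdot\rho_q^\theta,$$ where $\rho_q^\theta$ is the cardinality of the set $\{I\mid |I|=q,\ \rho^\theta\otimes\sigma_I=1\}$.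
   Context: OT manifolds: let $s,t>0$, $m=s+t$, $n=s+2t$, and let $K$ be a number field with exactly $s$ real embeddings $\sigma_1,\ldots,\sigma_s$ and $2t$ non-real embeddings $\sigma_{s+1},\ldots,\sigma_{n}$ in $\mathbb{C}$, ordered so that $\sigma_{s+t+i}=\overline{\sigma_{s+i}}$ for $1\le i\le t$. Let $O_K$ be the ring of integers, and $O_K^{*,+}=\{u\in O_K^*\mid \sigma_i(u)>0,\ 1\le i\le s\}$. Let $\mathbb{H}$ be the upper half plane, with holomorphic coordinates $(w_1,\ldots,w_s,z_1,\ldots,z_t)$ on $\mathbb{H}^s\times\mathbb{C}^t$. $O_K$ acts on $\mathbb{H}^s\times\mathbb{C}^t$ by translations $T_a(w,z)=(w_1+\sigma_1(a),\ldots,w_s+\sigma_s(a),z_1+\sigma_{s+1}(a),\ldots,z_t+\sigma_{s+t}(a))$ and $O_K^{*,+}$ acts by $R_u(w,z)=(\sigma_1(u)w_1,\ldots,\sigma_s(u)w_s,\sigma_{s+1}(u)z_1,\ldots,\sigma_{s+t}(u)z_t)$. Let $U\subset O_K^{*,+}$ be a subgroup of rank $s$ such that $u\mapsto(\sigma_1(u),\ldots,\sigma_s(u))$ embeds $U$ as a lattice in the multiplicative group $(\mathbb{R}_{>0})^s$. Then $\Gamma=U\ltimes O_K$ acts freely and properly discontinuously on $\mathbb{H}^s\times\mathbb{C}^t$ and the OT manifold of type $(s,t)$ associated to $(K,U)$ is the compact complex manifold $X(K,U)=(\mathbb{H}^s\times\mathbb{C}^t)/\Gamma$. Write $w_j=r_j+iv_j$,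 so $v_j=\operatorname{Im}w_j$; the forms $d\ln v_k$ are $\Gamma$-invariant and regarded as forms on $X$. Multi-indices: $I=(0<i_1<\ldots<i_q\le n)$ with $|I|=q$ ($I=\emptyset$ allowed). Put $e_j=dr_j$ for $1\le j\le s$, $e_{s+j}=dz_j$ and $e_{s+t+j}=d\bar z_j$ for $1\le j\le t$, $e_I=e_{i_1}\wedge\cdots\wedge e_{i_q}$, $e_\emptyset=1$. The character $\sigma_I:U\to\mathbb{C}^*$ is $\sigma_I(u)=\sigma_{i_1}(u)\cdots\sigma_{i_q}(u)$, $\sigma_\emptyset=1$. For $\theta=\sum a_k d\ln v_k$, $\rho^\theta:U\to\mathbb{C}^*$ is the character $\rho^\theta(u)=\sigma_1(u)^{a_1}\cdots\sigma_s(u)^{a_s}$ (powers of positive reals), and $\rho^\theta\otimes\sigma_I$ is the product character; ''$=1$'' means trivial. Twisted cohomology: $H^\bullet_\theta(X,\mathbb{C})=\ker d_\theta/\operatorname{Im}d_\theta$ is the cohomology of the complex of complex-valued smooth forms on $X$ with differential $d_\theta=d-\theta\wedge\cdot$, and $b^\theta_l=\dim_{\mathbb{C}}H^l_\theta(X,\mathbb{C})$. $\mathbb{C}\{\cdots\}$ denotes the complex span. The forms on the right-hand side are $\Gamma$-invariant forms on $\mathbb{H}^s\times\mathbb{C}^t$, regarded as forms on $X$. *)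

(* Defs.v *)
From HB Require Import structures.
From mathcomp Require Import all_boot all_order all_algebra all_field.
From mathcomp Require Import generic_quotient complex.
From mathcomp Require Import ring.
From mathcomp Require Import all_classical all_reals all_analysis.

Set Implicit Arguments.
Unset Strict Implicit.
Unset Printing Implicit Defensive.
Import Order.TTheory GRing.Theory Num.Theory.
Import numFieldNormedType.Exports.
Local Open Scope classical_set_scope.
Local Open Scope ring_scope.
Local Open Scope quotient_scope.
Local Open Scope complex_scope.

Section Submodules.
Variables (F : fieldType) (V : lmodType F) (P : submodClosed V).

(* [submodClosed] only registers the semimodule closure properties; this
   alias of P also carries closure under opposite. *)
Definition opp_alias : {pred V} := P.

HB.instance Definition _ := GRing.isZmodClosed.Build V opp_alias
  (GRing.submod_closedB (GRing.submodClosedP P)).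
HB.instance Definition _ := GRing.isScaleClosed.Build F V opp_alias
  (GRing.subsemimod_closedZ (GRing.subsemimodClosedP P)).

Definition submodule := {x : V | x \in opp_alias}.

HB.instance Definition _ := SubChoice.on submodule.
HB.instance Definition _ :=
  [SubChoice_isSubLmodule of submodule by <:].

Definition quotmod := Quotient.quot opp_alias.

HB.instance Definition _ := Choice.on quotmod.
HB.instance Definition _ := EqQuotient.on quotmod.
HB.instance Definition _ := GRing.Zmodule.on quotmod.

Definition qclass (x : V) : quotmod := \pi x.

Lemma qclass_eq (x y : V) : (qclass x == qclass y) = (x - y \in P).
Proof. by rewrite /qclass (@Quotient.idealrBE _ opp_alias). Qed.

Lemma qclassD (x y : V) : qclass (x + y) = qclass x + qclass y.
Proof. by rewrite /qclass !piE. Qed.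

Definition quotmod_scale (c : F) (x : quotmod) : quotmod :=
  qclass (c *: repr x).

Lemma qclassZ (c : F) (x : V) : qclass (c *: x) = quotmod_scale c (qclass x).
Proof.
by apply/eqP; rewrite qclass_eq -scalerBr rpredZ // -qclass_eq /qclass reprK.
Qed.

Lemma qclassW (Q : quotmod -> Prop) : (forall x, Q (qclass x)) -> forall v, Q v.
Proof. by move=> H v; rewrite -[v]reprK; apply: H. Qed.

Lemma quotmod_scaleA (a b : F) (v : quotmod) :
  quotmod_scale a (quotmod_scale b v) = quotmod_scale (a * b) v.
Proof. by elim/qclassW: v => v; rewrite -!qclassZ scalerA. Qed.

Lemma quotmod_scale1 : left_id 1 quotmod_scale.
Proof. by elim/qclassW => v; rewrite -qclassZ scale1r. Qed.

Lemma quotmod_scaleDr : right_distributive quotmod_scale +%R.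
Proof.
move=> c; elim/qclassW => u; elim/qclassW => v.
by rewrite -qclassD -!qclassZ scalerDr qclassD.
Qed.

Lemma quotmod_scaleDl (v : quotmod) :
  {morph quotmod_scale^~ v : a b / a + b}.
Proof.
by elim/qclassW: v => v a b; rewrite -!qclassZ scalerDl qclassD.
Qed.

HB.instance Definition _ := GRing.Zmodule_isLmodule.Build F quotmod
  quotmod_scaleA quotmod_scale1 quotmod_scaleDr quotmod_scaleDl.

End Submodules.

Definition has_dim (F : fieldType) (V : lmodType F) (n : nat) : Prop :=
  exists b : 'I_n -> V, forall x : V,
    exists! c : {ffun 'I_n -> F}, x = \sum_i c i *: b i.

Section Smooth.
Variables (R : realType) (V : normedModType R) (D : set V).

Fixpoint Ck (k : nat) (f : V -> R) : Prop :=
  if k is k'.+1 then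
    forall h, (forall x, D x -> derivable f x h) /\ Ck k' (fun x => 'D_h f x)
  else forall x, D x -> {for x, continuous f}.

Definition smooth (f : V -> R[i]) : Prop :=
  forall k, Ck k (fun x => complex.Re (f x)) /\ Ck k (fun x => complex.Im (f x)).

Definition cderive (f : V -> R[i]) (x h : V) : R[i] :=
  'D_h (fun y => complex.Re (f y)) x +i* 'D_h (fun y => complex.Im (f y)) x.

Hypothesis Dopen : open D.

Lemma near_eq_D (f g : V -> R) x : (forall y, D y -> f y = g y) -> D x ->
  {near x, f =1 g}.
Proof.
by move=> fg Dx; near do apply: fg; exact: open_nbhs_nbhs.
Unshelve. all: by end_near. Qed.

Lemma Ck_eq k (f g : V -> R) :
  (forall x, D x -> f x = g x) -> Ck k f -> Ck k g.
Proof.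
elim: k f g => [|k IH] f g fg /=.
  move=> Cf x Dx; rewrite /prop_for /continuous_at -fg //.
  apply: cvg_trans (Cf x Dx); apply: near_eq_cvg.
  exact: near_eq_D.
move=> Cf h; have [df Ck'] := Cf h; split.
  by move=> x Dx; apply: near_eq_derivable (df x Dx); exact: near_eq_D.
apply: IH Ck' => x Dx.
by apply: near_eq_derive; exact: near_eq_D.
Qed.

Lemma Ck_cst k (c : R) : Ck k (fun=> c).
Proof.
elim: k c => [|k IH] c /=; first by move=> x _; exact: cvg_cst.
move=> h; split=> [x _|]; first exact: derivable_cst.
by apply: Ck_eq (IH 0) => x _; rewrite derive_cst.
Qed.

Lemma smooth0 : smooth (fun=> 0).
Proof. by move=> k; split; exact: Ck_cst. Qed.

Lemma CkD k (f g : V -> R) : Ck k f -> Ck k g -> Ck k (fun x => f x + g x).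
Proof.
elim: k f g => [|k IH] f g /= Cf Cg.
  by move=> x Dx; apply: cvgD; [exact: Cf | exact: Cg].
move=> h; have [df Cf'] := Cf h; have [dg Cg'] := Cg h; split.
  by move=> x Dx; apply: derivableD; [exact: df | exact: dg].
apply: Ck_eq (IH _ _ Cf' Cg') => x Dx.
by rewrite deriveD; [| exact: df | exact: dg].
Qed.

Lemma CkM k (c : R) (f : V -> R) : Ck k f -> Ck k (fun x => c * f x).
Proof.
elim: k f => [|k IH] f /= Cf.
  by move=> x Dx; apply: cvgM; [exact: cvg_cst | exact: Cf].
move=> h; have [df Cf'] := Cf h; split.
  by move=> x Dx; apply: derivableZ; exact: df.
apply: Ck_eq (IH _ Cf') => x Dx.
by rewrite deriveZ; [| exact: df].
Qed.

Lemma smooth_lin (c : R[i]) (f g : V -> R[i]) :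
  smooth f -> smooth g -> smooth (fun x => c * f x + g x).
Proof.
move=> sf sg k; have [fr fi] := sf k; have [gr gi] := sg k; split.
  apply: Ck_eq (CkD (CkD (CkM (complex.Re c) fr) (CkM (- complex.Im c) fi)) gr).
  by move=> x _; case: c (f x) (g x) => ? ? [? ?] [? ?] /=; rewrite mulNr.
apply: Ck_eq (CkD (CkD (CkM (complex.Re c) fi) (CkM (complex.Im c) fr)) gi).
by move=> x _; case: c (f x) (g x) => ? ? [? ?] [? ?].
Qed.

Lemma derive_lin3 (p q : R) (f g k : V -> R) x h :
  derivable f x h -> derivable g x h -> derivable k x h ->
  'D_h (fun y => p * f y + q * g y + k y) x =
  p * 'D_h f x + q * 'D_h g x + 'D_h k x.
Proof.
move=> df dg dk.
have dpf : derivable (p *: f) x h by exact: derivableZ.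
have dqg : derivable (q *: g) x h by exact: derivableZ.
have -> : (fun y => p * f y + q * g y + k y) = (p *: f + q *: g) + k by [].
rewrite (deriveD (derivableD dpf dqg) dk) (deriveD dpf dqg).
by rewrite (deriveZ p df) (deriveZ q dg).
Qed.

Lemma cderive_lin (c : R[i]) (f g : V -> R[i]) x h :
  D x -> smooth f -> smooth g ->
  cderive (fun x => c * f x + g x) x h = c * cderive f x h + cderive g x h.
Proof.
move=> Dx sf sg; have [/(_ h)[fr _] /(_ h)[fi _]] := sf 1%N.
have [/(_ h)[gr _] /(_ h)[gi _]] := sg 1%N.
have {}fr := fr x Dx; have {}fi := fi x Dx.
have {}gr := gr x Dx; have {}gi := gi x Dx.
rewrite /cderive.
have -> : (fun y => complex.Re (c * f y + g y)) =
    (fun y => complex.Re c * complex.Re (f y)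
      + - complex.Im c * complex.Im (f y) + complex.Re (g y)).
  apply/funext => y.
  by case: c (f y) (g y) => ? ? [? ?] [? ?] /=; rewrite mulNr.
have -> : (fun y => complex.Im (c * f y + g y)) =
    (fun y => complex.Re c * complex.Im (f y)
      + complex.Im c * complex.Re (f y) + complex.Im (g y)).
  by apply/funext => y; case: c (f y) (g y) => ? ? [? ?] [? ?].
rewrite (derive_lin3 _ _ fr fi gr) (derive_lin3 _ _ fi fr gi) mulNr.
move: ('D_h _ x) ('D_h _ x) ('D_h _ x) ('D_h _ x) => p1 p2 p3 p4.
by case: c.
Qed.

End Smooth.

(* x ^ a for real x > 0 and complex a *)
Definition cpow (R : realType) (x : R) (a : R[i]) : R[i] :=
  (expR (complex.Re a * ln x))%:C *
  (cos (complex.Im a * ln x) +i* sin (complex.Im a * ln x)).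

Section Space.
Variables (R : realType) (s t : nat).

(* C^(s+t) as a real vector space; the columns hold real and imaginary
   parts, and the rows are the coordinates (w_1, .., w_s, z_1, .., z_t). *)
Definition pt := 'M[R]_(s + t, 2).

Definition coord (x : pt) (j : 'I_(s + t)) : R[i] := x j 0 +i* x j 1.

Definition mkpt (f : 'I_(s + t) -> R[i]) : pt :=
  \matrix_(j, k) if k == 0 then complex.Re (f j) else complex.Im (f j).

Definition wcoord (x : pt) (k : 'I_s) : R[i] := coord x (lshift t k).

Definition HC : set pt := [set x | forall k, 0 < complex.Im (wcoord x k)].

(* A differential form of degree l on HC is a function on all of [pt]
   vanishing outside HC; the regular module [^o] only serves to put the
   C-vector space structure on the function type. *)
Definition form (l : nat) := pt -> ('I_l -> pt) -> R[i]^o.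

HB.instance Definition _ l := GRing.Lmodule.on (form l).

Definition is_form l (w : form l) : Prop :=
  [/\ forall x, ~ HC x -> w x = 0,
      forall h, smooth HC (fun x => w x h),
      forall x h i (c : R) y z,
        w x (dfwith h i (c *: y + z)) =
        c%:C * w x (dfwith h i y) + w x (dfwith h i z)
    & forall x h i j, i != j -> h i = h j -> w x h = 0].

Definition omit l (i : 'I_l.+1) (h : 'I_l.+1 -> pt) : 'I_l -> pt :=
  fun j => h (lift i j).

Definition ext_d l (w : form l) : form l.+1 := fun x h =>
  if x \in HC then
    \sum_(i < l.+1) (-1) ^+ i * cderive (fun y => w y (omit i h)) x (h i)
  else 0.

Definition wedge1 l (theta : pt -> pt -> R[i]) (w : form l) :
    form l.+1 :=
  fun x h => \sum_(i < l.+1) (-1) ^+ i * (theta x (h i) * w x (omit i h)).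

Definition dlnv (k : 'I_s) (x h : pt) : R[i] :=
  (complex.Im (wcoord h k) / complex.Im (wcoord x k))%:C.

Variable a : 'I_s -> R[i].

Definition theta (x h : pt) : R[i] := \sum_k a k * dlnv k x h.

Definition d_theta l (w : form l) : form l.+1 := ext_d w - wedge1 theta w.

Definition vpow (x : pt) : R[i] :=
  \prod_k cpow (complex.Im (wcoord x k)) (a k).

(* the constant 1-forms dr_j, dz_j and d(conj z_j) *)
Definition e_form (i : 'I_(s + t + t)) (h : pt) : R[i] :=
  match fintype.split i with
  | inl j => match fintype.split j with
             | inl k => (complex.Re (wcoord h k))%:C
             | inr k => coord h (rshift s k)
             end
  | inr k => conjc (coord h (rshift s k))
  end.

(* The form dlnv_J /\ v^a e_I in degree l = #|J| + #|I|; a wedge product of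
   1-forms f_1, .., f_l evaluates on h_1, .., h_l to det (f_i (h_j)). *)
Definition basic_form l (J : {set 'I_s}) (I : {set 'I_(s + t + t)}) :
    form l :=
  fun x h => if x \in HC then
    let fs := [seq dlnv k x | k <- enum J] ++ [seq e_form i | i <- enum I] in
    vpow x * \det (\matrix_(i < l, j < l) nth (fun=> 0) fs i (h j))
  else 0.

Arguments basic_form : clear implicits.

Definition summand l (I : {set 'I_(s + t + t)}) : set (form l) :=
  [set w | exists c : {set 'I_s} -> R[i],
     w = \sum_(J : {set 'I_s} | (#|J| + #|I| == l)%N) c J *: basic_form l J I].

End Space.

Section FormLemmas.
Variables (R : realType) (s t : nat).
Local Notation HC := (@HC R s t).
Local Notation form := (form R s t).

Lemma HC_open : open HC.
Proof.
have H (k : 'I_s) : open [set x : pt R s t | 0 < x (lshift t k) 1].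
  apply: (@open_comp _ _ (fun x : pt R s t => x (lshift t k) 1)
    [set y | 0 < y]); last exact: open_gt.
  by move=> x _; exact: coord_continuous.
rewrite openE => x Hx.
apply: (@filter_forall _ 'I_s (fun k (y : pt R s t) =>
  0 < complex.Im (wcoord y k)) _ (nbhs_filter x)) => k.
by move: (H k); rewrite openE; apply; exact: Hx.
Qed.

Lemma is_form0 l : is_form (0 : form l).
Proof.
split=> //; first by move=> h; exact: (smooth0 HC_open).
by move=> x h i c y z /=; rewrite mulr0 addr0.
Qed.

Lemma is_form_lin l (c : R[i]) (w1 w2 : form l) :
  is_form w1 -> is_form w2 -> is_form (c *: w1 + w2).
Proof.
move=> [v1 s1 l1 a1] [v2 s2 l2 a2]; split.
- by move=> x Hx; rewrite -[LHS]/(c *: w1 x + w2 x) v1 // v2 // scaler0 addr0.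
- by move=> h; exact: (smooth_lin HC_open c (s1 h) (s2 h)).
- move=> x h i d y z.
  have E (v : 'I_l -> pt R s t) :
    (c *: w1 + w2) x v = c * w1 x v + w2 x v by [].
  by rewrite !E l1 l2; ring.
- move=> x h i j ij hij.
  by rewrite -[LHS]/(c * w1 x h + w2 x h) (a1 _ _ _ _ ij) // (a2 _ _ _ _ ij) //
    mulr0 addr0.
Qed.

Lemma d_theta0 (a : 'I_s -> R[i]) l : d_theta a (0 : form l) = 0.
Proof.
apply/funext => x; apply/funext => h.
rewrite -[LHS]/(ext_d 0 x h - wedge1 (theta a) 0 x h) /ext_d /wedge1.
rewrite [X in _ - X]big1 ?subr0; last by move=> i _; rewrite !mulr0.
case: ifP => // _; rewrite big1 // => i _.
by rewrite /cderive !derive_cst mulr0.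
Qed.

Lemma d_theta_lin (a : 'I_s -> R[i]) l (c : R[i]) (w1 w2 : form l) :
  is_form w1 -> is_form w2 ->
  d_theta a (c *: w1 + w2) = c *: d_theta a w1 + d_theta a w2.
Proof.
move=> f1 f2; apply/funext => x; apply/funext => h.
rewrite -[LHS]/(ext_d (c *: w1 + w2) x h - wedge1 (theta a) (c *: w1 + w2) x h).
rewrite -[RHS]/(c * (ext_d w1 x h - wedge1 (theta a) w1 x h)
  + (ext_d w2 x h - wedge1 (theta a) w2 x h)).
have -> : wedge1 (theta a) (c *: w1 + w2) x h =
    c * wedge1 (theta a) w1 x h + wedge1 (theta a) w2 x h.
  rewrite /wedge1 mulr_sumr -big_split /=; apply: eq_bigr => i _.
  rewrite -[(c *: w1 + w2) _ _]/(c * w1 x (omit i h) + w2 x (omit i h)).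
  by ring.
have -> : ext_d (c *: w1 + w2) x h = c * ext_d w1 x h + ext_d w2 x h.
  rewrite /ext_d; case: ifPn => [/set_mem Hx|_]; last by rewrite mulr0 addr0.
  rewrite mulr_sumr -big_split /=; apply: eq_bigr => i _.
  rewrite -[cderive (fun y => (c *: w1 + w2) y _) _ _]/(cderive
    (fun y => c * w1 y (omit i h) + w2 y (omit i h)) x (h i)).
  rewrite (cderive_lin c (h i) Hx) //; first by ring.
  - by have [_ + _ _] := f1; exact.
  - by have [_ + _ _] := f2; exact.
by ring.
Qed.

Lemma summand0 (a : 'I_s -> R[i]) l I : summand a I (0 : form l).
Proof. by exists (fun=> 0); rewrite big1 // => J _; rewrite scale0r. Qed.

Lemma summand_lin (a : 'I_s -> R[i]) l I (c : R[i]) (w1 w2 : form l) :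
  summand a I w1 -> summand a I w2 -> summand a I (c *: w1 + w2).
Proof.
move=> [c1 ->] [c2 ->]; exists (fun J => c * c1 J + c2 J).
rewrite scaler_sumr -big_split /=; apply: eq_bigr => J _.
by rewrite scalerA -scalerDl.
Qed.

End FormLemmas.

Arguments HC {R s t}.
Arguments coord {R s t}.
Arguments wcoord {R s t}.

Section NumberField.
Variables (R : realType) (K : fieldExtType rat) (s t : nat).
Variable sigma : 'I_(s + t + t) -> {rmorphism K -> R[i]}.

Definition real_emb (k : 'I_s) := sigma (lshift t (lshift t k)).
Definition cplx_emb (k : 'I_t) := sigma (lshift t (rshift s k)).
Definition conj_emb (k : 'I_t) := sigma (rshift (s + t) k).

Definition ordered_embeddings : Prop :=
  [/\ forall i j, sigma i =1 sigma j -> i = j,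
      (forall tau : {rmorphism K -> R[i]}, exists i, tau =1 sigma i),
      forall k x, complex.Im (real_emb k x) = 0,
      (forall k, exists x, complex.Im (cplx_emb k x) != 0)
    & forall k x, conj_emb k x = conjc (cplx_emb k x)].

Definition O_K : set K := [set x | integralOver (intr : int -> K) x].

Definition O_Kpos : set K :=
  [set u | [/\ u != 0, O_K u, O_K u^-1 & forall k, 0 < real_emb k u]].

Definition mul_indep r (f : 'I_r -> K) : Prop :=
  forall k : 'I_r -> int, \prod_i f i ^ k i = 1 -> forall i, k i = 0.

Definition mul_rank (U : set K) (r : nat) : Prop :=
  (exists2 f : 'I_r -> K, forall i, U (f i) & mul_indep f) /\
  (forall f : 'I_r.+1 -> K, (forall i, U (f i)) -> ~ mul_indep f).

(* (R_{>0})^s is identified with R^s through the logarithm *)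
Definition log_emb (u : K) : 'rV[R]_s :=
  \row_k ln (complex.Re (real_emb k u)).

Definition is_lattice (L : set 'rV[R]_s) : Prop :=
  exists2 B : 'M[R]_s, B \in unitmx &
    L = [set map_mx intr z *m B | z in [set: 'rV[int]_s]].

Definition mul_subgroup (U : set K) : Prop :=
  [/\ U `<=` O_Kpos, U 1 & forall u v, U u -> U v -> U (u / v)].

Definition admissible (U : set K) : Prop :=
  [/\ mul_subgroup U, mul_rank U s, set_inj U log_emb
    & is_lattice (log_emb @` U)].

Definition translate (b : K) (x : pt R s t) : pt R s t :=
  mkpt (fun j => coord x j + sigma (lshift t j) b).

Definition dilate (u : K) (x : pt R s t) : pt R s t :=
  mkpt (fun j => sigma (lshift t j) u * coord x j).

(* [dilate u] is real linear, hence is the differential of translate b \o dilate u *)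
Definition invariant (U : set K) l (w : form R s t l) : Prop :=
  forall u b x h, U u -> O_K b -> HC x ->
    w (translate b (dilate u x)) (fun j => dilate u (h j)) = w x h.

Definition rho (a : 'I_s -> R[i]) (u : K) : R[i] :=
  \prod_k cpow (complex.Re (real_emb k u)) (a k).

Definition sigmaI (I : {set 'I_(s + t + t)}) (u : K) : R[i] :=
  \prod_(i in I) sigma i u.

Definition trivial_char (U : set K) (a : 'I_s -> R[i])
    (I : {set 'I_(s + t + t)}) : Prop :=
  forall u, U u -> rho a u * sigmaI I u = 1.

End NumberField.

Section TwistedCohomology.
Variables (R : realType) (K : fieldExtType rat) (s t : nat).
Variable sigma : 'I_(s + t + t) -> {rmorphism K -> R[i]}.
Variables (U : set K) (a : 'I_s -> R[i]).

(* Forms on the quotient of HC by the free and properly discontinuous action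
   of U |>< O_K are the invariant forms on HC. *)
Definition is_Xform l (w : form R s t l) : Prop :=
  is_form w /\ invariant sigma U w.

Definition closed_form l : {pred form R s t l} :=
  fun w => `[< is_Xform w /\ d_theta a w = 0 >].

Definition is_exact l : form R s t l -> Prop :=
  match l with
  | 0 => fun w => w = 0
  | k.+1 => fun w => exists2 eta : form R s t k,
                       is_Xform eta & w = d_theta a eta
  end.

Lemma is_Xform0 l : is_Xform (0 : form R s t l).
Proof. by split; [exact: is_form0 | by []]. Qed.

Lemma is_Xform_lin l (c : R[i]) (w1 w2 : form R s t l) :
  is_Xform w1 -> is_Xform w2 -> is_Xform (c *: w1 + w2).
Proof.
move=> [f1 i1] [f2 i2]; split; first exact: is_form_lin.
move=> u b x h Uu Ob Hx.
rewrite -[RHS]/(c * w1 x h + w2 x h) -(i1 u b x h) // -(i2 u b x h) //.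
Qed.

Lemma closed_form_submod l : submod_closed (@closed_form l).
Proof.
split.
  by apply/asboolP; split; [exact: is_Xform0 | exact: d_theta0].
move=> c w1 w2 /asboolP [X1 d1] /asboolP [X2 d2]; apply/asboolP; split.
  exact: is_Xform_lin.
by rewrite d_theta_lin ?d1 ?d2 ?scaler0 ?addr0; [| case: X1 | case: X2].
Qed.

HB.instance Definition _ l := GRing.isSubmodClosed.Build R[i] (form R s t l)
  (@closed_form l) (@closed_form_submod l).

Definition exact_form l : {pred submodule (@closed_form l)} :=
  fun z => `[< is_exact (val z) >].

Lemma is_exact0 l : is_exact (0 : form R s t l).
Proof.
by case: l => [//|l]; exists 0; [exact: is_Xform0 | rewrite d_theta0].
Qed.

Lemma is_exact_lin l (c : R[i]) (w1 w2 : form R s t l) :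
  is_exact w1 -> is_exact w2 -> is_exact (c *: w1 + w2).
Proof.
case: l w1 w2 => [|l] w1 w2 /=; first by move=> -> ->; rewrite scaler0 addr0.
move=> [e1 X1 E1] [e2 X2 E2]; exists (c *: e1 + e2); first exact: is_Xform_lin.
by rewrite d_theta_lin ?E1 ?E2; [| case: X1 | case: X2].
Qed.

Lemma exact_form_submod l : submod_closed (@exact_form l).
Proof.
split; first by apply/asboolP; rewrite raddf0; exact: is_exact0.
move=> c z1 z2 /asboolP E1 /asboolP E2; apply/asboolP.
by rewrite linearP; exact: is_exact_lin.
Qed.

HB.instance Definition _ l := GRing.isSubmodClosed.Build R[i]
  (submodule (@closed_form l)) (@exact_form l) (@exact_form_submod l).

Definition twisted_cohomology l := quotmod (@exact_form l).

(* The external direct sum over I of the [summand a I], as families; the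
   component at I is forced to be 0 when the character of I is not trivial,
   and is automatically 0 when #|I| > l. *)
Definition form_family l := {set 'I_(s + t + t)} -> form R s t l.

HB.instance Definition _ l := GRing.Lmodule.on (form_family l).

Definition in_sum l : {pred form_family l} :=
  fun w => `[< forall I, summand a I (w I) /\
                 (~ trivial_char sigma U a I -> w I = 0) >].

Lemma in_sum_submod l : submod_closed (@in_sum l).
Proof.
split; first by apply/asboolP => I; split=> // ; exact: summand0.
move=> c w1 w2 /asboolP H1 /asboolP H2; apply/asboolP => I.
have [S1 Z1] := H1 I; have [S2 Z2] := H2 I.
rewrite -[(c *: w1 + w2) I]/(c *: w1 I + w2 I); split.
  exact: summand_lin.
by move=> nt; rewrite Z1 // Z2 // scaler0 addr0.
Qed.

HB.instance Definition _ l := GRing.isSubmodClosed.Build R[i] (form_family l)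
  (@in_sum l) (@in_sum_submod l).

Definition sum_of_forms l := submodule (@in_sum l).

Definition rho_card (q : nat) : nat :=
  #|[set I : {set 'I_(s + t + t)} |
      (#|I| == q) && `[< trivial_char sigma U a I >]]|.

End TwistedCohomology.

(* Main.v *)
(** In the coordinates y_k = ln v_k, r_k, z_k the group acts by affine maps. Writing a
    form as v^a times a combination of wedge products of the d ln v_k and e_i, with an
    alternating array of functions as coefficients, turns d_theta into the Koszul
    differential of a commuting frame of complex vector fields.

    Averaging over translations by O_K is homotopic to the identity by Cartan's formula,
    and kills all derivatives along the fibres (r, z), because by Dedekind's independence
    of embeddings O_K spans the fibre over the complex numbers. An invariant closed array
    with zero average thus has an O_K-invariant primitive, which is made invariant under
    the generators u_1, .., u_s of U one at a time: the defect of invariance under u_k is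
    the differential of a zeta, and u_k^* xi - xi = zeta is solved by cutting zeta with a
    smooth step in the k-th coordinate of ln v and summing along the orbits of u_k.

    The fibre-constant arrays split according to the set I of letters e_i involved. There
    u acts as a translation of ln v combined with the scalar (rho^theta sigma_I)(u), and
    translations are homotopic to the identity: the I-component is exact if the character
    is nontrivial, and homotopic to its average, a constant, otherwise. A constant array
    which is exact is the average of a sum of derivatives, hence zero. *)

Require Import Defs.
From HB Require Import structures.
From mathcomp Require Import all_boot all_order all_algebra all_field.
From mathcomp Require Import perm complex ring lra zify.
From mathcomp Require Import all_classical all_reals all_analysis.

Set Implicit Arguments.
Unset Strict Implicit.
Unset Printing Implicit Defensive.
Import Order.TTheory GRing.Theory Num.Theory.
Import numFieldNormedType.Exports.
Local Open Scope classical_set_scope.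
Local Open Scope ring_scope.
Local Open Scope complex_scope.

(** * Functions of class C^k *)

(** The descent carries the condition of zero average through the induction because the defect of
    invariance of a primitive is closed and one degree lower. The recursion therefore ends in degree
    0, where closed functions are constants and only zero is exact; a zero average excludes the
    other constants. The equation for xi is solvable because xi only has to be invariant under the
    earlier generators, and these fix the coordinate along which zeta is cut.

    The frame is complex so that units act diagonally on it: each field is multiplied by some
    sigma_i(u) or by 1, hence pullback multiplies the coefficient of every word by a scalar and
    mixes no letters.

    Averages are iterated integrals over segments along finitely many lattice vectors. A unit moves
    these segments, so the compatibility of averaging with the units needs its own argument,
    [P_gam]. *)

Section Lines.
Variables (R : realType) (V : normedModType R).
Implicit Types (f : V -> R) (x h : V).

Lemma is_derive_line f x h t df :
  is_derive (x + t *: h) h f df ->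
  is_derive t (1 : R) (fun r : R => f (x + r *: h)) df.
Proof.
move=> [dfx <-]; have e : (fun k : R => k^-1 *: (f (k *: h + (x + t *: h)) -
      f (x + t *: h))) =
    (fun k : R => k^-1 *: (f (x + (k%:A + t) *: h) - f (x + t *: h))).
  by apply/funext => k; rewrite -[k%:A]/(k * 1) mulr1 scalerDl addrCA addrA.
by split; [move: dfx; rewrite /derivable e | rewrite /derive e].
Qed.

Lemma is_derive_of_line f x h df :
  is_derive (0 : R) (1 : R) (fun r : R => f (x + r *: h)) df ->
  is_derive x h f df.
Proof.
have -> : (fun r : R => f (x + r *: h)) = (fun r : R => f (r *: h + x)).
  by apply/funext => r; rewrite addrC.
move=> [d1 v1]; split; first by apply/derivable1P.
rewrite -v1 /derive; set g1 := fun k => k^-1 *: _; set g2 := fun k => k^-1 *: _.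
suff -> : g1 = g2 by [].
apply/funext => r; rewrite /g1 /g2 /=.
by rewrite addr0 scale0r add0r -[r%:A]/(r * 1) mulr1.
Qed.

Lemma MVT_line f x h :
  (forall t : R, 0 <= t <= 1 -> derivable f (x + t *: h) h) ->
  exists2 t : R, 0 <= t <= 1 & f (x + h) - f x = 'D_h f (x + t *: h).
Proof.
move=> df; pose g := fun r : R => f (x + r *: h).
have dg (t : R) : 0 <= t <= 1 -> is_derive t 1 g ('D_h f (x + t *: h)).
  by move=> /df /derivableP H; exact: is_derive_line.
have [||t] := @MVT_segment R g (fun t => 'D_h f (x + t *: h)) 0 1 ler01.
- by move=> t; rewrite in_itv/= => /andP[a b]; apply: dg; rewrite !ltW.
- apply: derivable_within_continuous => t; rewrite in_itv/= => tt.
  by have [] := dg t tt.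
rewrite in_itv/= => tt; rewrite /g subr0 mulr1 scale1r scale0r addr0 => e.
by exists t.
Qed.

Lemma is_derive_scale f x h (c : R) df :
  is_derive x h f df -> is_derive x (c *: h) f (c * df).
Proof.
move=> dfx; have : is_derive (c * 0 : R) 1 (fun r : R => f (x + r *: h)) df.
  by apply: is_derive_line; rewrite mulr0 scale0r addr0.
move=> dl.
have dc : is_derive (0 : R) 1 (fun r : R => c * r) c.
  have := @is_deriveZ R R R id c (0 : R) 1 1 (is_derive_id _ _).
  by rewrite -[c *: 1]/(c * 1) mulr1.
have := is_derive1_comp dl dc.
have e : (fun r : R => f (x + r *: h)) \o [eta *%R c] =
    (fun r => f (x + r *: (c *: h))).
  by apply/funext => r /=; rewrite scalerA [r * c]mulrC.
by rewrite e mulrC; exact: is_derive_of_line.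
Qed.

Lemma derive_scale f x h (c : R) :
  derivable f x h -> 'D_(c *: h) f x = c * 'D_h f x.
Proof. by move=> /derivableP /is_derive_scale -/(_ c) [_ ->]. Qed.

End Lines.

Section Frechet.
Variables (R : realType) (V W : normedModType R).

Lemma differential_unique (f : V -> W) (L : {linear V -> W}) x :
  continuous L ->
  (forall e : R, 0 < e -> \forall h \near (0 : V),
     `|f (h + x) - (f x + L h)| <= e * `|h|) ->
  differentiable f x /\ 'd f x = L :> (V -> W).
Proof.
move=> cL H; have E : f \o shift x = cst (f x) + L +o_ 0 id.
  by apply/eqaddoP => e e0; exact: H.
have dL := diff_unique cL E; split=> //.
by apply/diff_locallyP; rewrite dL.
Qed.

End Frechet.

(** * Continuous partial derivatives and Frechet differentiability *)

Section C1.
Variables (R : realType) (m n : nat).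
Notation V := 'M[R]_(m, n).
Implicit Types (f : V -> R) (x h : V) (D : set V).

Lemma mx_entry_le h i j : `|h i j| <= `|h|.
Proof.
rewrite [leRHS]/Num.Def.normr /= mx_normrE.
exact: (le_bigmax _ (fun ij : 'I_m * 'I_n => `|h ij.1 ij.2|) (i, j)).
Qed.

Lemma mx_norm_le h (e : R) : 0 <= e -> (forall i j, `|h i j| <= e) -> `|h| <= e.
Proof.
move=> e0 H; rewrite [leLHS]/Num.Def.normr /= mx_normrE.
by apply: bigmax_le => // -[i j] _; exact: H.
Qed.

Definition partial_lin f x h : R :=
  \sum_(p : 'I_m * 'I_n) h p.1 p.2 * 'D_(delta_mx p.1 p.2) f x.

Lemma partial_lin_linear f x : linear (partial_lin f x : V -> R^o).
Proof.
move=> c h k; rewrite /partial_lin scaler_sumr -big_split /=.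
by apply: eq_bigr => p _; rewrite !mxE mulrDl -[_ *: _]/(_ * _) mulrA.
Qed.

HB.instance Definition _ f x :=
  GRing.isLinear.Build R V R^o *:%R (partial_lin f x) (@partial_lin_linear f x).

Lemma partial_lin_continuous f x : continuous (partial_lin f x).
Proof.
have C (p : 'I_m * 'I_n) :
    continuous (fun h : V => h p.1 p.2 * 'D_(delta_mx p.1 p.2) f x).
  move=> h; apply: (@cvgM _ _ (nbhs h) (nbhs_filter h)); last exact: cvg_cst.
  exact: (@coord_continuous R m n p.1 p.2 h).
exact: (@continuous_big R _ _ _ _ add_continuous V _ _ (fun p _ => C p)).
Qed.

(** Walk from [x] to [x + h] one matrix entry at a time and apply the mean value theorem to each
    step. In the sup norm the intermediate points stay within distance [|h|] of [x], so each step
    costs at most [e * |h|]. *)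
Lemma partial_increment f x (d e : R) : 0 <= e ->
  (forall y, `|y - x| < d -> forall p : 'I_m * 'I_n,
     derivable f y (delta_mx p.1 p.2) /\
     `|'D_(delta_mx p.1 p.2) f y - 'D_(delta_mx p.1 p.2) f x| <= e) ->
  forall h, `|h| < d ->
    `|f (x + h) - f x - partial_lin f x h| <= (size (index_enum ('I_m * 'I_n)%type))%:R * e * `|h|.
Proof.
move=> e0 H h hd.
pose hr (r : seq ('I_m * 'I_n)) : V := \sum_(p <- r) h p.1 p.2 *: delta_mx p.1 p.2.
have hrE r i j : uniq r -> hr r i j = if (i, j) \in r then h i j else 0.
  move=> ur; rewrite /hr summxE.
  under eq_bigr do rewrite !mxE.
  case: ifP => ij.
    rewrite (bigD1_seq (i, j)) //= !eqxx mulr1 big1 ?addr0 // => -[i' j'] /=.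
    rewrite xpair_eqE negb_and [i' == i]eq_sym [j' == j]eq_sym.
    by case: (i == i'); case: (j == j') => //=; rewrite ?mulr0.
  rewrite big1_seq // => -[i' j'] /= ij'.
  case: (i =P i') => [ii'|]; last by rewrite mulr0.
  case: (j =P j') => [jj'|]; last by rewrite mulr0.
  by move: ij; rewrite ii' jj' ij'.
have key r : uniq r -> `|f (x + hr r) - f x -
    \sum_(p <- r) h p.1 p.2 * 'D_(delta_mx p.1 p.2) f x| <=
    (size r)%:R * e * `|h|.
  elim: r => [_|p r IH /= /andP[pr ur]].
    by rewrite /hr !big_nil addr0 subrr subr0 normr0 !mul0r.
  have -> : hr (p :: r) = hr r + h p.1 p.2 *: delta_mx p.1 p.2.
    by rewrite /hr big_cons addrC.
  rewrite big_cons.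
  have bd (t : R) : 0 <= t <= 1 ->
     `|x + hr r + t *: (h p.1 p.2 *: delta_mx p.1 p.2) - x| < d.
    move=> /andP[t0 t1]; apply: le_lt_trans hd.
    rewrite addrC addrA addKr; apply: mx_norm_le => // i j.
    rewrite mxE hrE // !mxE.
    case: ifP => ij.
      case: (i =P p.1) => [ii|] /=; last by rewrite !mulr0 addr0 mx_entry_le.
      case: (j =P p.2) => [jj|] /=; last by rewrite !mulr0 addr0 mx_entry_le.
      by move: pr; rewrite [p]surjective_pairing -ii -jj ij.
    rewrite add0r; case: (i =P p.1) => [ii|] /=; last by rewrite !mulr0 normr0.
    case: (j =P p.2) => [jj|] /=; last by rewrite !mulr0 normr0.
    rewrite mulr1 normrM ger0_norm // (le_trans _ (mx_entry_le h p.1 p.2)) //.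
    by rewrite ler_piMl.
  have [|t t01 Et] := @MVT_line R V f (x + hr r) (h p.1 p.2 *: delta_mx p.1 p.2).
    move=> t tt; have [/derivableP Hd _] := H _ (bd t tt) p.
    by have [] := is_derive_scale (h p.1 p.2) Hd.
  have [Hd He] := H _ (bd t t01) p.
  rewrite derive_scale // in Et.
  rewrite addrA -[f (_ + _)](subrK (f (x + hr r))) Et.
  set A := 'D__ f _ in He *; set B := 'D__ f x in He *.
  have -> : h p.1 p.2 * A + f (x + hr r) - f x -
       (h p.1 p.2 * B + \sum_(j <- r) h j.1 j.2 * 'D_(delta_mx j.1 j.2) f x) =
     h p.1 p.2 * (A - B) + (f (x + hr r) - f x -
       \sum_(j <- r) h j.1 j.2 * 'D_(delta_mx j.1 j.2) f x) by ring.
  apply: le_trans (ler_normD _ _) _.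
  rewrite -[(size r).+1]addn1 natrD !mulrDl mul1r addrC; apply: lerD.
    exact: IH.
  rewrite normrM mulrC ler_pM //; exact: mx_entry_le.
have := key (index_enum _) (index_enum_uniq _).
have -> : hr (index_enum _) = h.
  by apply/matrixP => i j; rewrite hrE ?index_enum_uniq // mem_index_enum.
by [].
Qed.

Lemma C1_diff D f x : open D -> Ck D 1 f -> D x ->
  differentiable f x /\ 'd f x = partial_lin f x :> (V -> R).
Proof.
move=> oD Cf Dx; apply: (@differential_unique R V R^o f (partial_lin f x)).
  exact: partial_lin_continuous.
move=> e e0.
set N : R := (size (index_enum ('I_m * 'I_n)%type))%:R.
have N1 : 0 < N + 1 by rewrite ltr_wpDl.
(* [N + 1] instead of [N], since a matrix type without entries has [N = 0]. *)
have e'0 : 0 < e / (N + 1) by exact: divr_gt0.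
have nD : \forall y \near x, D y by exact: open_nbhs_nbhs.
have nd : \forall y \near x, forall p : 'I_m * 'I_n,
   `|'D_(delta_mx p.1 p.2) f y - 'D_(delta_mx p.1 p.2) f x| <= e / (N + 1).
  apply: (@filter_forall _ ('I_m * 'I_n)%type (fun p y =>
    `|'D_(delta_mx p.1 p.2) f y - 'D_(delta_mx p.1 p.2) f x| <= e / (N + 1))
    _ (nbhs_filter x)) => p.
  have [_ /(_ x Dx)] := Cf (delta_mx p.1 p.2).
  move=> /cvgrPdist_le /(_ _ e'0).
  by apply: filterS => y; rewrite distrC.
have /nbhs_normP[d /= d0 Hd] := @filterI _ _ (nbhs_filter x) _ _ nD nd.
apply/nbhs_normP; exists d => // h; rewrite /ball_ /= sub0r normrN => hd.
rewrite opprD addrA [h + x]addrC.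
apply: le_trans (@partial_increment f x d _ (ltW e'0) _ h hd) _.
  move=> y; rewrite distrC => /Hd [Dy Hy] p; split; last exact: Hy.
  by have [+ _] := Cf (delta_mx p.1 p.2); apply.
rewrite ler_wpM2r // mulrCA ler_piMr ?ltW //.
by rewrite ltr_pdivrMr // mul1r ltrDl.
Qed.

Lemma Ck1_differentiable D f x : open D -> Ck D 1 f -> D x ->
  differentiable f x.
Proof. by move=> oD Cf Dx; have [] := C1_diff oD Cf Dx. Qed.

Lemma derive_partial D f x h : open D -> Ck D 1 f -> D x ->
  'D_h f x = partial_lin f x h.
Proof.
move=> oD Cf Dx; have [d E] := C1_diff oD Cf Dx.
by rewrite deriveE // E.
Qed.

(** At level [k.+1] the predicate [Ck] records derivability in each direction but not continuity of
    the function itself, which directional derivability alone does not give. It is recovered from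
    Frechet differentiability. *)
Lemma Ck1_continuous D f : open D -> Ck D 1 f -> Ck D 0 f.
Proof.
by move=> oD Cf x Dx; apply: differentiable_continuous; exact: Ck1_differentiable Dx.
Qed.

Lemma CkS D k f : open D -> Ck D k.+1 f -> Ck D k f.
Proof.
move=> oD; elim: k f => [|k IH] f Cf; first exact: Ck1_continuous.
by move=> h; have [d C'] := Cf h; split => //; exact: IH.
Qed.

Lemma Ck_le D k k' f : open D -> (k <= k')%N -> Ck D k' f -> Ck D k f.
Proof.
move=> oD; elim: k' => [|k' IH]; first by rewrite leqn0 => /eqP ->.
rewrite leq_eqVlt => /predU1P[-> //|]; rewrite ltnS => kk Cf.
by apply: IH => //; exact: CkS.
Qed.

Lemma Ck_mul D k f g : open D -> Ck D k f -> Ck D k g ->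
  Ck D k (fun x => f x * g x).
Proof.
move=> oD; elim: k f g => [|k IH] f g Cf Cg.
  by move=> x Dx; apply: (@continuousM R V); [exact: Cf | exact: Cg].
move=> h; have [df C'f] := Cf h; have [dg C'g] := Cg h; split.
  by move=> x Dx; apply: derivableM; [exact: df | exact: dg].
apply: (@Ck_eq _ _ _ oD k (fun x => f x * 'D_h g x + g x * 'D_h f x)).
  by move=> x Dx; rewrite deriveM //; [exact: df | exact: dg].
by apply: CkD => //; apply: IH => //; exact: CkS.
Qed.

Lemma Ck_inv D k f : open D -> (forall x, D x -> f x != 0) -> Ck D k f ->
  Ck D k (fun x => (f x)^-1).
Proof.
move=> oD nz; elim: k => [|k IH] Cf.
  by move=> x Dx; apply: (@continuousV R V); [exact: nz | exact: Cf].
move=> h; have [df C'f] := Cf h; split.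
  by move=> x Dx; apply: derivableV; [exact: nz | exact: df].
apply: (@Ck_eq _ _ _ oD k (fun x => (- 1) * ((f x)^-1 * (f x)^-1 * 'D_h f x))).
  move=> x Dx; rewrite deriveV; [|exact: nz|exact: df].
  by rewrite -[_ *: _]/(_ * _) expr2 invfM mulN1r mulNr.
apply: CkM => //; do !apply: Ck_mul => //; exact: IH (CkS oD Cf).
Qed.

Lemma Ck_local D k f :
  (forall x, D x -> exists D', [/\ open D', D' x & Ck D' k f]) -> Ck D k f.
Proof.
elim: k f => [|k IH] f H.
  by move=> x Dx; have [D' [_ D'x C]] := H x Dx; exact: C.
move=> h; split.
  by move=> x Dx; have [D' [_ D'x C]] := H x Dx; have [+ _] := C h; apply.
apply: IH => x Dx; have [D' [oD' D'x C]] := H x Dx; exists D'; split => //.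
by have [] := C h.
Qed.

Lemma Ck_sub D D' k f : D' `<=` D -> Ck D k f -> Ck D' k f.
Proof.
move=> s; elim: k f => [|k IH] f C; first by move=> x /s; exact: C.
by move=> h; have [d C'] := C h; split; [move=> x /s; exact: d | exact: IH].
Qed.

Lemma Ck_sum D k (I : Type) (r : seq I) (P : pred I) (F : I -> V -> R) :
  open D -> (forall i, P i -> Ck D k (F i)) ->
  Ck D k (fun x => \sum_(i <- r | P i) F i x).
Proof.
move=> oD H; elim: r => [|i r IH].
  apply: (@Ck_eq _ _ _ oD k (fun=> 0)); last exact: Ck_cst.
  by move=> x _; rewrite big_nil.
apply: (@Ck_eq _ _ _ oD k (fun x => (if P i then F i x else 0) +
   \sum_(i <- r | P i) F i x)).
  by move=> x _; rewrite big_cons; case: (P i); rewrite ?add0r.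
apply: CkD => //; case Pi: (P i); [exact: H | exact: Ck_cst].
Qed.

End C1.

Section Composition.
Variables (R : realType) (m n m' n' : nat).
Notation V := 'M[R]_(m, n).
Notation V' := 'M[R]_(m', n').

Lemma mx_continuous (T : topologicalType) (F : T -> V') (x : T) :
  (forall i j, {for x, continuous (fun y => F y i j)}) -> {for x, continuous F}.
Proof.
move=> H; apply/(@cvgrPdist_le R V' T (nbhs x) (nbhs_filter x)) => e e0.
have : \forall y \near x, forall p : 'I_m' * 'I_n', `|F x p.1 p.2 - F y p.1 p.2| <= e.
  apply: (@filter_forall _ ('I_m' * 'I_n')%type (fun p y =>
    `|F x p.1 p.2 - F y p.1 p.2| <= e) _ (nbhs_filter x)) => p.
  have := H p.1 p.2.
  by move=> /(@cvgrPdist_le R R^o T (nbhs x) (nbhs_filter x)) /(_ _ e0).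
apply: filterS => y Hy; apply: mx_norm_le; first exact: ltW.
by move=> i j; rewrite !mxE; exact: (Hy (i, j)).
Qed.

Lemma is_derive_curve (f : V' -> R) (c : R -> V') (t : R) (v : V') :
  (forall i j, is_derive t 1 (fun r => c r i j) (v i j)) ->
  differentiable f (c t) -> is_derive t 1 (f \o c) ('d f (c t) v).
Proof.
move=> H df.
have dc : derivable c t 1 by apply/derivable_mxP => i j; have [] := H i j.
have Dc : 'D_1 c t = v.
  by rewrite derive_mx //; apply/matrixP => i j; rewrite mxE; have [] := H i j.
have dc' : differentiable c t by exact/derivable1_diffP.
have dfc : differentiable (f \o c) t by exact: differentiable_comp.
split; first exact/derivable1_diffP.
by rewrite deriveE // diff_comp //= -Dc deriveE.
Qed.

Lemma is_derive_comp_mx (f : V' -> R) (F : V -> V') (x h : V) (v : V') :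
  (forall i j, is_derive x h (fun y => F y i j) (v i j)) ->
  differentiable f (F x) -> is_derive x h (f \o F) ('d f (F x) v).
Proof.
move=> H df; pose c (r : R) := F (x + r *: h).
have c0 : c 0 = F x by rewrite /c scale0r addr0.
apply: is_derive_of_line.
have -> : 'd f (F x) v = 'd f (c 0) v by rewrite c0.
apply: (@is_derive_curve f c 0 v); last by rewrite c0.
move=> i j; apply: (@is_derive_line R V (fun y => F y i j) x h 0 (v i j)).
by rewrite scale0r addr0.
Qed.

Variables (D : set V) (D' : set V').
Hypotheses (oD : open D) (oD' : open D').

Lemma derive_comp_mx (f : V' -> R) (F : V -> V') (x h : V) :
  Ck D' 1 f -> D' (F x) -> (forall i j, derivable (fun y => F y i j) x h) ->
  is_derive x h (f \o F)
    (\sum_(p : 'I_m' * 'I_n') 'D_h (fun y => F y p.1 p.2) x *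
       'D_(delta_mx p.1 p.2) f (F x)).
Proof.
move=> Cf D'F H; have [d E] := C1_diff oD' Cf D'F.
pose v := \matrix_(i, j) 'D_h (fun y => F y i j) x.
have -> : (\sum_(p : 'I_m' * 'I_n') 'D_h (fun y => F y p.1 p.2) x *
       'D_(delta_mx p.1 p.2) f (F x)) = 'd f (F x) v.
  by rewrite E /partial_lin; apply: eq_bigr => p _; rewrite mxE.
apply: is_derive_comp_mx => // i j; rewrite mxE.
by apply: DeriveDef; first exact: H.
Qed.

(** The chain rule writes a derivative of [f \o F] as a sum of products in which partial derivatives
    of [f] are again composed with [F]; hence the induction on [k] with [f] varying. *)
Lemma Ck_comp k (f : V' -> R) (F : V -> V') :
  (forall x, D x -> D' (F x)) ->
  (forall i j, Ck D k (fun x => F x i j)) ->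
  Ck D' k f -> Ck D k (f \o F).
Proof.
move=> DD' CF; elim: k f CF => [|k IH] f CF Cf.
  move=> x Dx; apply: continuous_comp; last exact: Cf (DD' _ Dx).
  by apply: mx_continuous => i j; exact: CF.
have Cf1 : Ck D' 1 f by exact: Ck_le Cf.
move=> h; split.
  move=> x Dx; have [] // := @derive_comp_mx f F x h Cf1 (DD' _ Dx) _.
  by move=> i j; have [+ _] := CF i j h; exact.
apply: (@Ck_eq _ _ _ oD k (fun x => \sum_(p : 'I_m' * 'I_n')
   'D_h (fun y => F y p.1 p.2) x * 'D_(delta_mx p.1 p.2) f (F x))).
  move=> x Dx; have [] // := @derive_comp_mx f F x h Cf1 (DD' _ Dx) _.
  by move=> i j; have [+ _] := CF i j h; exact.
apply: Ck_sum => // p _; apply: Ck_mul => //.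
  by have [_] := CF p.1 p.2 h.
apply: (IH ('D_(delta_mx p.1 p.2) f)).
  by move=> i j; exact: CkS.
by have [_] := Cf (delta_mx p.1 p.2).
Qed.

Lemma Ck_entry k i j : Ck D k (fun x : V => x i j).
Proof.
have de (x h : V) : is_derive x h (fun x : V => x i j) (h i j).
  have := @derivable_id R V x h; move=> /derivable_mxP /(_ i j) d.
  split => //; have := @derive_id R V x h => /matrixP /(_ i j).
  by rewrite derive_mx ?mxE.
case: k => [|k]; first by move=> x _; exact: coord_continuous.
move=> h; split; first by move=> x _; have [] := de x h.
apply: (@Ck_eq _ _ _ oD k (fun=> h i j)); last exact: Ck_cst.
by move=> x _; have [_ ->] := de x h.
Qed.

End Composition.

Section Scalar.
Variables (R : realType) (m n : nat).
Notation V := 'M[R]_(m, n).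
Variables (D : set V) (E : set R).
Hypotheses (oD : open D) (oE : open E).

Lemma derive_comp_scalar (f : R -> R) (u : V -> R) (x h : V) (df du : R) :
  is_derive (u x) 1 f df -> is_derive x h u du ->
  is_derive x h (f \o u) (df * du).
Proof.
move=> Hf [d1 v1].
have Hu : is_derive (0 : R) 1 (fun r : R => u (x + r *: h)) du.
  by apply: is_derive_line; rewrite scale0r addr0; split.
have Hf' : is_derive (u (x + (0 : R) *: h)) 1 f df by rewrite scale0r addr0.
exact: is_derive_of_line (is_derive1_comp Hf' Hu).
Qed.

Lemma Ck_comp_scalar k (f : R -> R) (u : V -> R) :
  (forall x, D x -> E (u x)) -> Ck D k u -> Ck E k f -> Ck D k (f \o u).
Proof.
move=> DE; elim: k f => [|k IH] f Cu Cf.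
  by move=> x Dx; apply: continuous_comp; [exact: Cu | exact: Cf (DE _ Dx)].
move=> h; have dc x : D x -> is_derive x h (f \o u) ('D_1 f (u x) * 'D_h u x).
  move=> Dx; apply: derive_comp_scalar; apply: DeriveDef => //.
    by have [+ _] := Cf 1; apply; exact: DE.
  by have [+ _] := Cu h; apply.
split; first by move=> x /dc[].
apply: (@Ck_eq _ _ _ oD k (fun x => 'D_1 f (u x) * 'D_h u x)).
  by move=> x /dc[_ ->].
apply: Ck_mul => //; last by have [_] := Cu h.
by apply: (IH ('D_1 f)); [exact: CkS | have [_] := Cf 1].
Qed.

Lemma Ck_scalarS k (f f' : R -> R) :
  (forall x, E x -> is_derive x 1 f (f' x)) -> Ck E k f' -> Ck E k.+1 f.
Proof.
move=> H Cf' h.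
have dh x : E x -> is_derive x h f (h * f' x).
  move=> /H Hx; have := is_derive_scale h Hx.
  by rewrite -[h *: 1]/(h * 1) mulr1.
split; first by move=> x /dh[].
apply: (@Ck_eq _ _ _ oE k (fun x => h * f' x)); first by move=> x /dh[_ ->].
exact: CkM.
Qed.

Lemma Ck_scalar0 (f f' : R -> R) :
  (forall x, E x -> is_derive x 1 f (f' x)) -> Ck E 0 f.
Proof.
move=> H x /H[d _]; apply: differentiable_continuous.
exact/derivable1_diffP.
Qed.

End Scalar.

Lemma Ck_expR (R : realType) k : Ck [set: R] k (@expR R).
Proof.
elim: k => [|k IH]; first by move=> x _; exact: continuous_expR.
by apply: (Ck_scalarS openT _ IH) => x _; exact: is_derive_expR.
Qed.

(** * Integration along segments *)

Section UnitIntegral.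
Variable R : realType.
Implicit Types g : R -> R.

Definition int01 g : R := \int[lebesgue_measure]_(r in `[0, 1]) g r.

Lemma int01_integrable g : continuous g ->
  lebesgue_measure.-integrable (`[0, 1]%classic : set R) (EFin \o g).
Proof.
move=> cg; apply: continuous_compact_integrable; first exact: segment_compact.
exact: continuous_subspaceT.
Qed.

Lemma int01_eq g g' : (forall r, 0 <= r <= 1 -> g r = g' r) -> int01 g = int01 g'.
Proof.
by move=> H; apply: eq_Rintegral => r; rewrite inE /= in_itv /= => /H.
Qed.

Lemma cont_addR g g' : continuous g -> continuous g' ->
  continuous (fun r => g r + g' r).
Proof. by move=> c c' r; apply: cvgD; [exact: c | exact: c']. Qed.

Lemma int01D g g' : continuous g -> continuous g' ->
  int01 (fun r => g r + g' r) = int01 g + int01 g'.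
Proof. by move=> c c'; rewrite /int01 RintegralD //; exact: int01_integrable. Qed.

Lemma int01Z c g : continuous g -> int01 (fun r => c * g r) = c * int01 g.
Proof. by move=> cg; rewrite /int01 RintegralZl //; exact: int01_integrable. Qed.

Lemma int01_cst c : int01 (fun=> c) = c.
Proof.
have L : fine (lebesgue_measure (`[0, 1]%classic : set R)) = 1.
  by rewrite lebesgue_measure_itv /= lte_fin ltr01 -EFinB subr0.
by rewrite /int01 Rintegral_cst // [X in _ * X]L mulr1.
Qed.

Lemma int01_bound g c : continuous g -> (forall r, 0 <= r <= 1 -> `|g r| <= c) ->
  `|int01 g| <= c.
Proof.
move=> cg H; have ig := int01_integrable cg.
apply: le_trans (le_normr_Rintegral _ ig) _ => //.
rewrite -[leRHS]int01_cst /int01; apply: le_Rintegral => //.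
- by have := integrable_norm ig.
- by apply: (@int01_integrable (fun=> c)); exact: cst_continuous.
Qed.

Lemma int01_FTC (G g : R -> R) : continuous g ->
  (forall r : R, is_derive r 1 G (g r)) -> int01 g = G 1 - G 0.
Proof.
move=> cg dG; rewrite /int01 /Rintegral.
have cG : continuous G.
  move=> r; apply: differentiable_continuous; apply/derivable1_diffP.
  by have [] := dG r.
rewrite (@continuous_FTC2 R g G 0 1) //.
- exact: continuous_subspaceT.
- split; first by move=> r _; have [] := dG r.
    by apply: cvg_at_right_filter; exact: cG.
  by apply: cvg_at_left_filter; exact: cG.
- by move=> r _; rewrite derive1E; have [_] := dG r.
Qed.

End UnitIntegral.

Section LineIntegral.
Variables (R : realType) (V : normedModType R) (w : R -> R) (lam : V).
Hypotheses (cw : continuous w) (w1 : forall r, 0 <= r <= 1 -> `|w r| <= 1).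
Implicit Types f : V -> R.

Definition line_int f (x : V) : R := int01 (fun r => w r * f (x + r *: lam)).

Lemma line_continuous (x h : V) : continuous (fun r : R => x + r *: h).
Proof. by move=> r; apply: cvgD; [exact: cvg_cst | exact: scalel_continuous]. Qed.

Lemma line_int_continuous f x : continuous f ->
  continuous (fun r => w r * f (x + r *: lam)).
Proof.
move=> cf r; apply: cvgM; first exact: cw.
apply: (@continuous_comp _ _ _ (fun r : R => x + r *: lam) f).
  exact: line_continuous.
exact: cf.
Qed.

Lemma line_int_continuousZ c f x : continuous f ->
  continuous (fun r => c * (w r * f (x + r *: lam))).
Proof.
by move=> cf r; apply: cvgM; [exact: cvg_cst | exact: line_int_continuous].
Qed.

(** Compactness of [[0, 1]] turns joint continuity into an estimate uniform in [r], which lets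
    limits pass under the integral sign. *)
Lemma tube f (x : V) (e : R) : continuous f -> 0 < e ->
  \forall y \near x, forall r, 0 <= r <= 1 ->
    `|f (y + r *: lam) - f (x + r *: lam)| <= e.
Proof.
move=> cf e0.
have K := (compact_near_coveringP (`[0, 1]%classic : set R)).1
  (@segment_compact R 0 1).
have KH := K V (nbhs x) (fun y r => `|f (y + r *: lam) - f (x + r *: lam)| <= e)
  (nbhs_filter x).
suff H (r : R) : \forall r' \near r & y \near x,
    `|f (y + r' *: lam) - f (x + r' *: lam)| <= e.
  have := KH (fun r _ => H r); apply: filterS => y Hy r rr; apply: Hy.
  by rewrite /= in_itv.
have c2 : {for (r, x), continuous (fun z : R * V => f (z.2 + z.1 *: lam))}.
  apply: continuous_comp; last exact: cf.
  apply: cvgD; first exact: cvg_snd.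
  by apply: cvgZr_tmp; exact: cvg_fst.
have e2 : 0 < e / 2 by exact: divr_gt0.
have /cvgrPdist_le /(_ _ e2) H2 := c2.
have c1 : {for r, continuous (fun r : R => f (x + r *: lam))}.
  by apply: continuous_comp; [exact: line_continuous | exact: cf].
have /cvgrPdist_le /(_ _ e2) H1 := c1.
have H1' : \forall z \near (r, x),
    `|f (x + r *: lam) - f (x + z.1 *: lam)| <= e / 2.
  exact: (cvg_fst H1).
move: H2 H1'; apply: filterS2 => z /= A B.
rewrite (splitr e) -(subrKA (f (x + r *: lam))).
apply: le_trans (ler_normD _ _) _; apply: lerD => //.
by rewrite distrC.
Qed.

Lemma line_intD f g x : continuous f -> continuous g ->
  line_int (fun y => f y + g y) x = line_int f x + line_int g x.
Proof.
move=> cf cg; rewrite /line_int -int01D; try exact: line_int_continuous.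
by apply: int01_eq => r _; rewrite mulrDr.
Qed.

Lemma line_intZ c f x : continuous f ->
  line_int (fun y => c * f y) x = c * line_int f x.
Proof.
move=> cf; rewrite /line_int -int01Z; last exact: line_int_continuous.
by apply: int01_eq => r _; rewrite mulrCA.
Qed.

Lemma line_int_cont f : continuous f -> continuous (line_int f).
Proof.
move=> cf x; apply/cvgrPdist_le => e e0.
have := tube x cf e0; apply: filterS => y Hy.
have -> : line_int f x - line_int f y =
    int01 (fun r => w r * f (x + r *: lam) + (-1) * (w r * f (y + r *: lam))).
  rewrite int01D ?int01Z ?mulN1r //; try exact: line_int_continuous.
  move=> r; apply: cvgM; first exact: cvg_cst.
  exact: line_int_continuous.
apply: int01_bound.
  move=> r; apply: cvgD; first exact: line_int_continuous.
  by apply: cvgM; [exact: cvg_cst | exact: line_int_continuous].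
move=> r rr; rewrite mulN1r -mulrBr normrM -[e]mul1r ler_pM // ?w1 //.
by rewrite distrC; exact: Hy.
Qed.

(** The mean value theorem replaces the difference quotient of the integrand by a derivative at a
    nearby point, and [tube] makes the error uniform in the integration variable. *)
Lemma line_int_derive f x h : continuous f -> (forall y, derivable f y h) ->
  continuous ('D_h f) -> is_derive x h (line_int f) (line_int ('D_h f) x).
Proof.
move=> cf df cdf.
have key : (fun k : R => k^-1 *: (line_int f (k *: h + x) - line_int f x))
    @ 0^' --> line_int ('D_h f) x.
  apply/cvgrPdist_le => e e0.
  have := tube x cdf e0.
  move=> /nbhs_normP[d /= d0 Hd].
  have nk : \forall k \near (0 : R)^', `|k *: h| < d.
    have c0 : (fun k : R => k *: h) @ (0 : R) --> (0 : R) *: h.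
      exact: scalel_continuous.
    move: c0; rewrite scale0r => /cvgrPdist_lt /(_ _ d0) c0.
    apply: nbhs_dnbhs; move: c0; apply: filterS => k.
    by rewrite sub0r normrN.
  near=> k.
  have k0 : k != 0 by near: k; exact: nbhs_dnbhs_neq.
  have kd : `|k *: h| < d by near: k.
  have -> : line_int ('D_h f) x - k^-1 *: (line_int f (k *: h + x) - line_int f x)
     = int01 (fun r => w r * 'D_h f (x + r *: lam) +
        (- k^-1 * (w r * f (k *: h + x + r *: lam)) +
         k^-1 * (w r * f (x + r *: lam)))).
    rewrite !int01D ?int01Z; do ?exact: line_int_continuous.
    - by rewrite -/(line_int _ _) -[_ *: _]/(_ * _) /line_int; ring.
    all: try exact: line_int_continuousZ.
    - exact: (@line_int_continuous ('D_h f) x cdf).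
    - by apply: cont_addR; exact: line_int_continuousZ.
  apply: int01_bound.
    apply: cont_addR; first exact: (@line_int_continuous ('D_h f) x cdf).
    by apply: cont_addR; exact: line_int_continuousZ.
  move=> r rr.
  have [|t /andP[t0 t1]] := @MVT_line R V f (x + r *: lam) (k *: h).
    by move=> t _; have [] := is_derive_scale k (derivableP (df (x + r *: lam + t *: (k *: h)))).
  rewrite derive_scale // => E.
  have -> : w r * 'D_h f (x + r *: lam) +
        (- k^-1 * (w r * f (k *: h + x + r *: lam)) +
         k^-1 * (w r * f (x + r *: lam))) =
     w r * ('D_h f (x + r *: lam) - k^-1 * (f (x + r *: lam + k *: h) - f (x + r *: lam))).
    by rewrite -addrA [k *: h + _]addrC; ring.
  rewrite E mulKf // normrM -[e]mul1r ler_pM // ?w1 //.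
  rewrite distrC addrAC; apply: Hd => //.
  rewrite /ball_ /= opprD addrA subrr sub0r normrN normrZ ger0_norm //.
  by apply: le_lt_trans kd; rewrite ler_piMl.
split; first by apply/cvg_ex; eexists; exact: key.
exact: (cvg_lim _ key).
Unshelve. all: by end_near. Qed.

End LineIntegral.

Section LineIntegralSmooth.
Variables (R : realType) (m n : nat).
Notation V := 'M[R]_(m, n).
Variables (w : R -> R) (lam : V).
Hypotheses (cw : continuous w) (w1 : forall r, 0 <= r <= 1 -> `|w r| <= 1).
Implicit Types f : V -> R.

Lemma Ck0_continuous f : Ck setT 0 f -> continuous f.
Proof. by move=> Cf x; exact: Cf. Qed.

Lemma Ck_continuous k f : Ck setT k f -> continuous f.
Proof. by move=> Cf; apply: Ck0_continuous; exact: (Ck_le openT (leq0n k) Cf). Qed.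

Lemma line_int_derive_C1 f x h : Ck setT 1 f ->
  is_derive x h (line_int w lam f) (line_int w lam ('D_h f) x).
Proof.
move=> Cf; have [d c] := Cf h; apply: line_int_derive => //.
- exact: Ck_continuous Cf.
- by move=> y; exact: d.
- exact: (@Ck_continuous 0 ('D_h f) c).
Qed.

Lemma Ck_line_int k f : Ck setT k f -> Ck setT k (line_int w lam f).
Proof.
elim: k f => [|k IH] f Cf.
  by move=> x _; apply: line_int_cont => //; exact: Ck_continuous Cf.
have C1 : Ck setT 1 f by exact: (Ck_le openT _ Cf).
move=> h; split; first by move=> x _; have [] := line_int_derive_C1 x h C1.
apply: (@Ck_eq _ _ _ openT k (line_int w lam ('D_h f))).
  by move=> x _; have [_ ->] := line_int_derive_C1 x h C1.
by apply: IH; have [] := Cf h.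
Qed.

End LineIntegralSmooth.

(** * Integral mean value formulas and symmetry of second derivatives *)

Section Schwarz.
Variables (R : realType) (m n : nat).
Notation V := 'M[R]_(m, n).
Implicit Types f : V -> R.

Lemma mean_line_int f (x h : V) : Ck setT 1 f ->
  f (x + h) - f x = line_int (fun=> 1) h ('D_h f) x.
Proof.
move=> Cf; have [d c] := Cf h.
have c1 : continuous (fun _ : R => 1 : R) by exact: cst_continuous.
have dG (r : R) : is_derive r 1 (fun r => f (x + r *: h)) (1 * 'D_h f (x + r *: h)).
  by rewrite mul1r; apply: is_derive_line; apply: DeriveDef => //; exact: d.
have cg := @line_int_continuous _ _ _ h c1 _ x (@Ck_continuous _ _ _ 0 ('D_h f) c).
by rewrite /line_int (int01_FTC cg dG) scale1r scale0r addr0.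
Qed.

(** Integration by parts: the weight [1 - r] has derivative [-1], vanishes at [r = 1] and equals 1
    at [r = 0], so the only boundary term is [f x]. *)
Lemma linear_taper_int f (x h : V) : Ck setT 1 f ->
  line_int (fun r => 1 - r) h ('D_h f) x = line_int (fun=> 1) h f x - f x.
Proof.
move=> Cf; have [d c] := Cf h.
have cf := Ck_continuous Cf.
have cw : continuous (fun r : R => 1 - r).
  by move=> r; apply: cvgB; [exact: cvg_cst | exact: cvg_id].
have c1 : continuous (fun r : R => 1 * f (x + r *: h)).
  by apply: line_int_continuous => //; exact: cst_continuous.
have c2 : continuous (fun r : R => (1 - r) * 'D_h f (x + r *: h)).
  exact: (@line_int_continuous _ _ _ h cw _ x (@Ck_continuous _ _ _ 0 ('D_h f) c)).
apply/eqP; rewrite eq_sym addrC eq_sym -subr_eq; apply/eqP.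
rewrite /line_int -[X in _ - X]mul1r -mulNr -int01Z // -int01D //; last first.
  by move=> r; apply: cvgM; [exact: cvg_cst | exact: c1].
have dG (r : R) : is_derive r 1 (fun r => (1 - r) * f (x + r *: h))
    ((1 - r) * 'D_h f (x + r *: h) + -1 * (1 * f (x + r *: h))).
  have Hf : is_derive r 1 (fun r => f (x + r *: h)) ('D_h f (x + r *: h)).
    by apply: is_derive_line; apply: DeriveDef => //; exact: d.
  have Hw : is_derive r 1 (fun r : R => 1 - r) (-1).
    by rewrite -[-1]add0r; apply: is_deriveB.
  have := is_deriveM Hw Hf.
  rewrite -[X in is_derive _ _ _ (X + _)]/(_ * _) -[X in is_derive _ _ _ (_ + X)]/(_ * _).
  by move=> H; apply: is_derive_eq H _; ring.
have cc : continuous (fun r : R => (1 - r) * 'D_h f (x + r *: h) +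
    -1 * (1 * f (x + r *: h))).
  apply: cont_addR; first exact: c2.
  by move=> r; apply: cvgM; [exact: cvg_cst | exact: c1].
rewrite (int01_FTC cc dG).
by rewrite subrr mul0r subr0 scale0r addr0 mul1r sub0r.
Qed.

(** The increment [f (y + t *: h) - f y] is [t] times a segment average of ['D_h f]. Differentiating
    it along [k] under the integral and letting [t] tend to 0 leaves ['D_k ('D_h f)], by continuity
    of the latter. *)
Lemma Schwarz f (x h k : V) : Ck setT 2 f ->
  'D_h ('D_k f) x = 'D_k ('D_h f) x.
Proof.
move=> Cf; have C1 : Ck setT 1 f by exact: (Ck_le openT _ Cf).
have [dh ch] := Cf h; have [dk ck] := Cf k.
have c1 : continuous (fun _ : R => 1 : R) by exact: cst_continuous.
have n1 (r : R) : 0 <= r <= 1 -> `|1 : R| <= 1 by rewrite normr1.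
have E (t : R) : 'D_k f (x + t *: h) - 'D_k f x =
    t * line_int (fun=> 1) (t *: h) ('D_k ('D_h f)) x.
  have H1 : is_derive x k (fun y => f (y + t *: h) - f y)
      ('D_k f (x + t *: h) - 'D_k f x).
    apply: is_deriveB; last by apply: DeriveDef => //; exact: dk.
    apply: is_derive_of_line.
    have -> : (fun r => f (x + r *: k + t *: h)) = (fun r => f (x + t *: h + r *: k)).
      by apply/funext => r; rewrite addrAC.
    apply: is_derive_line; rewrite scale0r addr0.
    by apply: DeriveDef => //; exact: dk.
  have [_ <-] := H1.
  have -> : (fun y => f (y + t *: h) - f y) =
     (fun y => t * line_int (fun=> 1) (t *: h) ('D_h f) y).
    apply/funext => y; rewrite mean_line_int //.
    have -> : 'D_(t *: h) f = fun y => t * 'D_h f y.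
      by apply/funext => z; rewrite derive_scale //; exact: dh.
    by rewrite line_intZ //; exact: (@Ck_continuous _ _ _ 1 ('D_h f) ch).
  have H2 := line_int_derive_C1 (t *: h) c1 n1 x k ch.
  by have [_ ->] := is_deriveZ t H2.
have [_ <-] : is_derive x h ('D_k f) ('D_k ('D_h f) x); last by [].
have [_ ckh] := ch k.
have ckh' := @Ck_continuous _ _ _ 0 _ ckh.
have key : (fun t : R => t^-1 *: ('D_k f (t *: h + x) - 'D_k f x)) @ 0^' -->
    'D_k ('D_h f) x.
  apply/cvgrPdist_le => e e0.
  have := ckh' x; move=> /cvgrPdist_le /(_ _ e0) /nbhs_normP[d /= d0 Hd].
  have nt : \forall t \near (0 : R)^', `|t *: h| < d.
    have c0 : (fun t : R => t *: h) @ (0 : R) --> (0 : R) *: h.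
      exact: scalel_continuous.
    move: c0; rewrite scale0r => /cvgrPdist_lt /(_ _ d0) c0.
    apply: nbhs_dnbhs; move: c0; apply: filterS => t.
    by rewrite sub0r normrN.
  near=> t.
  have t0 : t != 0 by near: t; exact: nbhs_dnbhs_neq.
  have td : `|t *: h| < d by near: t.
  rewrite [t *: h + x]addrC E -[_ *: _]/(_ * _) mulKf //.
  have cc := @line_int_continuous _ _ _ (t *: h) c1 _ x ckh'.
  rewrite /line_int -[X in X - _]int01_cst -[X in _ - X]mul1r -mulNr -int01Z //.
  have c3 : continuous (fun r : R => - 1 * (1 * 'D_k ('D_h f) (x + r *: (t *: h)))).
    by move=> r; apply: cvgM; [exact: cvg_cst | exact: cc].
  have c4 : continuous (fun _ : R => 'D_k ('D_h f) x) by exact: cst_continuous.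
  rewrite -int01D //.
  apply: int01_bound; first exact: cont_addR.
  move=> r /andP[r0 r1]; rewrite mul1r mulN1r; apply: Hd.
  rewrite /ball_ /= opprD addrA subrr sub0r normrN normrZ ger0_norm //.
  by apply: le_lt_trans td; rewrite ler_piMl.
split; first by apply/cvg_ex; eexists; exact: key.
exact: (cvg_lim _ key).
Unshelve. all: by end_near. Qed.

End Schwarz.

(** * Smooth complex-valued functions *)

Section Bump.
Variable R : realType.

(* [flat k] is [x^-k exp (-1/x)], extended by [0] to [x <= 0]. *)
Definition flat (k : nat) (x : R) : R :=
  if 0 < x then x ^- k * expR (- x^-1) else 0.

Lemma flat_le0 k x : x <= 0 -> flat k x = 0.
Proof. by move=> x0; rewrite /flat ltNge x0. Qed.

Lemma flat_gt0 k x : 0 < x -> 0 < flat k x.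
Proof. by move=> x0; rewrite /flat x0 mulr_gt0 ?expR_gt0 ?invr_gt0 ?exprn_gt0. Qed.

Lemma flat_ge0 k x : 0 <= flat k x.
Proof. by have [/flat_le0 ->|/flat_gt0 /ltW] := leP x 0. Qed.

Lemma flat_bound k : exists2 C : R, 0 < C & forall x, flat k x <= C * `|x|.
Proof.
pose n : R := k.+1%:R; have n0 : 0 < n by rewrite ltr0n.
(* The constant comes from [(u / n) ^+ k.+1 <= expR u] with [n = k.+1] and [u = x^-1]: one power
   more than in [x ^- k] leaves the factor [x]. *)
exists (n ^+ k.+1); first exact: exprn_gt0.
move=> x; have [x0|x0] := leP x 0.
  by rewrite flat_le0 // mulr_ge0 // exprn_ge0 // ltW.
rewrite /flat x0 (gtr0_norm x0) expRN.
rewrite ler_pdivrMr ?expR_gt0 // mulrAC.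
have : (x^-1 / n) ^+ k.+1 <= expR x^-1.
  have -> : x^-1 = k.+1%:R * (x^-1 / n) by rewrite mulrC divfK ?gt_eqF.
  rewrite expRM_natl; apply: lerXn2r; rewrite ?nnegrE ?expR_ge0 //.
    by rewrite mulrC mulKf ?gt_eqF // divr_ge0 // ?invr_ge0 ltW.
  rewrite mulrC mulKf ?gt_eqF //.
  by apply: le_trans (expR_ge1Dx _); rewrite lerDr.
rewrite expr_div_n ler_pdivrMr ?exprn_gt0 // [_ * n ^+ _]mulrC => H.
apply: le_trans (_ : x^-1 ^+ k.+1 * x <= _); last by rewrite ler_pM2r.
by rewrite exprS mulrAC mulVf ?gt_eqF // mul1r exprVn.
Qed.

(** The span of the family is stable under differentiation, so all its members are smooth by one
    induction. At 0, from the right, the difference quotient of [flat k] is [flat k.+1], which tends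
    to 0 by [flat_bound]. *)
Lemma is_derive_flat k (x : R) :
  is_derive x 1 (flat k) (- k%:R * flat k.+1 x + flat k.+2 x).
Proof.
have [x0|x0|->] := ltgtP x 0.
- rewrite !flat_le0 ?(ltW x0) // mulr0 addr0.
  apply: (@near_eq_is_derive _ _ _ (fun=> 0) (flat k)).
  + have := lt_nbhsl x0; apply: filterS => y /ltW y0; by rewrite flat_le0.
- have E j : flat j x = x ^- j * expR (- x^-1) by rewrite /flat x0.
  rewrite !E.
  have nE : \near x, x^-1 ^+ k * expR (- x^-1) = flat k x.
    by have := lt_nbhsr x0; apply: filterS => y y0; rewrite /flat y0 exprVn.
  apply: (near_eq_is_derive nE).
  + have x0' : x != 0 by rewrite gt_eqF.
    have Hi : is_derive x 1 (fun y : R => y^-1) (- x ^- 2).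
      have := @is_deriveV R id x 1 1 x0' (is_derive_id x 1).
      by rewrite -[_ *: _]/(_ * _) mulr1.
    have HX : is_derive x 1 (fun y : R => y^-1 ^+ k) (- (k%:R * x ^- k.+1)).
      have -> : (fun y : R => y^-1 ^+ k) = (fun y => y^-1) ^+ k.
        by apply/funext => y; rewrite exprfctE.
      have H := is_deriveX k Hi; apply: is_derive_eq H _.
      rewrite -[_ *: _]/(_ * _) mulrN; congr (- _).
      case: (k) => [|j]; first by rewrite !mul0r.
      by rewrite -mulrA exprVn -invfM -exprD addn2.
    have HE : is_derive x 1 (fun y : R => expR (- y^-1)) (x ^- 2 * expR (- x^-1)).
      have HN : is_derive x 1 (fun y : R => - y^-1) (x ^- 2).
        by rewrite -[x ^- 2]opprK; exact: is_deriveN Hi.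
      have := @is_derive1_comp R expR (fun y : R => - y^-1) x _ _
        (is_derive_expR (- x^-1)) HN.
      by rewrite mulrC.
    have := is_deriveM HX HE => H; apply: is_derive_eq H _.
    rewrite -[X in X + _]/(_ * _) -[X in _ + X]/(_ * _) exprVn.
    rewrite -[k.+2]addn2 exprD [(x ^+ k * x ^+ 2)^-1]invfM.
    move: (k%:R : R) (x ^- k) (x ^- 2) (x ^- k.+1) (expR _) => d a b c e.
    ring.
rewrite !flat_le0 // mulr0 addr0.
have [C C0 HC] := flat_bound k.+1.
have key : (fun h : R => h^-1 *: (flat k (h *: 1 + 0) - flat k 0)) @ 0^' --> (0 : R).
  apply/cvgrPdist_le => e e0.
  have nh : \forall h \near (0 : R)^', `|h| < e / C.
    by apply: dnbhs0_lt; exact: divr_gt0.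
  near=> h.
  have h0 : h != 0 by near: h; exact: nbhs_dnbhs_neq.
  have he : `|h| < e / C by near: h.
  rewrite sub0r normrN addr0 -[h *: 1]/(h * 1) mulr1 [flat k 0]flat_le0 // subr0.
  rewrite -[_ *: _]/(_ * _).
  have [hn|hp] := leP h 0; first by rewrite flat_le0 // mulr0 normr0 ltW.
  have -> : h^-1 * flat k h = flat k.+1 h.
    by rewrite /flat hp exprS invfM !mulrA.
  rewrite ger0_norm ?flat_ge0 //; apply: le_trans (HC h) _.
  by rewrite mulrC -ler_pdivlMr // ltW.
split; first by apply/cvg_ex; eexists; exact: key.
exact: (cvg_lim _ key).
Unshelve. all: by end_near. Qed.

Lemma Ck_flat j k : Ck [set: R] j (flat k).
Proof.
elim: j k => [|j IH] k.
  by apply: Ck_scalar0 => x _; exact: is_derive_flat.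
apply: (Ck_scalarS openT (fun x _ => is_derive_flat k x)).
apply: (CkD openT); last exact: IH.
by apply: CkM; [exact: openT | exact: IH].
Qed.

Definition smooth_step (x : R) : R := flat 0 x / (flat 0 x + flat 0 (1 - x)).

Lemma smooth_step_den x : flat 0 x + flat 0 (1 - x) != 0.
Proof.
rewrite gt_eqF //; have [x0|x0] := leP x 0.
  by rewrite ltr_wpDl ?flat_ge0 // flat_gt0 // subr_gt0 (le_lt_trans x0).
by rewrite ltr_pwDl ?flat_ge0 // flat_gt0.
Qed.

Lemma smooth_step_le0 x : x <= 0 -> smooth_step x = 0.
Proof. by move=> x0; rewrite /smooth_step flat_le0 // mul0r. Qed.

Lemma smooth_step_ge1 x : 1 <= x -> smooth_step x = 1.
Proof.
move=> x1; have := smooth_step_den x; rewrite /smooth_step.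
by rewrite [flat 0 (1 - x)]flat_le0 ?subr_le0 // addr0 => ?; rewrite divff.
Qed.

Lemma Ck_smooth_step m n (D : set 'M[R]_(m, n)) k u : open D ->
  Ck D k u -> Ck D k (fun x => smooth_step (u x)).
Proof.
move=> oD Cu; have C1 : Ck D k (fun x => flat 0 (u x)).
  exact: (@Ck_comp_scalar _ _ _ D setT oD k (flat 0) u (fun _ _ => I) Cu (Ck_flat _ _)).
have C2 : Ck D k (fun x => 1 - u x).
  apply: (@CkD _ _ _ oD k (fun=> 1)); first exact: Ck_cst.
  by apply: (Ck_eq oD _ (CkM oD (-1) Cu)) => x _; rewrite mulN1r.
have C3 : Ck D k (fun x => flat 0 (1 - u x)).
  exact: (@Ck_comp_scalar _ _ _ D setT oD k (flat 0) _ (fun _ _ => I) C2 (Ck_flat _ _)).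
apply: Ck_mul => //; apply: Ck_inv => //.
  by move=> x _; exact: smooth_step_den.
exact: CkD.
Qed.

End Bump.

Section ComplexParts.
Variable R : rcfType.
Implicit Types x y : R[i].

Lemma cplx_eq x y : complex.Re x = complex.Re y -> complex.Im x = complex.Im y ->
  x = y.
Proof. by case: x => a b; case: y => c d /= -> ->. Qed.

Lemma cReD x y : complex.Re (x + y) = complex.Re x + complex.Re y.
Proof. by case: x; case: y. Qed.

Lemma cImD x y : complex.Im (x + y) = complex.Im x + complex.Im y.
Proof. by case: x; case: y. Qed.

Lemma cReM x y : complex.Re (x * y) =
  complex.Re x * complex.Re y - complex.Im x * complex.Im y.
Proof. by case: x; case: y. Qed.

Lemma cImM x y : complex.Im (x * y) =
  complex.Re x * complex.Im y + complex.Im x * complex.Re y.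
Proof. by case: x => a b; case: y => c d /=; rewrite addrC. Qed.

Lemma cReN x : complex.Re (- x) = - complex.Re x.
Proof. by case: x. Qed.

Lemma cImN x : complex.Im (- x) = - complex.Im x.
Proof. by case: x. Qed.

Lemma realCB (a b : R) : (a - b)%:C = a%:C - b%:C.
Proof. by apply: cplx_eq => //=; rewrite subr0. Qed.

Lemma realCM (a b : R) : (a * b)%:C = a%:C * b%:C.
Proof. by apply: cplx_eq => /=; rewrite ?mul0r ?mulr0 ?subr0 ?addr0. Qed.

End ComplexParts.

Section ComplexSmooth.
Variables (R : realType) (m n : nat).
Notation V := 'M[R]_(m, n).
Variable D : set V.
Hypothesis oD : open D.
Implicit Types f g : V -> R[i].

Lemma smooth_eq f g : (forall x, D x -> f x = g x) -> smooth D f -> smooth D g.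
Proof.
move=> fg sf k; have [r i] := sf k.
by split; [apply: Ck_eq r | apply: Ck_eq i] => // x Dx; rewrite fg.
Qed.

Lemma smooth_cst (c : R[i]) : smooth D (fun=> c).
Proof. by move=> k; split; exact: Ck_cst. Qed.

Lemma smooth_add f g : smooth D f -> smooth D g -> smooth D (fun x => f x + g x).
Proof.
move=> sf sg; apply: smooth_eq (smooth_lin oD 1 sf sg) => x _.
by rewrite mul1r.
Qed.

Lemma smooth_scale c f : smooth D f -> smooth D (fun x => c * f x).
Proof.
move=> sf; apply: smooth_eq (smooth_lin oD c sf (smooth_cst 0)) => x _.
by rewrite addr0.
Qed.

Lemma smooth_mul f g : smooth D f -> smooth D g -> smooth D (fun x => f x * g x).
Proof.
move=> sf sg k; have [fr fi] := sf k; have [gr gi] := sg k; split.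
  apply: (Ck_eq oD _ (CkD oD (Ck_mul oD fr gr) (CkM oD (-1) (Ck_mul oD fi gi)))).
  by move=> x _; rewrite cReM mulN1r.
apply: (Ck_eq oD _ (CkD oD (Ck_mul oD fr gi) (Ck_mul oD fi gr))).
by move=> x _; rewrite cImM.
Qed.

Lemma smooth_real (u : V -> R) : (forall k, Ck D k u) -> smooth D (fun x => (u x)%:C).
Proof. by move=> Cu k; split; [exact: Cu | exact: Ck_cst]. Qed.

Lemma smooth_sum (I : Type) (r : seq I) (P : pred I) (F : I -> V -> R[i]) :
  (forall i, P i -> smooth D (F i)) -> smooth D (fun x => \sum_(i <- r | P i) F i x).
Proof.
move=> H; elim: r => [|i r IH].
  by apply: smooth_eq (smooth_cst 0) => x _; rewrite big_nil.
case Pi: (P i); last by apply: smooth_eq IH => x _; rewrite big_cons Pi.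
by apply: smooth_eq (smooth_add (H i Pi) IH) => x _; rewrite big_cons Pi.
Qed.

Lemma smooth_prod (I : Type) (r : seq I) (P : pred I) (F : I -> V -> R[i]) :
  (forall i, P i -> smooth D (F i)) -> smooth D (fun x => \prod_(i <- r | P i) F i x).
Proof.
move=> H; elim: r => [|i r IH].
  by apply: smooth_eq (smooth_cst 1) => x _; rewrite big_nil.
case Pi: (P i); last by apply: smooth_eq IH => x _; rewrite big_cons Pi.
by apply: smooth_eq (smooth_mul (H i Pi) IH) => x _; rewrite big_cons Pi.
Qed.

Lemma smooth_local f :
  (forall x, D x -> exists D', [/\ open D', D' x & smooth D' f]) -> smooth D f.
Proof.
move=> H k; split; apply: Ck_local => x Dx.
  by have [D' [oD' D'x sD]] := H x Dx; exists D'; split => //; have [] := sD k.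
by have [D' [oD' D'x sD]] := H x Dx; exists D'; split => //; have [] := sD k.
Qed.

Lemma smooth_derivable f x h : smooth D f -> D x ->
  derivable (fun y => complex.Re (f y)) x h /\
  derivable (fun y => complex.Im (f y)) x h.
Proof.
move=> sf Dx; have [/(_ h)[fr _] /(_ h)[fi _]] := sf 1%N.
by split; [exact: fr | exact: fi].
Qed.

Lemma smooth_cderive f h : smooth D f -> smooth D (fun x => cderive f x h).
Proof.
move=> sf k; have [fr fi] := sf k.+1.
by split; [have [_] := fr h | have [_] := fi h].
Qed.

Lemma cderive_cst (c : R[i]) (x h : V) : cderive (fun=> c) x h = 0.
Proof. by rewrite /cderive !derive_cst. Qed.

Lemma cderiveD f g x h : D x -> smooth D f -> smooth D g ->
  cderive (fun y => f y + g y) x h = cderive f x h + cderive g x h.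
Proof.
move=> Dx sf sg.
have -> : (fun y => f y + g y) = (fun y => 1 * f y + g y).
  by apply/funext => y; rewrite mul1r.
by rewrite (cderive_lin 1 h Dx) // mul1r.
Qed.

Lemma cderiveZ c f x h : D x -> smooth D f ->
  cderive (fun y => c * f y) x h = c * cderive f x h.
Proof.
move=> Dx sf.
have -> : (fun y => c * f y) = (fun y => c * f y + 0).
  by apply/funext => y; rewrite addr0.
by rewrite (cderive_lin c h Dx) ?cderive_cst ?addr0 //; exact: smooth_cst.
Qed.

Lemma cderive_sum (I : Type) (r : seq I) (P : pred I) (F : I -> V -> R[i]) x h :
  D x -> (forall i, P i -> smooth D (F i)) ->
  cderive (fun x => \sum_(i <- r | P i) F i x) x h =
  \sum_(i <- r | P i) cderive (F i) x h.
Proof.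
move=> Dx H; elim: r => [|i r IH].
  have -> : (fun x => \sum_(i <- [::] | P i) F i x) = (fun=> 0).
    by apply/funext => y; rewrite big_nil.
  by rewrite big_nil cderive_cst.
rewrite big_cons; case Pi: (P i); last first.
  rewrite -IH; have -> // : (fun x => \sum_(j <- i :: r | P j) F j x) =
    (fun x => \sum_(j <- r | P j) F j x).
  by apply/funext => y; rewrite big_cons Pi.
have -> : (fun x => \sum_(j <- i :: r | P j) F j x) =
    (fun x => F i x + \sum_(j <- r | P j) F j x).
  by apply/funext => y; rewrite big_cons Pi.
by rewrite cderiveD ?IH //; [exact: H | exact: smooth_sum].
Qed.

Lemma cderiveM f g x h : D x -> smooth D f -> smooth D g ->
  cderive (fun y => f y * g y) x h = cderive f x h * g x + f x * cderive g x h.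
Proof.
move=> Dx sf sg.
have [fr fi] := smooth_derivable h sf Dx; have [gr gi] := smooth_derivable h sg Dx.
have {}fr := derivableP fr; have {}fi := derivableP fi.
have {}gr := derivableP gr; have {}gi := derivableP gi.
apply: cplx_eq; rewrite ?cReD ?cImD ?cReM ?cImM /cderive /=.
  have -> : (fun y => complex.Re (f y * g y)) = (fun y => complex.Re (f y)) *
      (fun y => complex.Re (g y)) - (fun y => complex.Im (f y)) *
      (fun y => complex.Im (g y)) by apply/funext => y; rewrite cReM.
  have [_ ->] := is_deriveB (is_deriveM fr gr) (is_deriveM fi gi).
  rewrite -[X in X + _ - _]/(_ * _) -[X in _ + X - _]/(_ * _).
  rewrite -[X in _ - (X + _)]/(_ * _) -[X in _ - (_ + X)]/(_ * _).
  by ring.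
have -> : (fun y => complex.Im (f y * g y)) = (fun y => complex.Re (f y)) *
    (fun y => complex.Im (g y)) + (fun y => complex.Im (f y)) *
    (fun y => complex.Re (g y)) by apply/funext => y; rewrite cImM.
have [_ ->] := is_deriveD (is_deriveM fr gi) (is_deriveM fi gr).
rewrite -[X in X + _ + _]/(_ * _) -[X in _ + X + _]/(_ * _).
rewrite -[X in _ + (X + _)]/(_ * _) -[X in _ + (_ + X)]/(_ * _).
by ring.
Qed.

Lemma cderive_linr f x (c : R) h k : D x -> smooth D f ->
  cderive f x (c *: h + k) = c%:C * cderive f x h + cderive f x k.
Proof.
move=> Dx sf; have [fr fi] := sf 1%N.
rewrite /cderive !(derive_partial _ oD _ Dx) // !linearP.
by apply: cplx_eq; rewrite ?cReD ?cImD ?cReM ?cImM /= mul0r ?subr0 ?addr0.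
Qed.

Lemma cderive_partial f x h : D x -> smooth D f ->
  cderive f x h = \sum_(p : 'I_m * 'I_n)
    (h p.1 p.2)%:C * cderive f x (delta_mx p.1 p.2).
Proof.
move=> Dx sf; have [fr fi] := sf 1%N.
rewrite /cderive !(derive_partial h oD _ Dx) // /partial_lin.
apply: cplx_eq => /=.
  rewrite (big_morph _ (@cReD R) (erefl _)); apply: eq_bigr => p _.
  by rewrite cReM /= mul0r subr0.
rewrite (big_morph _ (@cImD R) (erefl _)); apply: eq_bigr => p _.
by rewrite cImM /= mul0r addr0.
Qed.

End ComplexSmooth.

Section ComplexComp.
Variables (R : realType) (m n m' n' : nat).
Notation V := 'M[R]_(m, n).
Notation V' := 'M[R]_(m', n').
Variables (D : set V) (D' : set V').
Hypotheses (oD : open D) (oD' : open D').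

Lemma smooth_comp (f : V' -> R[i]) (F : V -> V') :
  (forall x, D x -> D' (F x)) -> (forall k i j, Ck D k (fun x => F x i j)) ->
  smooth D' f -> smooth D (f \o F).
Proof.
move=> DD CF sf k; have [r i] := sf k; split.
  exact: (@Ck_comp _ _ _ _ _ D D' oD oD' k (fun y => complex.Re (f y)) F).
exact: (@Ck_comp _ _ _ _ _ D D' oD oD' k (fun y => complex.Im (f y)) F).
Qed.

Lemma cderive_comp (f : V' -> R[i]) (F : V -> V') (x h : V) :
  smooth D' f -> D' (F x) -> (forall i j, derivable (fun y => F y i j) x h) ->
  cderive (f \o F) x h =
    \sum_(p : 'I_m' * 'I_n') ('D_h (fun y => F y p.1 p.2) x)%:C *
       cderive f (F x) (delta_mx p.1 p.2).
Proof.
move=> sf D'F H; have [fr fi] := sf 1%N.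
have [_ Er] := derive_comp_mx oD' fr D'F H.
have [_ Ei] := derive_comp_mx oD' fi D'F H.
rewrite /cderive; apply: cplx_eq => /=.
  rewrite (big_morph _ (@cReD R) (erefl _)) Er; apply: eq_bigr => p _.
  by rewrite cReM /= mul0r subr0.
rewrite (big_morph _ (@cImD R) (erefl _)) Ei; apply: eq_bigr => p _.
by rewrite cImM /= mul0r addr0.
Qed.

End ComplexComp.

Section ComplexFull.
Variables (R : realType) (m n : nat).
Notation V := 'M[R]_(m, n).
Notation sm := (@smooth R V setT).
Implicit Types (f g : V -> R[i]) (x h lam : V).

Lemma smooth_compT f (F : V -> V) :
  (forall k i j, Ck setT k (fun x => F x i j)) -> sm f -> sm (f \o F).
Proof. by move=> CF; apply: (@smooth_comp _ _ _ _ _ setT setT) => //; exact: openT. Qed.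

Lemma smooth_translate f c : sm f -> sm (fun x => f (x + c)).
Proof.
apply: (@smooth_compT f (fun x => x + c)) => k i j.
apply: (@Ck_eq _ _ _ openT k (fun x => x i j + c i j)).
  by move=> x _; rewrite mxE.
by apply: (CkD openT); [apply: Ck_entry; exact: openT | exact: Ck_cst openT _ _].
Qed.

Lemma cderive_affine f (F : V -> V) x h h' : sm f ->
  (forall t : R, F (x + t *: h) = F x + t *: h') ->
  cderive (f \o F) x h = cderive f (F x) h'.
Proof.
move=> sf E.
have [dr di] := @smooth_derivable R m n setT f (F x) h' sf I.
suff H (u : V -> R) : derivable u (F x) h' -> 'D_h (u \o F) x = 'D_h' u (F x).
  by apply: cplx_eq; [exact: (H _ dr) | exact: (H _ di)].
move=> du; have [_ ->] // : is_derive x h (u \o F) ('D_h' u (F x)).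
apply: is_derive_of_line.
have -> : (fun r : R => (u \o F) (x + r *: h)) = (fun r => u (F x + r *: h')).
  by apply/funext => r /=; rewrite E.
by apply: is_derive_line; rewrite scale0r addr0; apply: DeriveDef.
Qed.

Lemma cderive_translate f c x h : sm f ->
  cderive (fun y => f (y + c)) x h = cderive f (x + c) h.
Proof.
move=> sf; apply: (@cderive_affine f (fun y => y + c)) => // t.
by rewrite addrAC.
Qed.

Lemma cderiveC f x h (k : V) : sm f ->
  cderive (fun y => cderive f y k) x h = cderive (fun y => cderive f y h) x k.
Proof.
move=> sf; have [r i] := sf 2%N.
by apply: cplx_eq; [exact: (Schwarz x h k r) | exact: (Schwarz x h k i)].
Qed.

Definition unit_weight (r : R) : R := 1.
Definition taper (r : R) : R := 1 - r.

Lemma unit_weightC : continuous unit_weight.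
Proof. exact: cst_continuous. Qed.

Lemma taperC : continuous taper.
Proof. by move=> r; apply: cvgB; [exact: cvg_cst | exact: cvg_id]. Qed.

Lemma unit_weight1 (r : R) : 0 <= r <= 1 -> `|unit_weight r| <= 1.
Proof. by rewrite normr1. Qed.

Lemma taper1 (r : R) : 0 <= r <= 1 -> `|taper r| <= 1.
Proof.
by move=> /andP[r0 r1]; rewrite ger0_norm ?subr_ge0 // lerBlDr lerDl.
Qed.

Definition cint w lam f x : R[i] :=
  line_int w lam (fun y => complex.Re (f y)) x +i*
  line_int w lam (fun y => complex.Im (f y)) x.

Lemma smooth_cont f : sm f -> continuous (fun y => complex.Re (f y)) /\
  continuous (fun y => complex.Im (f y)).
Proof.
move=> sf; have [r i] := sf 0%N.
by split; [exact: (Ck_continuous r) | exact: (Ck_continuous i)].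
Qed.

Section Weight.
Variable w : R -> R.
Hypotheses (cw : continuous w) (w1 : forall r, 0 <= r <= 1 -> `|w r| <= 1).

Lemma smooth_cint lam f : sm f -> sm (cint w lam f).
Proof. by move=> sf k; have [r i] := sf k; split; exact: Ck_line_int. Qed.

Lemma cderive_cint lam f x h : sm f ->
  cderive (cint w lam f) x h = cint w lam (fun y => cderive f y h) x.
Proof.
move=> sf; have [r i] := sf 1%N.
have [_ Er] := line_int_derive_C1 lam cw w1 x h r.
have [_ Ei] := line_int_derive_C1 lam cw w1 x h i.
by rewrite /cderive /cint /= Er Ei.
Qed.

Lemma cintD lam f g x : sm f -> sm g ->
  cint w lam (fun y => f y + g y) x = cint w lam f x + cint w lam g x.
Proof.
move=> /smooth_cont[fr fi] /smooth_cont[gr gi]; rewrite /cint.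
apply: cplx_eq; rewrite ?cReD ?cImD /= -line_intD //.
  by apply: int01_eq => r _; rewrite cReD.
by apply: int01_eq => r _; rewrite cImD.
Qed.

Lemma cintZ lam c f x : sm f ->
  cint w lam (fun y => c * f y) x = c * cint w lam f x.
Proof.
move=> /smooth_cont[fr fi]; rewrite /cint.
have cZ (a : R) (u : V -> R) : continuous u -> continuous (fun y => a * u y).
  by move=> cu y; apply: (@continuousM R V); [exact: cst_continuous | exact: cu].
apply: cplx_eq; rewrite ?cReM ?cImM /=.
  rewrite -mulNr -!line_intZ // -line_intD //; try exact: cZ.
  by apply: int01_eq => r _; rewrite cReM mulNr.
rewrite -!line_intZ // -line_intD //; try exact: cZ.
by apply: int01_eq => r _; rewrite cImM.
Qed.

Lemma cint_translate lam f c x :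
  cint w lam (fun y => f (y + c)) x = cint w lam f (x + c).
Proof.
by apply: cplx_eq; rewrite /cint /line_int /=; apply: int01_eq => r _; rewrite addrAC.
Qed.

End Weight.

Definition avg := cint unit_weight.
Definition prim := cint taper.

(** With Cartan's formula this makes contraction by [lam] followed by [prim lam] a homotopy between
    the identity and [avg lam]. *)
Lemma prim_derive lam f x : sm f ->
  prim lam (fun y => cderive f y lam) x = avg lam f x - f x.
Proof.
move=> sf; have [r i] := sf 1%N; rewrite /prim /avg /cint /cderive /=.
rewrite !linear_taper_int //.
by apply: cplx_eq; rewrite ?cReD ?cImD ?cReN ?cImN.
Qed.

Lemma avg_derive lam f x : sm f ->
  avg lam (fun y => cderive f y lam) x = f (x + lam) - f x.
Proof.
move=> sf; have [r i] := sf 1%N; rewrite /avg /cint /cderive /=.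
have := mean_line_int x lam r; have := mean_line_int x lam i.
rewrite /unit_weight => <- <-.
by apply: cplx_eq; rewrite ?cReD ?cImD ?cReN ?cImN.
Qed.

Lemma avg_const lam f x : (forall r : R, f (x + r *: lam) = f x) ->
  avg lam f x = f x.
Proof.
move=> H; rewrite /avg /cint /line_int; apply: cplx_eq => /=.
  rewrite -[RHS]int01_cst; apply: int01_eq => r _.
  by rewrite H /unit_weight mul1r.
rewrite -[RHS]int01_cst; apply: int01_eq => r _.
by rewrite H /unit_weight mul1r.
Qed.

(** The difference [f (x + r *: h) - f x] is the segment average of the derivative along
    [r *: h]. *)
Lemma const_along f h : sm f -> (forall x, cderive f x h = 0) ->
  forall x (r : R), f (x + r *: h) = f x.
Proof.
move=> sf H x r; apply/eqP; rewrite -subr_eq0 -avg_derive //.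
have -> : (fun y => cderive f y (r *: h)) = (fun=> 0).
  apply/funext => y; rewrite -[r *: h]addr0 (cderive_linr openT) ?H //.
  by rewrite mulr0 add0r /cderive !derive0.
rewrite /avg /cint /line_int; apply/eqP; apply: cplx_eq => /=.
  by rewrite -[RHS]int01_cst; apply: int01_eq => r' _; rewrite mulr0.
by rewrite -[RHS]int01_cst; apply: int01_eq => r' _; rewrite mulr0.
Qed.

End ComplexFull.

(** * A twisted difference equation along the orbits of one map *)

Section Telescope.
Variables (R : realType) (m n : nat).
Notation V := 'M[R]_(m, n).
Notation sm := (@smooth R V setT).
Variables (gam gam' : V -> V) (ell : V -> R) (chi : R[i]).
Hypotheses (gamK : cancel gam gam') (gamK' : cancel gam' gam).
Hypotheses (sgam : forall f, sm f -> sm (f \o gam))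
           (sgam' : forall f, sm f -> sm (f \o gam')).
Hypotheses (cell : forall k, Ck setT k ell)
           (ell_gam : forall p, ell (gam p) = ell p + 1) (chi0 : chi != 0).
Implicit Type b : V -> R[i].

Let oT : open [set: V]. Proof. exact: openT. Qed.

Lemma ell_gam' p : ell (gam' p) = ell p - 1.
Proof. by rewrite -[in RHS](gamK' p) ell_gam addrK. Qed.

Lemma ell_iter k p : ell (iter k gam p) = ell p + k%:R.
Proof.
by elim: k => [|k IH]; rewrite ?addr0 //= ell_gam IH -addrA natr1.
Qed.

Lemma ell_iter' k p : ell (iter k gam' p) = ell p - k%:R.
Proof.
elim: k => [|k IH]; rewrite ?subr0 //= ell_gam' IH.
by rewrite -addrA -opprD natr1.
Qed.

Definition past b k p : R[i] :=
  chi ^- k * (smooth_step (ell (iter k gam' p)))%:C * b (iter k gam' p).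
Definition future b k p : R[i] :=
  chi ^+ k * (1 - smooth_step (ell (iter k gam p)))%:C * b (iter k gam p).
Definition partial_solve b M p : R[i] :=
  \sum_(k < M) past b k.+1 p - \sum_(k < M) future b k p.
(** [past b k p] vanishes once [k >= ell p] and [future b k p] once [k >= 1 - ell p]. One unit of
    the shift compensates the truncation, the other this 1. *)
Definition solve_bound p : nat := (Num.truncn `|ell p|).+2.

(* A solution of [chi * xi (gam p) - xi p = b p]: split [b] with a smooth step
   along [ell] and sum each half along the orbits away from its support, so
   that the sums are locally finite. *)
Definition solve b p : R[i] := partial_solve b (solve_bound p) p.

Lemma solve_boundP p k : (solve_bound p <= k.+1)%N -> `|ell p| <= k%:R.
Proof.
rewrite ltnS => le; apply: ltW; apply: lt_le_trans (truncnS_gt _) _.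
by rewrite ler_nat.
Qed.

Lemma past0 b k p : (solve_bound p <= k.+1)%N -> past b k p = 0.
Proof.
move=> /solve_boundP H; rewrite /past smooth_step_le0 ?mulr0 ?mul0r //.
by rewrite ell_iter' subr_le0; apply: le_trans (ler_norm _) H.
Qed.

Lemma future0 b k p : (solve_bound p <= k)%N -> future b k p = 0.
Proof.
case: k => // k /solve_boundP H; rewrite /future smooth_step_ge1.
  by rewrite subrr mulr0 mul0r.
rewrite ell_iter -natr1 addrA lerDr -lerBlDl sub0r.
by apply: le_trans H; rewrite lerNl; exact: lerNnormlW.
Qed.

Lemma solveE b M p : (solve_bound p <= M)%N -> solve b p = partial_solve b M p.
Proof.
move=> le; rewrite /solve /partial_solve; congr (_ - _).
  rewrite -(subnKC le) big_split_ord /= [X in _ + X]big1 ?addr0 // => k _.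
  by apply: past0; rewrite -addnS leqW // leq_addr.
rewrite -(subnKC le) big_split_ord /= [X in _ + X]big1 ?addr0 // => k _.
by apply: future0; rewrite leq_addr.
Qed.

(** Composing with [gam] and multiplying by [chi] lowers the index of [past] and raises that of
    [future]. Both sums telescope: the terms at [M] vanish, and those of index 0 are the two halves
    of [b]. *)
Lemma solve_eq b p : chi * solve b (gam p) - solve b p = b p.
Proof.
pose M := maxn (solve_bound p) (solve_bound (gam p)).
rewrite !(@solveE _ M) ?leq_maxl ?leq_maxr // /partial_solve.
have P k : chi * past b k.+1 (gam p) = past b k p.
  by rewrite /past iterSr gamK exprS invfM !mulrA mulfV // mul1r.
have F k : chi * future b k (gam p) = future b k.+1 p.
  by rewrite /future iterSr exprS !mulrA.
rewrite mulrBr !mulr_sumr.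
under eq_bigr do rewrite P.
under [X in _ - X - _]eq_bigr do rewrite F.
have tel (G : nat -> R[i]) : \sum_(k < M) G k.+1 = \sum_(k < M) G k + G M - G 0.
  by rewrite -[X in X - _](big_ord_recr M G) /= big_ord_recl /= addrAC subrr add0r.
rewrite (tel (fun k => past b k p)) (tel (fun k => future b k p)) (@past0 b M p) ?(@future0 b M p); last 2 first.
- exact: leq_maxl.
- by rewrite leqW // leq_maxl.
rewrite /past /future /= expr0 invr1 !mul1r !addr0.
move: (\sum_(k < M) _) (\sum_(k < M) _) => A B.
rewrite realCB; ring.
Qed.

Lemma smooth_iter f k : sm f -> sm (f \o iter k gam) /\ sm (f \o iter k gam').
Proof.
move=> sf; elim: k => [|k [IH IH']]; first by [].
split.
  have -> : f \o iter k.+1 gam = (f \o iter k gam) \o gam.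
    by apply/funext => p; rewrite /comp iterSr.
  exact: sgam.
have -> : f \o iter k.+1 gam' = (f \o iter k gam') \o gam'.
  by apply/funext => p; rewrite /comp iterSr.
exact: sgam'.
Qed.

(** The number of terms in [solve b p] jumps with [p]. Near a given point [ell] is bounded, so one
    large number of terms serves a whole neighbourhood. *)
Lemma smooth_solve b : sm b -> sm (solve b).
Proof.
move=> sb.
have sst : sm (fun p => (smooth_step (ell p))%:C).
  by apply: (smooth_real oT) => k; apply: (Ck_smooth_step oT); exact: cell.
have sst' : sm (fun p => (1 - smooth_step (ell p))%:C).
  have := smooth_add oT (smooth_cst oT 1) (smooth_scale oT (-1) sst).
  apply: (smooth_eq oT) => p _.
  by rewrite realCB mulN1r.
have sM M : sm (partial_solve b M).
  have s1 : sm (fun p => \sum_(k < M) past b k.+1 p).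
    apply: (smooth_sum oT) => k _; apply: (smooth_mul oT).
      by apply: (smooth_scale oT); have [_] := smooth_iter k.+1 sst.
    by have [_] := smooth_iter k.+1 sb.
  have s2 : sm (fun p => \sum_(k < M) future b k p).
    apply: (smooth_sum oT) => k _; apply: (smooth_mul oT).
      by apply: (smooth_scale oT); have [] := smooth_iter k sst'.
    by have [] := smooth_iter k sb.
  apply: (smooth_eq oT _ (smooth_add oT s1 (smooth_scale oT (-1) s2))).
  by move=> p _; rewrite mulN1r.
apply: smooth_local => p _.
pose c := `|ell p| + 1; pose D' := [set q : V | `|ell q| < c].
have oD' : open D'.
  apply: (@open_comp _ _ (fun q => `|ell q|) [set y | y < c]); last exact: open_lt.
  move=> q _; apply: continuous_comp; last exact: norm_continuous.
  by have := cell 0%N; apply.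
exists D'; split => //.
  by rewrite /D' /= ltrDl.
apply: (@smooth_eq _ _ _ D' oD' (partial_solve b (Num.truncn c).+2)).
  move=> q D'q; rewrite (@solveE _ (Num.truncn c).+2) //.
  by rewrite !ltnS; apply: le_truncn; exact: ltW.
move=> k; have [r i] := sM (Num.truncn c).+2 k.
by split; [apply: Ck_sub r | apply: Ck_sub i].
Qed.

Lemma solveZ c b p : solve (fun q => c * b q) p = c * solve b p.
Proof.
rewrite /solve /partial_solve mulrBr !mulr_sumr.
by congr (_ - _); apply: eq_bigr => k _; rewrite /past /future mulrCA.
Qed.

(** [solve] is built from [ell] and the values of [b] on the orbit, so it inherits every symmetry of
    these values that preserves [ell]. This serves both lattice translations and the generators
    treated earlier. *)
Lemma solve_inv b (h : V -> V) kappa p : ell (h p) = ell p ->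
  (forall k, kappa * b (iter k gam (h p)) = b (iter k gam p)) ->
  (forall k, kappa * b (iter k gam' (h p)) = b (iter k gam' p)) ->
  kappa * solve b (h p) = solve b p.
Proof.
move=> eh H H'; rewrite /solve /solve_bound eh /partial_solve mulrBr !mulr_sumr.
congr (_ - _); apply: eq_bigr => k _.
  by rewrite /past mulrCA H' !ell_iter' eh.
by rewrite /future mulrCA H !ell_iter eh.
Qed.

End Telescope.

(** * Koszul complexes of complex frames *)

Section Words.
Variable T : Type.

Definition omitw l (i : 'I_l.+1) (phi : 'I_l.+1 -> T) : 'I_l -> T :=
  fun j => phi (lift i j).

Definition consw l (a : T) (phi : 'I_l -> T) : 'I_l.+1 -> T :=
  fun i => if unlift ord0 i is Some j then phi j else a.

Definition swapw l (a b : 'I_l) (phi : 'I_l -> T) : 'I_l -> T :=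
  fun i => phi (tperm a b i).

Lemma consw0 l a (phi : 'I_l -> T) : consw a phi ord0 = a.
Proof. by rewrite /consw unlift_none. Qed.

Lemma conswS l a (phi : 'I_l -> T) i : consw a phi (lift ord0 i) = phi i.
Proof. by rewrite /consw liftK. Qed.

Lemma omitw_cons0 l a (phi : 'I_l -> T) : omitw ord0 (consw a phi) = phi.
Proof. by apply/funext => i; rewrite /omitw conswS. Qed.

Lemma omitw_consS l a (phi : 'I_l.+1 -> T) i :
  omitw (lift ord0 i) (consw a phi) = consw a (omitw i phi).
Proof.
apply/funext => j; rewrite /omitw.
have [j' ->|->] := unliftP ord0 j.
  have -> : lift (lift ord0 i) (lift ord0 j') = lift ord0 (lift i j').
    by apply: ord_inj; rewrite /= /bump /=; lia.
  by rewrite !conswS.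
have -> : lift (lift ord0 i) ord0 = ord0.
  by apply: ord_inj; rewrite /= /bump /=; lia.
by rewrite !consw0.
Qed.

Lemma omitw_omitw l (i : 'I_l.+2) (j : 'I_l.+1) (i' : 'I_l.+2) (j' : 'I_l.+1)
    (phi : 'I_l.+2 -> T) : (j < i)%N -> i' = j :> nat -> j' = i.-1 :> nat ->
  omitw j (omitw i phi) = omitw j' (omitw i' phi).
Proof.
move=> ji ei ej; apply/funext => x; rewrite /omitw; congr phi.
by apply: ord_inj; rewrite /= ei ej /bump; lia.
Qed.

Lemma omitw_swap l (a b : 'I_l.+1) (phi : 'I_l.+1 -> T) : b = a.+1 :> nat ->
  omitw a (swapw a b phi) = omitw b phi /\ omitw b (swapw a b phi) = omitw a phi.
Proof.
move=> ab; have H (x : 'I_l) : tperm a b (lift a x) = lift b x.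
  have [xa|xa] := pselect (x = a :> nat).
    have -> : lift a x = b by apply: ord_inj; rewrite /= ab /bump; lia.
    by rewrite tpermR; apply: ord_inj; rewrite /= ab /bump; lia.
  have -> : lift b x = lift a x.
    by apply: ord_inj; rewrite /= ab /bump; lia.
  rewrite tpermD //; first exact: neq_lift.
  by apply/eqP => /(congr1 val); rewrite /= ab /bump; lia.
split; apply/funext => x; rewrite /omitw /swapw ?H //.
by rewrite -H tpermK.
Qed.

Lemma omitw_swap_other l (a b i : 'I_l.+1) (phi : 'I_l.+1 -> T) :
  b = a.+1 :> nat -> i != a -> i != b ->
  exists a' b' : 'I_l, b' = a'.+1 :> nat /\
    omitw i (swapw a b phi) = swapw a' b' (omitw i phi).
Proof.
move=> ab ia ib.
have [a' ea|e] := unliftP i a; last by rewrite e eqxx in ia.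
have [b' eb|e] := unliftP i b; last by rewrite e eqxx in ib.
exists a', b'; split.
  move: ia ib ab; rewrite ea eb -!val_eqE /= /bump.
  by move=> /eqP ? /eqP ?; lia.
apply/funext => x; rewrite /omitw /swapw ea eb; congr phi.
have [->|xa] := eqVneq x a'; first by rewrite !tpermL.
have [->|xb] := eqVneq x b'; first by rewrite !tpermR.
by rewrite !tpermD // ?(inj_eq lift_inj) // eq_sym.
Qed.

End Words.

Section Koszul.
Variables (R : realType) (m n : nat).
Notation V := 'M[R]_(m, n).
Notation sm := (@smooth R V setT).
Variables (T : finType) (fre fim : T -> V) (co : T -> V -> R[i]).
Let oT : open [set: V]. Proof. exact: openT. Qed.
Implicit Type f : V -> R[i].

Definition frame_d (j : T) f (x : V) : R[i] :=
  cderive f x (fre j) + 'i * cderive f x (fim j).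

Hypothesis coP : forall f x lam, sm f ->
  cderive f x lam = \sum_j co j lam * frame_d j f x.

Definition karr l := ('I_l -> T) -> V -> R[i].
Implicit Type l : nat.

Definition kd l (f : karr l) : karr l.+1 := fun phi x =>
  \sum_(i < l.+1) (-1) ^+ i * frame_d (phi i) (f (omitw i phi)) x.

Lemma frame_dE j f x :
  frame_d j f x = cderive f x (fre j) + 'i * cderive f x (fim j).
Proof. by []. Qed.

Lemma kdE l (f : karr l) phi x :
  kd f phi x = \sum_(i < l.+1) (-1) ^+ i * frame_d (phi i) (f (omitw i phi)) x.
Proof. by []. Qed.

Definition ksm l (f : karr l) := forall phi, sm (f phi).

(** Adjacent transpositions generate the others and interact simply with the deletion of a letter:
    see [omitw_swap] and [omitw_swap_other]. Vanishing on words with a repeated letter follows from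
    the sign change. *)
Definition kalt l (f : karr l) := forall (a b : 'I_l) phi x,
  b = a.+1 :> nat -> f (swapw a b phi) x = - f phi x.

Definition kiota l (lam : V) (f : karr l.+1) : karr l := fun phi x =>
  \sum_j co j lam * f (consw j phi) x.

(** What averages, [prim] and the frame fields have in common. Such an operator, applied to each
    coefficient, commutes with [kd]. *)
Record kop (O : (V -> R[i]) -> V -> R[i]) : Prop := {
  kop_sm : forall f, sm f -> sm (O f);
  kop_lin : forall c f g x, sm f -> sm g ->
    O (fun y => c * f y + g y) x = c * O f x + O g x;
  kop_d : forall f h x, sm f ->
    cderive (O f) x h = O (fun y => cderive f y h) x }.

Lemma frame_sm j f : sm f -> sm (frame_d j f).
Proof.
move=> sf; apply: (smooth_add oT); first exact: smooth_cderive.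
by apply: (smooth_scale oT); exact: smooth_cderive.
Qed.

Lemma frame_lin j c f g x : sm f -> sm g ->
  frame_d j (fun y => c * f y + g y) x = c * frame_d j f x + frame_d j g x.
Proof.
by move=> sf sg; rewrite /frame_d !(cderive_lin c _ I sf sg); ring.
Qed.

Lemma cderive_frame j f x h : sm f ->
  cderive (frame_d j f) x h = frame_d j (fun y => cderive f y h) x.
Proof.
move=> sf; transitivity (cderive (fun y => cderive f y (fre j)) x h +
    'i * cderive (fun y => cderive f y (fim j)) x h).
  rewrite (@cderiveD _ _ _ setT) //; last 2 first.
  - exact: smooth_cderive.
  - by apply: (smooth_scale oT); exact: smooth_cderive.
  by rewrite (cderiveZ oT) //; exact: smooth_cderive.
exact: (f_equal2 (fun a b => a + 'i * b) (cderiveC _ _ _ sf) (cderiveC _ _ _ sf)).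
Qed.

Lemma kop_frame_d j : kop (frame_d j).
Proof.
split; [by move=> f; exact: frame_sm | by move=> c f g x; exact: frame_lin |].
by move=> f h x; exact: cderive_frame.
Qed.

Lemma kop0 O : kop O -> forall x, O (fun=> 0) x = 0.
Proof.
move=> kO x; have s0 : sm (fun=> 0) by exact: (smooth_cst oT 0).
have := kop_lin kO (-1) x s0 s0.
have -> : (fun _ : V => -1 * 0 + 0) = (fun=> 0 : R[i]).
  by apply/funext => y; rewrite mulr0 addr0.
by rewrite mulN1r addNr.
Qed.

Lemma kopZ O : kop O -> forall c f x, sm f -> O (fun y => c * f y) x = c * O f x.
Proof.
move=> kO c f x sf; have s0 : sm (fun=> 0) by exact: (smooth_cst oT 0).
rewrite -[RHS]addr0 -[X in _ + X](kop0 kO x) -(kop_lin kO) //.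
by have -> : (fun y => c * f y) = (fun y => c * f y + 0)
  by apply/funext => y; rewrite addr0.
Qed.

Lemma kopD O : kop O -> forall f g x, sm f -> sm g ->
  O (fun y => f y + g y) x = O f x + O g x.
Proof.
move=> kO f g x sf sg; rewrite -[X in _ = X + _]mul1r -(kop_lin kO) //.
by have -> : (fun y => f y + g y) = (fun y => 1 * f y + g y)
  by apply/funext => y; rewrite mul1r.
Qed.

Lemma kop_sum O : kop O -> forall (I : Type) (r : seq I) (F : I -> V -> R[i]) x,
  (forall i, sm (F i)) ->
  O (fun y => \sum_(i <- r) F i y) x = \sum_(i <- r) O (F i) x.
Proof.
move=> kO I r F x sF; elim: r => [|i r IH].
  have -> : (fun y => \sum_(i <- [::]) F i y) = (fun=> 0).
    by apply/funext => y; rewrite big_nil.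
  by rewrite big_nil kop0.
have -> : (fun y => \sum_(j <- i :: r) F j y) =
    (fun y => F i y + \sum_(j <- r) F j y).
  by apply/funext => y; rewrite big_cons.
by rewrite big_cons kopD // ?IH //; exact: smooth_sum.
Qed.

Lemma kop_frame O j f x : kop O -> sm f ->
  frame_d j (O f) x = O (frame_d j f) x.
Proof.
move=> kO sf; rewrite /frame_d !(kop_d kO) // -(kopZ kO); last exact: smooth_cderive.
rewrite -(kopD kO) //; first exact: smooth_cderive.
by apply: (smooth_scale oT); exact: smooth_cderive.
Qed.

Lemma frameC j k f x : sm f -> frame_d j (frame_d k f) x = frame_d k (frame_d j f) x.
Proof. by move=> sf; rewrite (kop_frame j x (kop_frame_d k) sf). Qed.

Lemma kop_kd l O (f : karr l) phi x : kop O -> ksm f ->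
  kd (fun psi => O (f psi)) phi x = O (kd f phi) x.
Proof.
move=> kO sf; rewrite /kd kop_sum //; last first.
  by move=> i; apply: (smooth_scale oT); exact: frame_sm.
by apply: eq_bigr => i _; rewrite kop_frame // (kopZ kO) //; exact: frame_sm.
Qed.

Lemma kd_sm l (f : karr l) : ksm f -> ksm (kd f).
Proof.
move=> sf phi; apply: (smooth_sum oT) => i _.
by apply: (smooth_scale oT); exact: frame_sm.
Qed.

Lemma kd_lin l c (f g : karr l) phi x : ksm f -> ksm g ->
  kd (fun psi y => c * f psi y + g psi y) phi x = c * kd f phi x + kd g phi x.
Proof.
move=> sf sg; rewrite /kd mulr_sumr -big_split /=; apply: eq_bigr => i _.
by rewrite frame_lin //; ring.
Qed.

(** Swapping the letters at [a] and [b = a + 1] exchanges the two terms that delete them, whose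
    signs are opposite; in every other term the shortened word undergoes an adjacent swap. *)
Lemma kd_alt l (f : karr l) : ksm f -> kalt f -> kalt (kd f).
Proof.
move=> sf af a b phi x ab.
have nab : a != b by apply/eqP => e; move: ab; rewrite e; lia.
have fN (psi psi' : 'I_l -> T) j y : (forall y, f psi y = - f psi' y) ->
    frame_d j (f psi) y = - frame_d j (f psi') y.
  move=> H; have -> : f psi = (fun y => -1 * f psi' y + 0).
    by apply/funext => z; rewrite H mulN1r addr0.
  rewrite frame_lin //; last exact: (smooth_cst oT).
  by rewrite mulN1r /frame_d !cderive_cst mulr0 !addr0.
rewrite /kd (bigD1 a) //= (bigD1 b) /=; last by rewrite eq_sym.
rewrite [in RHS](bigD1 a) //= [in RHS](bigD1 b) /=; last by rewrite eq_sym.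
have [-> ->] := omitw_swap phi ab.
rewrite {1 2}/swapw tpermL tpermR ab exprS.
rewrite !opprD -sumrN !mulN1r !mulNr opprK addrCA; congr (_ + (_ + _)).
apply: eq_bigr => i /andP[ia ib].
have [a' [b' [ab' E]]] := omitw_swap_other phi ab ia ib.
have -> : swapw a b phi i = phi i by rewrite /swapw tpermD // eq_sym.
by rewrite E (fN _ (omitw i phi)) ?mulrN // => y; exact: af.
Qed.

Lemma kd_kd l (f : karr l) phi x : ksm f -> kd (kd f) phi x = 0.
Proof.
move=> sf.
pose F (z : 'I_l.+2 * 'I_l.+1) : R[i] := (-1) ^+ (z.1 + z.2) *
  frame_d (phi z.1) (frame_d (omitw z.1 phi z.2) (f (omitw z.2 (omitw z.1 phi)))) x.
have -> : kd (kd f) phi x = \sum_z F z.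
  rewrite /kd -(pair_bigA _ (fun i j => F (i, j))) /=; apply: eq_bigr => i _.
  have kO : frame_d (phi i) (kd f (omitw i phi)) x = \sum_(j < l.+1) (-1) ^+ j *
      frame_d (phi i) (frame_d (omitw i phi j) (f (omitw j (omitw i phi)))) x.
    rewrite (kop_sum (kop_frame_d _)) => [|j]; last first.
      by apply: (smooth_scale oT); exact: frame_sm.
    by apply: eq_bigr => j _; rewrite (kopZ (kop_frame_d _)) //; exact: frame_sm.
  by rewrite kO mulr_sumr; apply: eq_bigr => j _; rewrite /F /= exprD mulrA.
(* The same two letters can be deleted in either order, with shifted indices. [h] exchanges the
   orders: it is an involution that changes the parity of [z.1 + z.2], and the frame fields
   commute. *)
pose h (z : 'I_l.+2 * 'I_l.+1) : 'I_l.+2 * 'I_l.+1 :=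
  if (z.2 < z.1)%N then (inord z.2, inord z.1.-1) else (inord z.2.+1, inord z.1).
have hv1 z : (h z).1 = (if (z.2 < z.1)%N then z.2 : nat else z.2.+1) :> nat.
  case: z => [[i hi] [j hj]] /=; rewrite /h /=.
  by case: ifP => ji /=; rewrite inordK //; lia.
have hv2 z : (h z).2 = (if (z.2 < z.1)%N then z.1.-1 else z.1 : nat) :> nat.
  case: z => [[i hi] [j hj]] /=; rewrite /h /=.
  by case: ifP => ji /=; rewrite inordK //; lia.
have hK : involutive h.
  move=> z; have := hv1 z; have := hv2 z; have := hv1 (h z); have := hv2 (h z).
  case: (h z) => [i' j'] /=; case: (h _) => [i2 j2] /=; case: z => [i j] /=.
  move=> e4 e3 e2 e1.
  case: (ltnP j i) e1 e2 => ji e1 e2; case: (ltnP j' i') e3 e4 => ji' e3 e4;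
  by congr (_, _); apply: ord_inj; lia.
have omitE (i i' : 'I_l.+2) (j j' : 'I_l.+1) : (j < i)%N -> i' = j :> nat ->
    j' = i.-1 :> nat -> omitw i phi j = phi i' /\ omitw i' phi j' = phi i.
  move=> ji e1 e2; rewrite /omitw; split; congr phi; apply: ord_inj;
  by rewrite /= /bump; lia.
have Fh' (z : 'I_l.+2 * 'I_l.+1) : (z.2 < z.1)%N -> F (h z) = - F z.
  move=> zz; have := hv1 z; have := hv2 z; rewrite zz.
  case: z zz => [i j] /= ji; case: (h _) => [i' j'] /= e2 e1.
  rewrite /F /= -(omitw_omitw phi ji e1 e2).
  have [-> ->] := omitE _ _ _ _ ji e1 e2.
  rewrite frameC // -mulNr; congr (_ * _).
  have -> : (i + j = (i' + j').+1)%N by lia.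
  by rewrite exprS mulN1r opprK.
have Fh (z : 'I_l.+2 * 'I_l.+1) : F (h z) = - F z.
  have [zz|zz] := ltnP z.2 z.1; first exact: Fh'.
  suff hz : ((h z).2 < (h z).1)%N.
    by have := Fh' _ hz; rewrite hK => ->; rewrite opprK.
  have := hv1 z; have := hv2 z; case: (h z) => [i' j'] /=.
  by case: z zz => [i j] /= ji; rewrite ltnNge ji /=; lia.
have S0 : \sum_z F z = - \sum_z F z.
  rewrite {1}(reindex_inj (inv_inj hK)) -sumrN.
  by apply: eq_bigr => z _; rewrite Fh.
apply/eqP; have /eqP := S0; rewrite -subr_eq0 opprK -mulr2n mulrn_eq0.
by case/orP.
Qed.

Lemma cartan0 (lam : V) (f : karr 0) phi x : ksm f ->
  kiota lam (kd f) phi x = cderive (f phi) x lam.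
Proof.
move=> sf; rewrite coP // /kiota; apply: eq_bigr => j _; congr (_ * _).
by rewrite /kd big_ord_recl big_ord0 addr0 expr0 mul1r consw0 omitw_cons0.
Qed.

(** Contraction inserts its letter in front. The term of [kd f] that deletes this letter is the
    derivative along [lam]; all others carry one extra sign and cancel against [kd] of the
    contraction. *)
Lemma cartan l (lam : V) (f : karr l.+1) phi x : ksm f ->
  kiota lam (kd f) phi x + kd (kiota lam f) phi x = cderive (f phi) x lam.
Proof.
move=> sf; rewrite coP // /kiota /kd.
under eq_bigr => j _.
  rewrite big_ord_recl expr0 mul1r consw0 omitw_cons0 mulrDr.
  rewrite mulr_sumr.
  over.
rewrite big_split /= -addrA -[RHS]addr0; congr (_ + _).
rewrite exchange_big /= -big_split /= big1 // => i _.
have -> : frame_d (phi i) (fun x0 => \sum_j co j lam * f (consw j (omitw i phi)) x0) x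
   = \sum_j co j lam * frame_d (phi i) (f (consw j (omitw i phi))) x.
  rewrite (kop_sum (kop_frame_d _)) => [|j]; last exact: (smooth_scale oT).
  by apply: eq_bigr => j _; rewrite (kopZ (kop_frame_d _)).
rewrite mulr_sumr -big_split /= big1 // => j _.
rewrite conswS omitw_consS /bump leq0n add1n exprS.
by ring.
Qed.

Lemma kiota_sm l lam (f : karr l.+1) : ksm f -> ksm (kiota lam f).
Proof.
by move=> sf phi; apply: (smooth_sum oT) => j _; exact: (smooth_scale oT).
Qed.

Lemma kiota_alt l lam (f : karr l.+1) : kalt f -> kalt (kiota lam f).
Proof.
move=> af a b phi x ab; rewrite /kiota -sumrN; apply: eq_bigr => j _.
have -> : consw j (swapw a b phi) = swapw (lift ord0 a) (lift ord0 b) (consw j phi).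
  apply/funext => i; rewrite /swapw.
  have [i' ->|->] := unliftP ord0 i; rewrite ?conswS ?consw0.
    have [->|ia] := eqVneq i' a; first by rewrite !tpermL conswS.
    have [->|ib] := eqVneq i' b; first by rewrite !tpermR conswS.
    by rewrite !tpermD ?conswS // ?(inj_eq lift_inj) // eq_sym.
  by rewrite tpermD ?consw0 // eq_sym neq_lift.
by rewrite af ?mulrN //= ab.
Qed.

End Koszul.

(** * Homotopies between the identity and averages *)

Section KoszulHomotopy.
Variables (R : realType) (m n : nat).
Notation V := 'M[R]_(m, n).
Notation sm := (@smooth R V setT).
Variables (T : finType) (fre fim : T -> V) (co : T -> V -> R[i]).
Let oT : open [set: V]. Proof. exact: openT. Qed.
Notation frame_d := (frame_d fre fim).
Notation kd := (kd fre fim).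
Notation karr := (karr R m n T).

Hypothesis coP : forall (f : V -> R[i]) x lam, sm f ->
  cderive f x lam = \sum_j co j lam * frame_d j f x.

Lemma kop_cint (w : R -> R) (lam : V) : continuous w ->
  (forall r : R, 0 <= r <= 1 -> `|w r| <= 1) -> kop (cint w lam).
Proof.
move=> cw w1; split=> [f|c f g x sf sg|f h x sf].
- exact: smooth_cint.
- by rewrite cintD ?cintZ //; exact: (smooth_scale oT).
- exact: cderive_cint.
Qed.

Lemma kop_avg (lam : V) : kop (avg lam).
Proof. by apply: kop_cint; [exact: unit_weightC | exact: unit_weight1]. Qed.

Lemma kop_prim (lam : V) : kop (prim lam).
Proof. by apply: kop_cint; [exact: taperC | exact: taper1]. Qed.

Definition knull l (f : karr l) := forall phi x, f phi x = 0.
Definition kclass := forall l, karr l -> Prop.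

Definition kexact (K : kclass) l : karr l -> Prop :=
  match l return karr l -> Prop with
  | 0 => fun f => knull f
  | l'.+1 => fun f => exists2 eta : karr l', K l' eta & forall phi x, f phi x = kd eta phi x
  end.

Definition avgs (lams : seq V) (f : V -> R[i]) : V -> R[i] :=
  foldr (fun lam g => avg lam g) f lams.

Lemma kop_avgs lams : kop (avgs lams).
Proof.
elim: lams => [|lam lams IH]; first by split.
have kl := kop_avg lam; split=> [f sf|c f g x sf sg|f h x sf] /=.
- by apply: (kop_sm kl); exact: (kop_sm IH).
- have -> : avgs lams (fun y => c * f y + g y) =
      (fun y => c * avgs lams f y + avgs lams g y).
    by apply/funext => y; rewrite (kop_lin IH).
  by rewrite (kop_lin kl) //; exact: (kop_sm IH).
- rewrite (kop_d kl); last exact: (kop_sm IH).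
  have -> // : (fun y => cderive (avgs lams f) y h) = avgs lams (fun y => cderive f y h).
  by apply/funext => y; rewrite (kop_d IH).
Qed.

Definition khom l lam (f : karr l.+1) : karr l :=
  fun phi => prim lam (kiota co lam f phi).

Lemma kd_khom l lam (f : karr l.+1) phi x : ksm f -> knull (kd f) ->
  kd (khom lam f) phi x = avg lam (f phi) x - f phi x.
Proof.
move=> sf cf; rewrite /khom (kop_kd fre fim _ _ (kop_prim lam)); last exact: kiota_sm.
rewrite -prim_derive //; congr (prim lam _ x).
apply/funext => y; rewrite -(cartan coP) // [X in X + _](_ : _ = 0) ?add0r //.
by rewrite /kiota big1 // => j _; rewrite cf mulr0.
Qed.

(** The properties that keep the averaging homotopy inside a class. They are established for
    lattice-periodic arrays with the lattice vectors [lams], and for fibre-constant invariant arrays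
    with the translations [cvec i]. *)
Record kclosed (K : kclass) (lams : seq V) : Prop := {
  kcl_sm : forall l (f : karr l), K l f -> ksm f;
  kcl0 : forall l, K l (fun _ _ => 0);
  kcl_lin : forall l c (f g : karr l), K l f -> K l g ->
    K l (fun phi x => c * f phi x + g phi x);
  kcl_avg : forall l lam (f : karr l), lam \in lams -> K l f ->
    K l (fun phi => avg lam (f phi));
  kcl_hom : forall l lam (f : karr l.+1), lam \in lams -> K l.+1 f ->
    K l (khom lam f) }.

Lemma kexact0 K lams l : kclosed K lams -> @kexact K l (fun _ _ => 0).
Proof.
move=> KK; case: l => [|l] //=; exists (fun _ _ => 0); first exact: (kcl0 KK).
move=> phi x; rewrite /kd big1 // => i _.
by rewrite (kop0 (kop_frame_d _ _ _)) mulr0.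
Qed.

Lemma kexact_lin K lams l c (f g : karr l) : kclosed K lams ->
  kexact K f -> kexact K g -> kexact K (fun phi x => c * f phi x + g phi x).
Proof.
move=> KK; case: l f g => [|l] f g /=.
  by move=> zf zg phi x; rewrite zf zg mulr0 addr0.
move=> [e Ke Ef] [e' Ke' Eg]; exists (fun phi x => c * e phi x + e' phi x).
  exact: (kcl_lin KK).
by move=> phi x; rewrite kd_lin ?Ef ?Eg //; apply: (kcl_sm KK).
Qed.

Lemma kexact_eq K l (f g : karr l) : (forall phi x, f phi x = g phi x) ->
  kexact K f -> kexact K g.
Proof.
by move=> fg; have -> : f = g by apply/funext => phi; apply/funext => x.
Qed.

Lemma kexact_sub K lams l (f g : karr l) : kclosed K lams ->
  kexact K f -> kexact K g -> kexact K (fun phi x => f phi x - g phi x).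
Proof.
move=> KK ef eg; apply: kexact_eq (kexact_lin (-1) KK eg ef) => phi x.
by rewrite mulN1r addrC.
Qed.

Lemma avgs_closed K lams l (f : karr l) : kclosed K lams -> K l f ->
  forall ls, {subset ls <= lams} -> K l (fun phi => avgs ls (f phi)).
Proof.
move=> KK Kf; elim=> [//|lam ls IH] sub /=.
apply: (kcl_avg KK (f := fun phi => avgs ls (f phi))).
  by apply: sub; rewrite mem_head.
by apply: IH => y yl; apply: sub; rewrite inE yl orbT.
Qed.

Lemma kd_avgs0 l (f : karr l) ls : ksm f -> knull (kd f) ->
  knull (kd (fun phi => avgs ls (f phi))).
Proof.
move=> sf cf phi x; rewrite (kop_kd fre fim _ _ (kop_avgs ls)) //.
have -> : kd f phi = (fun=> 0) by apply/funext => y; exact: cf.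
exact: (kop0 (kop_avgs ls)).
Qed.

(** Average along one vector at a time: each partial average is closed and differs from the next by
    [kd] of its [khom]. In degree 0 a closed array has zero derivatives, so averaging does not
    change it. *)
Lemma homotopy_avgs K lams l (f : karr l) : kclosed K lams -> K l f ->
  knull (kd f) -> kexact K (fun phi x => f phi x - avgs lams (f phi) x).
Proof.
move=> KK Kf cf; have : {subset lams <= lams} by [].
have sf := kcl_sm KK Kf.
elim: {-2}lams => [_|lam ls IH sub] /=.
  by apply: kexact_eq (kexact0 l KK) => phi x; rewrite subrr.
have sub' : {subset ls <= lams} by move=> y yl; apply: sub; rewrite inE yl orbT.
have lamin : lam \in lams by apply: sub; rewrite mem_head.
pose g : karr l := fun phi => avgs ls (f phi).
have Kg : K l g := avgs_closed KK Kf sub'.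
have cg : knull (kd g) by exact: kd_avgs0.
have sg := kcl_sm KK Kg.
suff eg : kexact K (fun phi x => avg lam (g phi) x - g phi x).
  apply: kexact_eq (kexact_sub KK (IH sub') eg) => phi x.
  by rewrite opprB addrA subrK.
case: l f g Kf cf sf {IH} Kg cg sg => [|l] f g _ _ _ Kg cg sg /=.
  move=> phi x; rewrite -prim_derive //.
  have -> : (fun y => cderive (g phi) y lam) = (fun=> 0).
    apply/funext => y; rewrite -(cartan0 coP) // /kiota big1 // => j _.
    by rewrite cg mulr0.
  exact: (kop0 (kop_prim lam)).
exists (khom lam g); first exact: (kcl_hom KK).
by move=> phi x; rewrite kd_khom.
Qed.

Lemma avgs_const lams (f : V -> R[i]) : sm f ->
  (forall lam x, lam \in lams -> cderive f x lam = 0) -> avgs lams f = f.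
Proof.
move=> sf; elim: lams => [//|lam ls IH] H /=.
rewrite IH; last by move=> l x ll; apply: H; rewrite inE ll orbT.
apply/funext => x; apply: avg_const => r; apply: const_along => // y.
by apply: H; rewrite mem_head.
Qed.

Lemma avgs_periodic lams (b : V) (f : V -> R[i]) :
  (forall x, f (x + b) = f x) -> forall x, avgs lams f (x + b) = avgs lams f x.
Proof.
move=> pf; elim: lams => [//|lam ls IH] x /=.
rewrite /avg -cint_translate; congr (cint _ lam _ x).
by apply/funext => y.
Qed.

(** The average along [lam] of a derivative along [lam] is a difference over one period; the
    averages taken before it commute with the derivative and preserve the period. *)
Lemma avgs_derive lams lam (f : V -> R[i]) x : sm f -> lam \in lams ->
  (forall x, f (x + lam) = f x) -> avgs lams (fun y => cderive f y lam) x = 0.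
Proof.
move=> sf + pf; elim: lams x => [//|lam' ls IH] x; rewrite inE /=.
have ka := kop_avgs ls.
have E : avgs ls (fun y => cderive f y lam) = (fun y => cderive (avgs ls f) y lam).
  by apply/funext => y; rewrite (kop_d ka).
move=> /predU1P[<-|ll].
  rewrite E avg_derive; last exact: (kop_sm ka).
  by rewrite avgs_periodic // subrr.
have -> : avgs ls (fun y => cderive f y lam) = (fun=> 0).
  by apply/funext => y; exact: IH.
exact: (kop0 (kop_avg lam')).
Qed.

End KoszulHomotopy.

(** * Descent of primitives along the group *)

Section Antisymmetry.
Variable R : realType.

Definition antisym (A : Type) l (W : ('I_l -> A) -> R[i]) : Prop :=
  forall (a b : 'I_l) h, b = a.+1 :> nat -> W (swapw a b h) = - W h.

Lemma antisym_swap (A : Type) l (W : ('I_l -> A) -> R[i]) : antisym W ->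
  forall (a b : 'I_l) h, a != b -> W (swapw a b h) = - W h.
Proof.
move=> aW; have key d : forall (a b : 'I_l) h, b = (a + d).+1 :> nat ->
    W (swapw a b h) = - W h.
  elim: d => [|d IH] a b h ab; first by apply: aW; rewrite ab addn0.
  have b'l : ((a + d).+1 < l)%N by have := ltn_ord b; lia.
  pose b' := Ordinal b'l.
  (* Conjugation by the adjacent swap of [b' = b - 1] and [b] shortens the distance by one; its two
     signs cancel. *)
  have -> : swapw a b h = swapw b' b (swapw a b' (swapw b' b h)).
    apply/funext => i; rewrite /swapw; congr h.
    have ab' : a != b' by rewrite -val_eqE /=; lia.
    have bb' : b != b' by rewrite -val_eqE /=; lia.
    have abn : a != b by rewrite -val_eqE /=; lia.
    have [->|ia] := eqVneq i a; first by rewrite (@tpermD _ b' b a) // 1?eq_sym // !tpermL.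
    have [->|ib] := eqVneq i b; first by rewrite !tpermR (@tpermD _ b' b a) // 1?eq_sym.
    have [->|ib'] := eqVneq i b'.
      by rewrite tpermL (@tpermD _ a b b') // (@tpermD _ a b' b) // ?tpermR // eq_sym.
    by rewrite !tpermD // 1?eq_sym.
  have e1 : b = b'.+1 :> nat by rewrite ab addnS.
  by rewrite (aW _ _ _ e1) IH // (aW _ _ _ e1) opprK.
move=> a b h; rewrite -val_eqE /= neq_ltn => /orP[lt|lt].
  by apply: (key (b - a).-1); lia.
have -> : swapw a b h = swapw b a h.
  by apply/funext => i; rewrite /swapw tpermC.
by apply: (key (a - b).-1); lia.
Qed.

Lemma antisym_inj (A : Type) l (W : ('I_l -> A) -> R[i]) h : antisym W ->
  W h != 0 -> injective h.
Proof.
move=> aW nz a b E; apply/eqP; apply: contraNT nz => ab.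
have := antisym_swap aW h ab.
have -> : swapw a b h = h by apply/funext => i; rewrite /swapw; case: tpermP => // ->.
by move=> /eqP; rewrite -subr_eq0 opprK -mulr2n mulrn_eq0 => /orP[].
Qed.

End Antisymmetry.

Section Alternating.
Variables (R : realType) (m n : nat) (T : finType).
Notation karr := (karr R m n T).

Lemma kalt_antisym l (f : karr l) x : kalt f -> antisym (f^~ x).
Proof. by move=> af a b phi; exact: af. Qed.

Lemma kalt_inj l (f : karr l) phi x : kalt f -> f phi x != 0 -> injective phi.
Proof. by move=> af; exact: (antisym_inj (kalt_antisym x af)). Qed.

End Alternating.

Section Descent.
Variables (R : realType) (m n : nat).
Notation V := 'M[R]_(m, n).
Notation sm := (@smooth R V setT).
Variables (T : finType) (fre fim : T -> V) (co : T -> V -> R[i]).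
Let oT : open [set: V]. Proof. exact: openT. Qed.
Notation frame_d := (frame_d fre fim).
Notation kd := (kd fre fim).
Notation karr := (karr R m n T).

Hypothesis coP : forall (f : V -> R[i]) x lam, sm f ->
  cderive f x lam = \sum_j co j lam * frame_d j f x.

(* [fib] singles out the letters of the fibre directions, [Lat] is the lattice
   of translations along the fibre and [lams] a spanning family in it. *)
Variables (fib : pred T) (Lat : set V) (lams : seq V).
Hypothesis lams_Lat : forall lam, lam \in lams -> Lat lam.
Hypothesis Lat_fib : forall b j, Lat b -> ~~ fib j -> co j b = 0.
Hypothesis fib_span : forall j, fib j -> exists W : V -> R[i],
  forall (f : V -> R[i]) x, sm f ->
  frame_d j f x = \sum_(lam <- lams) W lam * cderive f x lam.

Variables (N : nat) (gam gam' : nat -> V -> V) (wt : nat -> T -> R[i])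
  (rho : nat -> R[i]) (ell : nat -> V -> R).
Hypothesis gamK : forall i, cancel (gam i) (gam' i).
Hypothesis gamK' : forall i, cancel (gam' i) (gam i).
Hypothesis sgam : forall i (f : V -> R[i]), sm f -> sm (f \o gam i).
Hypothesis sgam' : forall i (f : V -> R[i]), sm f -> sm (f \o gam' i).
Hypothesis frame_gam : forall i j (f : V -> R[i]) x, sm f ->
  frame_d j (f \o gam i) x = wt i j * frame_d j f (gam i x).
Hypothesis gam_Lat : forall i b, Lat b -> exists2 b', Lat b' &
  forall p, gam i (p + b) = gam i p + b'.
Hypothesis gam'_Lat : forall i b, Lat b -> exists2 b', Lat b' &
  forall p, gam' i (p + b) = gam' i p + b'.
Hypothesis gamC : forall i j p, gam i (gam j p) = gam j (gam i p).
Hypothesis Cell : forall i k, Ck setT k (ell i).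
Hypothesis ell_gam : forall i j p, (i < N)%N -> (j < N)%N ->
  ell j (gam i p) = ell j p + (i == j)%:R.
Hypothesis ell_Lat : forall i b p, Lat b -> ell i (p + b) = ell i p.
Hypothesis wt0 : forall i j, wt i j != 0.
Hypothesis rho0 : forall i, rho i != 0.

Definition periodic (f : V -> R[i]) := forall b x, Lat b -> f (x + b) = f x.
(** The factor by which pullback along [gam i] multiplies the coefficient of the word [phi]:
    [wt i j] is the eigenvalue of [gam i] on the frame field [j], and [rho i] comes from the
    twist. *)
Definition chi i l (phi : 'I_l -> T) : R[i] := rho i * \prod_a wt i (phi a).
Definition pull i l (f : karr l) : karr l := fun phi x =>
  chi i phi * f phi (gam i x).
Notation P := (avgs lams).

Lemma chi_neq0 i l (phi : 'I_l -> T) : chi i phi != 0.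
Proof. by rewrite mulf_neq0 //; apply/prodf_neq0 => a _. Qed.

Lemma chi_swap i l (a b : 'I_l) (phi : 'I_l -> T) : chi i (swapw a b phi) = chi i phi.
Proof.
by rewrite /chi [in RHS](reindex_inj (@perm_inj _ (tperm a b))).
Qed.

Lemma chi_omit i l (a : 'I_l.+1) (phi : 'I_l.+1 -> T) :
  chi i phi = chi i (omitw a phi) * wt i (phi a).
Proof. by rewrite /chi (bigD1_ord a) //= mulrCA mulrC. Qed.

Lemma pull_sm i l (f : karr l) : ksm f -> ksm (pull i f).
Proof. by move=> sf phi; apply: (smooth_scale oT); exact: sgam (sf phi). Qed.

Lemma pull_alt i l (f : karr l) : kalt f -> kalt (pull i f).
Proof. by move=> af a b phi x ab; rewrite /pull chi_swap af // mulrN. Qed.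

Lemma kd_pull i l (f : karr l) phi x : ksm f -> kd (pull i f) phi x = pull i (kd f) phi x.
Proof.
move=> sf; rewrite /pull /kd mulr_sumr; apply: eq_bigr => a _.
rewrite (kopZ (kop_frame_d _ _ _)) ?frame_gam //; last exact: sgam.
by rewrite (chi_omit i a phi); ring.
Qed.

Lemma periodic_gam i f : periodic f -> periodic (f \o gam i).
Proof.
by move=> pf b x Lb; have [b' Lb' E] := gam_Lat i Lb; rewrite /= E pf.
Qed.

Lemma periodic_cderive f h : sm f -> periodic f -> periodic (fun y => cderive f y h).
Proof.
move=> sf pf b x Lb; rewrite -cderive_translate //.
by have -> : (fun y => f (y + b)) = f by apply/funext => y; exact: pf.
Qed.

Lemma periodic_frame j f : sm f -> periodic f -> periodic (frame_d j f).
Proof.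
by move=> sf pf b x Lb; rewrite !frame_dE !(periodic_cderive _ sf pf).
Qed.

Lemma periodic_cint w lam f : periodic f -> periodic (cint w lam f).
Proof.
move=> pf b x Lb; rewrite -cint_translate.
by have -> : (fun y => f (y + b)) = f by apply/funext => y; exact: pf.
Qed.

Lemma periodic_avgs ls f : periodic f -> periodic (avgs ls f).
Proof. by move=> pf; elim: ls => [//|lam ls IH] /=; exact: periodic_cint. Qed.

Lemma P_frame f j x : sm f -> periodic f -> fib j -> P (frame_d j f) x = 0.
Proof.
move=> sf pf fj; have [W HW] := fib_span fj.
have -> : frame_d j f = fun y => \sum_(lam <- lams) W lam * cderive f y lam.
  by apply/funext => y; rewrite HW.
rewrite (kop_sum (kop_avgs lams)); last first.
  by move=> lam; apply: (smooth_scale oT); exact: smooth_cderive.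
rewrite big1_seq // => lam /= ll; rewrite (kopZ (kop_avgs lams)).
  by rewrite avgs_derive ?mulr0 // => y; apply: pf; exact: lams_Lat.
exact: smooth_cderive.
Qed.

Lemma frame_P f j x : sm f -> periodic f -> fib j -> frame_d j (P f) x = 0.
Proof.
by move=> sf pf fj; rewrite (kop_frame _ _ _ _ (kop_avgs lams)) // P_frame.
Qed.

Lemma cderive_Lat f b x : sm f -> (forall j x, fib j -> frame_d j f x = 0) ->
  Lat b -> cderive f x b = 0.
Proof.
move=> sf H Lb; rewrite coP // big1 // => j _.
by have [fj|nfj] := boolP (fib j); [rewrite H ?mulr0 | rewrite Lat_fib ?mul0r].
Qed.

Lemma P_fibre f : sm f -> (forall j x, fib j -> frame_d j f x = 0) -> P f = f.
Proof.
by move=> sf H; apply: avgs_const => // lam x ll; apply: cderive_Lat => //; exact: lams_Lat.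
Qed.

Lemma P_idem f : sm f -> periodic f -> P (P f) = P f.
Proof.
move=> sf pf; apply: P_fibre; first exact: (kop_sm (kop_avgs lams)).
by move=> j x fj; exact: frame_P.
Qed.

(** [gam i] moves the segments over which [P] averages, so the two sides are different integrals.
    But [P f \o gam i] is constant along the fibres, hence its own average, and [f \o gam i] differs
    from it by fibre derivatives of periodic functions, which [P] annihilates. *)
Lemma P_gam i f x : sm f -> periodic f -> P (f \o gam i) x = P f (gam i x).
Proof.
move=> sf pf; have kP := kop_avgs lams.
have sPf : sm (P f) by exact: (kop_sm kP).
have EP : P (P f \o gam i) = P f \o gam i.
  apply: P_fibre; first exact: sgam.
  by move=> j y fj; rewrite frame_gam // frame_P // mulr0.
rewrite -[RHS]/((P f \o gam i) x) -EP; apply/eqP; rewrite -subr_eq0; apply/eqP.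
have kill ls : {subset ls <= lams} ->
    P (fun y => f (gam i y) - avgs ls f (gam i y)) x = 0.
  elim: ls => [_|lam ls IH sub].
    have -> : (fun y => f (gam i y) - avgs [::] f (gam i y)) = (fun=> 0).
      by apply/funext => y; rewrite subrr.
    exact: (kop0 kP).
  pose g := avgs ls f.
  have sg : sm g by exact: (kop_sm (kop_avgs ls)).
  have pg : periodic g by exact: periodic_avgs.
  have spr : sm (prim lam g) by exact: (kop_sm (kop_prim lam)).
  have ppr : periodic (prim lam g) by exact: periodic_cint.
  (* One averaging step changes [g] by the derivative of [prim lam g] along [lam]. Expanded in the
     frame and pulled back by [gam i], it acquires the inverse eigenvalues of the frame fields. *)
  have E : (fun y => f (gam i y) - avgs (lam :: ls) f (gam i y)) =
      (fun y => (f (gam i y) - g (gam i y)) +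
        (\sum_j (- co j lam) * (wt i j)^-1 * frame_d j (prim lam g \o gam i) y)).
    apply/funext => y; rewrite -[avgs (lam :: ls) f]/(avg lam g).
    have -> : \sum_j (- co j lam) * (wt i j)^-1 * frame_d j (prim lam g \o gam i) y =
       - cderive (prim lam g) (gam i y) lam.
      rewrite coP // -sumrN; apply: eq_bigr => j _; rewrite frame_gam //.
      by rewrite -mulrA mulKf // mulNr.
    by rewrite (kop_d (kop_prim lam)) // prim_derive //; ring.
  rewrite E (kopD kP) ?IH ?add0r; last 3 first.
  - by move=> y yl; apply: sub; rewrite inE yl orbT.
  - apply: (smooth_add oT); first exact: sgam sf.
    have := smooth_scale oT (-1) (sgam i sg).
    by apply: (smooth_eq oT) => y _; rewrite mulN1r.
  - apply: (smooth_sum oT) => j _; apply: (smooth_scale oT).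
    by apply: frame_sm; exact: sgam.
  rewrite (kop_sum kP); last first.
    move=> j; apply: (smooth_scale oT); apply: frame_sm; exact: sgam.
  rewrite big1 // => j _; rewrite (kopZ kP); last by apply: frame_sm; exact: sgam.
  have [fj|nfj] := boolP (fib j).
    by rewrite (P_frame x (sgam i spr) (periodic_gam i ppr) fj) mulr0.
  by rewrite Lat_fib ?oppr0 ?mul0r //; apply: lams_Lat; apply: sub; rewrite mem_head.
have := kill lams (fun _ => id).
have -> : (fun y => f (gam i y) - P f (gam i y)) =
   (fun y => -1 * (P f \o gam i) y + (f \o gam i) y).
  by apply/funext => y; rewrite mulN1r addrC.
rewrite (kop_lin kP) ?mulN1r 1?addrC //; exact: sgam.
Qed.

Definition lat_class l (f : karr l) : Prop :=
  [/\ ksm f, kalt f & forall phi, periodic (f phi)].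

Lemma kalt_lin l c (f g : karr l) : kalt f -> kalt g ->
  kalt (fun phi x => c * f phi x + g phi x).
Proof. by move=> af ag a b phi x ab; rewrite af // ag // mulrN -opprD. Qed.

Lemma ksm_lin l c (f g : karr l) : ksm f -> ksm g ->
  ksm (fun phi x => c * f phi x + g phi x).
Proof. by move=> sf sg phi; exact: smooth_lin. Qed.

Lemma kalt_kop O l (f : karr l) : kop O -> ksm f -> kalt f -> kalt (fun phi => O (f phi)).
Proof.
move=> kO sf af a b phi x ab; rewrite -mulN1r -(kopZ kO) //.
congr (O _ x); apply/funext => y; by rewrite af // mulN1r.
Qed.

Lemma lat_class_closed : kclosed co lat_class lams.
Proof.
split.
- by move=> l f [].
- move=> l; split=> //; first by move=> phi; exact: (smooth_cst oT).
  by move=> a b phi x _; rewrite oppr0.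
- move=> l c f g [sf af pf] [sg ag pg]; split; [exact: ksm_lin | exact: kalt_lin |].
  by move=> phi b x Lb; rewrite pf // pg.
- move=> l lam f _ [sf af pf]; have ka := kop_avg lam; split.
  + by move=> phi; exact: (kop_sm ka).
  + exact: kalt_kop.
  + by move=> phi; exact: periodic_cint.
- move=> l lam f _ [sf af pf]; have ka := kop_prim lam; split.
  + by move=> phi; apply: (kop_sm ka); exact: kiota_sm.
  + by apply: kalt_kop => //; [exact: kiota_sm | exact: kiota_alt].
  + move=> phi; apply: periodic_cint => b x Lb.
    by apply: eq_bigr => j _; rewrite pf.
Qed.

Definition inv_class k l (f : karr l) : Prop :=
  lat_class f /\ forall i phi x, (i < k)%N -> pull i f phi x = f phi x.

Definition mean_zero l (f : karr l) : Prop := forall phi x, P (f phi) x = 0.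

Definition mean_free l (f : karr l) : karr l := fun phi x => f phi x - P (f phi) x.

Lemma lat_class_sub l (f g : karr l) : lat_class f -> lat_class g ->
  lat_class (fun phi x => f phi x - g phi x).
Proof.
move=> lf lg; have := kcl_lin lat_class_closed (-1) lg lf.
have -> // : (fun phi x => -1 * g phi x + f phi x) = (fun phi x => f phi x - g phi x).
by apply/funext => phi; apply/funext => x; rewrite mulN1r addrC.
Qed.

Lemma inv_class_sub k l (f g : karr l) : inv_class k f -> inv_class k g ->
  inv_class k (fun phi x => f phi x - g phi x).
Proof.
move=> [lf vf] [lg vg]; split; first exact: lat_class_sub.
by move=> i phi x ik; rewrite /pull mulrBr -/(pull i f phi x) -/(pull i g phi x) vf ?vg.
Qed.

Lemma lat_class_P l (f : karr l) : lat_class f -> lat_class (fun phi => P (f phi)).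
Proof.
by move=> lf; exact: (avgs_closed lat_class_closed lf (fun _ => id)).
Qed.

Lemma pull_P i l (f : karr l) phi x : lat_class f ->
  pull i (fun phi => P (f phi)) phi x = P (pull i f phi) x.
Proof.
move=> [sf _ pf]; rewrite /pull (kopZ (kop_avgs lams)); last exact: sgam (sf phi).
by rewrite -(P_gam i x (sf phi) (pf phi)).
Qed.

Lemma inv_class_P k l (f : karr l) : inv_class k f -> inv_class k (fun phi => P (f phi)).
Proof.
move=> [lf vf]; split; first exact: lat_class_P.
move=> i phi x ik; rewrite pull_P //; congr (P _ x).
by apply/funext => y; exact: vf.
Qed.

Lemma inv_class_mean_free k l (f : karr l) : inv_class k f -> inv_class k (mean_free f).
Proof. by move=> vf; apply: inv_class_sub => //; exact: inv_class_P. Qed.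

Lemma kopB O f g x : kop O -> sm f -> sm g -> O (fun y => f y - g y) x = O f x - O g x.
Proof.
move=> kO sf sg; have -> : (fun y => f y - g y) = (fun y => -1 * g y + f y).
  by apply/funext => y; rewrite mulN1r addrC.
by rewrite (kop_lin kO) // mulN1r addrC.
Qed.

Lemma mean_zero_free l (f : karr l) : lat_class f -> mean_zero (mean_free f).
Proof.
move=> [sf _ pf] phi x; rewrite /mean_free (kopB _ (kop_avgs lams)) //.
  by rewrite P_idem // subrr.
exact: (kop_sm (kop_avgs lams)).
Qed.

Lemma mean_zeroE l (f : karr l) : mean_zero f -> mean_free f = f.
Proof.
by move=> zf; apply/funext => phi; apply/funext => x; rewrite /mean_free zf subr0.
Qed.

Lemma kdB l (f g : karr l) phi x : ksm f -> ksm g ->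
  kd (fun phi x => f phi x - g phi x) phi x = kd f phi x - kd g phi x.
Proof.
move=> sf sg; have -> : (fun phi x => f phi x - g phi x) =
    (fun phi x => -1 * g phi x + f phi x).
  by apply/funext => psi; apply/funext => y; rewrite mulN1r addrC.
by rewrite kd_lin // mulN1r addrC.
Qed.

Lemma kd_mean_free l (f : karr l) phi x : ksm f ->
  kd (mean_free f) phi x = mean_free (kd f) phi x.
Proof.
move=> sf; rewrite kdB //; last by move=> psi; exact: (kop_sm (kop_avgs lams)).
by rewrite (kop_kd fre fim _ _ (kop_avgs lams)).
Qed.

(* Adding one generator [gam k] at a time: a primitive [eta] of [f] invariant
   under the previous generators is corrected by [d xi], where [xi] solves
   [gam k^* xi - xi = zeta] and [zeta] is a primitive of [gam k^* eta - eta]. *)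
Lemma descent k l (f : karr l) : (k <= N)%N -> inv_class k f -> mean_zero f ->
  knull (kd f) -> kexact fre fim (fun l (g : karr l) => inv_class k g /\ mean_zero g) f.
Proof.
elim: k l f => [|k IH] l f kN [lf vf] zf cf.
  (* Before any generator is imposed, the averaging homotopy itself gives a primitive, since the
     average of [f] is zero. *)
  have := homotopy_avgs coP lat_class_closed lf cf.
  rewrite -/(mean_free f) mean_zeroE //.
  case: l f lf vf zf cf => [//|l] f lf vf zf cf [eta le Ee].
  (* Removing the average of the primitive changes its differential by the average of [f], which is
     zero. *)
  exists (mean_free eta).
    split; last exact: mean_zero_free.
    by apply: inv_class_mean_free; split.
  move=> phi x; rewrite kd_mean_free; last by case: le.
  have <- : f = kd eta by apply/funext => psi; apply/funext => y; exact: Ee.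
  by rewrite mean_zeroE.
have {}IH := fun l f => IH l f (ltnW kN).
have vf' : inv_class k f.
  by split=> // i phi x ik; apply: vf; rewrite ltnW.
have := IH l f vf' zf cf.
case: l f lf vf zf cf vf' => [//|l] f lf vf zf cf vf' [eta [ve ze] Ee].
have [le ie] := ve; have [se ae pe] := le.
pose delta : karr l := fun phi x => pull k eta phi x - eta phi x.
have lpull l' (g : karr l') : lat_class g -> lat_class (pull k g).
  move=> [sg ag pg]; split; [exact: pull_sm | exact: pull_alt |].
  move=> phi b x Lb; rewrite /pull; congr (_ * _).
  exact: (periodic_gam k (pg phi) x Lb).
have pullC i l' (g : karr l') phi x :
    pull i (pull k g) phi x = pull k (pull i g) phi x.
  by rewrite /pull gamC mulrCA.
have vpull l' (g : karr l') : inv_class k g -> inv_class k (pull k g).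
  move=> [lg ig]; split; first exact: lpull.
  move=> i phi x ik; rewrite pullC /pull; congr (_ * _).
  exact: ig.
have vd : inv_class k delta by apply: inv_class_sub => //; exact: vpull.
have zd : mean_zero delta.
  move=> phi x; rewrite (kopB _ (kop_avgs lams)) //; last exact: pull_sm.
  rewrite -pull_P // /pull !ze mulr0 subrr //.
have cd : knull (kd delta).
  move=> phi x; rewrite kdB //; last exact: pull_sm.
  rewrite kd_pull // /pull -!Ee.
  by have := vf k phi x (ltnSn k); rewrite /pull => ->; rewrite subrr.
have := IH l delta vd zd cd.
(* In degree 0 exactness of the defect means that it vanishes, so [eta] is already invariant under
   [gam k]. *)
case: l f lf vf zf cf vf' eta ve ze Ee le ie se ae pe @delta vd zd cd =>
  [|l] f lf vf zf cf vf' eta ve ze Ee le ie se ae pe delta vd zd cd.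
  move=> zdelta; exists eta => //; split => //; split => // i phi x.
  rewrite ltnS leq_eqVlt => /predU1P[->|ik]; last exact: ie.
  by apply/eqP; rewrite -subr_eq0; apply/eqP; exact: zdelta.
move=> [zeta [vz zz] Ez].
have [[sz az pz] iz] := vz.
pose xi : karr l := fun phi => solve (gam k) (gam' k) (ell k) (chi k phi) (zeta phi).
have ellk p : ell k (gam k p) = ell k p + 1 by rewrite ell_gam // eqxx.
have xiE phi x : pull k xi phi x - xi phi x = zeta phi x.
  by apply: solve_eq => //; exact: chi_neq0.
have sxi : ksm xi.
  move=> phi; exact: (@smooth_solve R m n (gam k) (gam' k) (ell k) (chi k phi)
    (gamK' k) (@sgam k) (@sgam' k) (@Cell k) ellk (zeta phi) (sz phi)).
have axi : kalt xi.
  move=> a b phi x ab; rewrite /xi chi_swap.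
  have -> : zeta (swapw a b phi) = (fun y => -1 * zeta phi y).
    by apply/funext => y; rewrite az // mulN1r.
  by rewrite solveZ mulN1r.
have iterL (g : V -> V) : (forall b, Lat b -> exists2 b', Lat b' &
     forall p, g (p + b) = g p + b') -> forall j b, Lat b -> exists2 b', Lat b' &
     forall p, iter j g (p + b) = iter j g p + b'.
  move=> H; elim=> [|j IHj] b Lb; first by exists b.
  have [b1 Lb1 E1] := IHj b Lb; have [b2 Lb2 E2] := H b1 Lb1.
  by exists b2 => // p; rewrite !iterS E1 E2.
have pxi phi : periodic (xi phi).
  (* A lattice translation preserves [ell k], and the iterates of [gam k] and of its inverse turn it
     into lattice translations, under which [zeta] is periodic. *)
  move=> b x Lb; have := @solve_inv R m n (gam k) (gam' k) (ell k) (chi k phi)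
    (gamK' k) ellk (zeta phi) (fun p => p + b) 1 x.
  rewrite mul1r; apply; first exact: ell_Lat.
    move=> j; rewrite mul1r.
    have [b' Lb' E] := iterL (gam k) (@gam_Lat k) j b Lb.
    by rewrite E pz.
  move=> j; rewrite mul1r.
  have [b' Lb' E] := iterL (gam' k) (@gam'_Lat k) j b Lb.
  by rewrite E pz.
have iterC (g g' : V -> V) j p : (forall p, g (g' p) = g' (g p)) ->
    iter j g (g' p) = g' (iter j g p).
  by move=> H; elim: j => [//|j IHj]; rewrite !iterS IHj H.
have gamC' i p : gam' k (gam i p) = gam i (gam' k p).
  by apply: (can_inj (gamK k)); rewrite gamK' gamC gamK'.
have ixi i phi x : (i < k)%N -> pull i xi phi x = xi phi x.
  move=> ik; apply: (@solve_inv R m n (gam k) (gam' k) (ell k) (chi k phi)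
    (gamK' k) ellk (zeta phi) (gam i) (chi i phi) x).
  - by rewrite ell_gam ?(ltn_trans ik) // (ltn_eqF ik) addr0.
  - by move=> j; rewrite iterC; [exact: iz | exact: gamC].
  - by move=> j; rewrite iterC; [exact: iz | exact: gamC'].
have vxi : inv_class k xi by split.
pose xi' := mean_free xi.
have vxi' : inv_class k xi' by exact: inv_class_mean_free.
have zxi' : mean_zero xi' by apply: mean_zero_free; case: vxi.
have [[sxi' axi' pxi'] ixi'] := vxi'.
(* Subtracting the average of [xi] preserves the equation, because averaging commutes with [pull k]
   and [zeta] has average zero. *)
have xiE' phi x : pull k xi' phi x - xi' phi x = zeta phi x.
  transitivity ((pull k xi phi x - xi phi x) -
      (pull k (fun phi => P (xi phi)) phi x - P (xi phi) x)).
    by rewrite /xi' /mean_free /pull; ring.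
  rewrite xiE pull_P // -(kopB _ (kop_avgs lams)) //; last exact: pull_sm.
  have -> : (fun y => pull k xi phi y - xi phi y) = zeta phi.
    by apply/funext => y; exact: xiE.
  by rewrite zz subr0.
have sdxi := kd_sm fre fim sxi'.
have vdxi : inv_class k (kd xi').
  split; first split => //.
  - exact: kd_alt.
  - move=> phi b x Lb; apply: eq_bigr => j _; congr (_ * _).
    by apply: (periodic_frame _ (sxi' _) (pxi' _)).
  move=> i phi x ik; rewrite -kd_pull //.
  have -> // : pull i xi' = xi'.
  by apply/funext => psi; apply/funext => y; exact: ixi'.
exists (fun phi x => eta phi x - kd xi' phi x).
  split; last first.
    move=> phi x; rewrite (kopB _ (kop_avgs lams)) // ze sub0r.
    rewrite -(kop_kd fre fim _ _ (kop_avgs lams)) //.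
    rewrite kdE big1 ?oppr0 // => j _.
    have -> : P (xi' (omitw j phi)) = (fun=> 0) by apply/funext => y; exact: zxi'.
    by rewrite (kop0 (kop_frame_d _ _ _)) mulr0.
  split; first by case: (inv_class_sub ve vdxi).
  move=> i phi x; rewrite ltnS leq_eqVlt => /predU1P[->|ik]; last first.
    by have [_] := inv_class_sub ve vdxi; apply.
  apply/eqP; rewrite -subr_eq0; apply/eqP.
  (* The defect of the corrected primitive is [delta] minus [kd zeta], which is zero by the choice
     of [zeta]. *)
  transitivity (delta phi x - (pull k (kd xi') phi x - kd xi' phi x)).
    by rewrite /delta /pull; ring.
  rewrite -kd_pull // -kdB //; last exact: pull_sm.
  rewrite Ez; have -> : (fun phi x => pull k xi' phi x - xi' phi x) = zeta.
    by apply/funext => psi; apply/funext => y; exact: xiE'.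
  by rewrite subrr.
by move=> phi x; rewrite kdB // -Ee kd_kd // subr0.
Qed.

(* [cvec i] is the translation of the base induced by [gam i]. *)
Variable cvec : nat -> V.
Hypothesis gam_cvec : forall i x, (i < N)%N -> exists2 mu, gam i x = x + cvec i + mu &
  forall j, ~~ fib j -> co j mu = 0.
Hypothesis cvec_base : forall i j, fib j -> co j (cvec i) = 0.
Hypothesis base_span : forall j, ~~ fib j -> exists W : V -> R[i],
  forall (f : V -> R[i]) x, sm f ->
  frame_d j f x = \sum_(lam <- map cvec (iota 0 N)) W lam * cderive f x lam.
Hypothesis wt_base : forall i j, ~~ fib j -> wt i j = 1.

(** * Arrays constant along the fibres and their characters *)

Definition xclass l (f : karr l) : Prop := inv_class N f.
Definition fib_const l (f : karr l) : Prop :=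
  forall phi j x, fib j -> frame_d j (f phi) x = 0.
Definition base_class l (f : karr l) : Prop :=
  [/\ ksm f, kalt f, fib_const f &
     forall i phi x, (i < N)%N -> pull i f phi x = f phi x].
Definition fibset l (phi : 'I_l -> T) : {set T} :=
  [set j | fib j && [exists a, phi a == j]].
Definition chiI i (I : {set T}) : R[i] := rho i * \prod_(j in I) wt i j.
Definition proj_fib (I : {set T}) l (f : karr l) : karr l :=
  fun phi x => (fibset phi == I)%:R * f phi x.

Lemma mu_invariant f mu x : sm f -> (forall j x, fib j -> frame_d j f x = 0) ->
  (forall j, ~~ fib j -> co j mu = 0) -> f (x + mu) = f x.
Proof.
move=> sf H m0; rewrite -[mu]scale1r; apply: const_along => // y.
rewrite coP // big1 // => j _.
by have [fj|nfj] := boolP (fib j); [rewrite H ?mulr0 | rewrite m0 ?mul0r].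
Qed.

Lemma fib_const_periodic l (f : karr l) phi : ksm f -> fib_const f -> periodic (f phi).
Proof.
move=> sf cf b x Lb; apply: mu_invariant => //; first by move=> j y; exact: cf.
by move=> j; exact: Lat_fib.
Qed.

Lemma base_xclass l (f : karr l) : base_class f -> xclass f.
Proof.
move=> [sf af cf vf]; split=> //; split=> // phi.
exact: fib_const_periodic.
Qed.

(** The points [gam i x] and [x + cvec i] differ by a fibre vector, which such an array does not
    see. Invariance thus becomes a translation law on the base. *)
Lemma fib_const_gam l (f : karr l) i phi x : (i < N)%N -> ksm f -> fib_const f ->
  f phi (gam i x) = f phi (x + cvec i).
Proof.
move=> iN sf cf; have [mu -> m0] := gam_cvec x iN.
by apply: mu_invariant => // j y; exact: cf.
Qed.

(** Base letters have weight 1, and injectivity makes each fibre letter count once. Words with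
    repetitions carry no nonzero alternating coefficient. *)
Lemma chi_fibset i l (phi : 'I_l -> T) : injective phi -> chi i phi = chiI i (fibset phi).
Proof.
move=> iphi; rewrite /chi /chiI; congr (_ * _).
rewrite (bigID (fun a => fib (phi a))) /= [X in _ * X]big1 ?mulr1; last first.
  by move=> a; exact: wt_base.
rewrite (reindex_omap phi (fun j => [pick a | phi a == j])) /=.
  apply: eq_bigl => a; rewrite inE; case: pickP => [b /eqP/iphi ->|/(_ a)]; last by rewrite eqxx.
  rewrite eqxx andbT; apply: esym; rewrite andbC.
  by have -> : [exists b, phi b == phi a] by apply/existsP; exists a.
move=> j; rewrite inE => /andP[_ /existsP[a /eqP <-]].
by case: pickP => [b /eqP /= ->|/(_ a)] //; rewrite eqxx.
Qed.

Lemma fibset_omit l (a : 'I_l.+1) (phi : 'I_l.+1 -> T) : ~~ fib (phi a) ->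
  fibset (omitw a phi) = fibset phi.
Proof.
move=> nf; apply/setP => j; rewrite !inE; case fj: (fib j) => //=.
apply/existsP/existsP => [[b /eqP <-]|[b /eqP E]]; first by exists (lift a b).
have [b' eb|eb] := unliftP a b; first by exists b'; rewrite /omitw -eb E.
by move: nf; rewrite -eb E fj.
Qed.

Lemma fibset_swap l (a b : 'I_l) (phi : 'I_l -> T) : fibset (swapw a b phi) = fibset phi.
Proof.
apply/setP => j; rewrite !inE; case: (fib j) => //=.
apply/existsP/existsP => -[c /eqP <-]; first by exists (tperm a b c).
by exists (tperm a b c); rewrite /swapw tpermK.
Qed.

(** A term of [kd] that deletes a fibre letter differentiates along the fibre and vanishes; deleting
    a base letter leaves the set of fibre letters unchanged. *)
Lemma kd_proj I l (f : karr l) phi x : ksm f -> fib_const f ->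
  kd (proj_fib I f) phi x = proj_fib I (kd f) phi x.
Proof.
move=> sf cf; rewrite /proj_fib !kdE mulr_sumr; apply: eq_bigr => a _.
rewrite (kopZ (kop_frame_d _ _ _)) //.
have [fa|nfa] := boolP (fib (phi a)); first by rewrite cf // !mulr0.
by rewrite fibset_omit // mulrCA.
Qed.

Lemma base_proj I l (f : karr l) : base_class f -> base_class (proj_fib I f).
Proof.
move=> [sf af cf vf]; split.
- by move=> phi; exact: (smooth_scale oT).
- by move=> a b phi x ab; rewrite /proj_fib fibset_swap af // mulrN.
- by move=> phi j x fj; rewrite (kopZ (kop_frame_d _ _ _)) // cf // mulr0.
- by move=> i phi x iN; rewrite /pull /proj_fib mulrCA -/(pull i f phi x) vf.
Qed.

Lemma chi_cons i l j (phi : 'I_l -> T) : ~~ fib j -> chi i (consw j phi) = chi i phi.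
Proof. by move=> nf; rewrite (chi_omit i ord0) omitw_cons0 consw0 wt_base // mulr1. Qed.

Lemma cint_gam (w : R -> R) lam f i x : continuous w -> (i < N)%N -> sm f ->
  (forall r : R, 0 <= r <= 1 -> `|w r| <= 1) ->
  (forall j x, fib j -> frame_d j f x = 0) ->
  cint w lam f (gam i x) = cint w lam (fun y => f (y + cvec i)) x.
Proof.
move=> cw iN sf w1 H; rewrite cint_translate.
have [mu -> m0] := gam_cvec x iN.
apply: mu_invariant => //; first exact: smooth_cint.
move=> j y fj; have kO := kop_cint lam cw w1.
rewrite (kop_frame _ _ _ _ kO) //.
have -> : frame_d j f = (fun=> 0) by apply/funext => z; exact: H.
exact: (kop0 kO).
Qed.

Lemma fib_const_kop O l (f : karr l) : kop O -> ksm f -> fib_const f ->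
  fib_const (fun phi => O (f phi)).
Proof.
move=> kO sf cf phi j x fj; rewrite (kop_frame _ _ _ _ kO) //.
have -> : frame_d j (f phi) = (fun=> 0) by apply/funext => y; exact: cf.
exact: (kop0 kO).
Qed.

Lemma base_cint (w : R -> R) lam l (f : karr l) : kop (cint w lam) -> continuous w ->
  (forall r : R, 0 <= r <= 1 -> `|w r| <= 1) ->
  base_class f -> base_class (fun phi => cint w lam (f phi)).
Proof.
move=> kO cw w1 [sf af cf vf]; split.
- by move=> phi; exact: (kop_sm kO).
- exact: kalt_kop.
- exact: fib_const_kop.
move=> i phi x iN; rewrite /pull cint_gam //; last by move=> j y; exact: cf.
rewrite -(kopZ kO); last exact: smooth_translate.
congr (cint w lam _ x); apply/funext => y.
by rewrite -fib_const_gam //; exact: vf.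
Qed.

Lemma base_kiota i l (f : karr l.+1) : base_class f -> base_class (kiota co (cvec i) f).
Proof.
move=> [sf af cf vf]; split; [exact: kiota_sm | exact: kiota_alt | |].
- move=> phi j x fj; rewrite /kiota (kop_sum (kop_frame_d _ _ _)) => [|k]; last first.
    exact: (smooth_scale oT).
  by rewrite big1 // => k _; rewrite (kopZ (kop_frame_d _ _ _)) // cf // mulr0.
- move=> i' phi x iN; rewrite /pull /kiota mulr_sumr; apply: eq_bigr => j _.
  have [fj|nfj] := boolP (fib j); first by rewrite cvec_base // !mul0r mulr0.
  by rewrite mulrCA -(chi_cons i' phi nfj) -/(pull i' f _ x) vf.
Qed.

Lemma base_lin l c (f g : karr l) : base_class f -> base_class g ->
  base_class (fun phi x => c * f phi x + g phi x).
Proof.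
move=> [sf af cf vf] [sg ag cg vg]; split.
- exact: ksm_lin.
- exact: kalt_lin.
- by move=> phi j x fj; rewrite (kop_lin (kop_frame_d _ _ _)) // cf // cg // mulr0 addr0.
- move=> i phi x iN; rewrite /pull mulrDr mulrCA -/(pull i f phi x) -/(pull i g phi x).
  by rewrite vf // vg.
Qed.

Lemma base_zero l : @base_class l (fun _ _ => 0).
Proof.
split.
- by move=> phi; exact: (smooth_cst oT).
- by move=> a b phi x _; rewrite oppr0.
- by move=> phi j x _; exact: (kop0 (kop_frame_d _ _ _)).
- by move=> i phi x _; rewrite /pull mulr0.
Qed.

Notation cvecs := (map cvec (seq.iota 0 N)).

Lemma base_closed : kclosed co base_class cvecs.
Proof.
split.
- by move=> l f [].
- exact: base_zero.
- by move=> l c f g; exact: base_lin.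
- move=> l lam f _ bf; apply: base_cint => //; first exact: kop_avg.
    exact: unit_weightC.
  exact: unit_weight1.
- move=> l lam f /mapP[i _ ->] bf; apply: (base_cint (kop_prim _)).
  + exact: taperC.
  + exact: taper1.
  + exact: base_kiota.
Qed.

Lemma base_translate i I l (f : karr l) phi x : (i < N)%N -> base_class f ->
  chiI i I * proj_fib I f phi (x + cvec i) = proj_fib I f phi x.
Proof.
move=> iN bf; have [sf af cf vf] := base_proj I bf.
rewrite -(fib_const_gam _ _ iN sf cf) -(vf i phi x iN) /pull.
have [->|nz] := eqVneq (proj_fib I f phi (gam i x)) 0; first by rewrite !mulr0.
congr (_ * _); have ip := kalt_inj af nz.
move: nz; rewrite /proj_fib; case: (fibset phi =P I) => [<-|_]; last by rewrite mulr0n mul0r eqxx.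
by rewrite chi_fibset.
Qed.

(** Translation by [cvec i] multiplies the component by [(chiI i I)^-1]. The average of its
    derivative along [cvec i] is therefore a nonzero multiple of the component itself, and by
    Cartan's formula this derivative is exact. *)
Lemma base_nontrivial I i l (f : karr l) : (i < N)%N -> chiI i I != 1 ->
  base_class f -> knull (kd f) -> kexact fre fim base_class (proj_fib I f).
Proof.
move=> iN ci bf cf; have bg := base_proj I bf.
have [sf _ fcf _] := bf; have [sg ag fcg vg] := bg.
have c0 : chiI i I != 0.
  by rewrite mulf_neq0 //; apply/prodf_neq0.
have cg : knull (kd (proj_fib I f)).
  by move=> phi x; rewrite kd_proj // /proj_fib cf mulr0.
have tr phi x : proj_fib I f phi (x + cvec i) = (chiI i I)^-1 * proj_fib I f phi x.
  by rewrite -(base_translate I phi x iN bf) mulKf.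
pose c := (chiI i I)^-1 - 1.
have cn0 : c != 0 by rewrite subr_eq0 invr_eq1.
have key phi x : avg (cvec i) (fun y => cderive (proj_fib I f phi) y (cvec i)) x =
    c * proj_fib I f phi x.
  by rewrite avg_derive // tr /c mulrBl mul1r.
move: (proj_fib I f) bg sg ag fcg vg cg key {tr} => g bg sg ag fcg vg cg key.
case: l f g {bf sf fcf cf} bg sg ag fcg vg cg key => [|l] _ g bg sg ag fcg vg cg key /=.
  move=> phi x; apply/eqP; rewrite -(mulrI_eq0 _ (mulfI cn0)) -key; apply/eqP.
  have -> : (fun y => cderive (g phi) y (cvec i)) = (fun=> 0).
    apply/funext => y; rewrite -(cartan0 coP) // /kiota big1 // => j _.
    by rewrite cg mulr0.
  exact: (kop0 (kop_avg _)).
exists (fun phi x => c^-1 * avg (cvec i) (kiota co (cvec i) g phi) x).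
  have := base_lin c^-1 (base_cint (kop_avg (cvec i)) (@unit_weightC R) (@unit_weight1 R)
     (base_kiota i bg)) (base_zero l).
  have -> // : (fun (phi : 'I_l -> T) x => c^-1 * cint (@unit_weight R) (cvec i)
      (kiota co (cvec i) g phi) x + 0) =
    (fun phi x => c^-1 * avg (cvec i) (kiota co (cvec i) g phi) x).
  by apply/funext => phi; apply/funext => x; rewrite addr0.
move=> phi x.
have kO : kop (fun h x => c^-1 * avg (cvec i) h x).
  have ka := kop_avg (cvec i); split.
  - by move=> h sh; apply: (smooth_scale oT); exact: (kop_sm ka).
  - by move=> d h h' y sh sh'; rewrite (kop_lin ka) //; ring.
  - move=> h v y sh; rewrite (cderiveZ oT) ?(kop_d ka) //.
    exact: (kop_sm ka).
rewrite (kop_kd fre fim _ _ kO); last exact: kiota_sm.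
have -> : kd (kiota co (cvec i) g) phi = (fun y => cderive (g phi) y (cvec i)).
  apply/funext => y; rewrite -(cartan coP) // [X in _ = X + _](_ : _ = 0) ?add0r //.
  by rewrite /kiota big1 // => j _; rewrite cg mulr0.
by rewrite key mulKf.
Qed.

(** With trivial multipliers the component is periodic under every [cvec i]. These span the base
    directions, so averaging over them kills the remaining derivatives. *)
Lemma base_trivial_const I l (f : karr l) phi j x : base_class f ->
  (forall i, (i < N)%N -> chiI i I = 1) ->
  frame_d j (avgs cvecs (proj_fib I f phi)) x = 0.
Proof.
move=> bf tI; have [sf af cf vf] := base_proj I bf.
rewrite (kop_frame _ _ _ _ (kop_avgs _)) //.
have [fj|nfj] := boolP (fib j).
  have -> : frame_d j (proj_fib I f phi) = (fun=> 0) by apply/funext => y; exact: cf.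
  exact: (kop0 (kop_avgs _)).
have [W HW] := base_span nfj.
have -> : frame_d j (proj_fib I f phi) = fun y =>
    \sum_(lam <- cvecs) W lam * cderive (proj_fib I f phi) y lam.
  by apply/funext => y; rewrite HW.
rewrite (kop_sum (kop_avgs _)); last first.
  by move=> lam; apply: (smooth_scale oT); exact: smooth_cderive.
rewrite big1_seq // => lam /= /[dup] ll /mapP[i ii ->].
have iN : (i < N)%N by move: ii; rewrite mem_iota add0n.
rewrite (kopZ (kop_avgs _)); last exact: smooth_cderive.
rewrite avgs_derive ?mulr0 //; first by apply: map_f; rewrite mem_iota.
by move=> y; rewrite -[RHS](base_translate I phi y iN bf) tI // mul1r.
Qed.

Definition trivial_set (I : {set T}) : Prop := forall i, (i < N)%N -> chiI i I = 1.

Lemma kexact_sum (K : kclass R m n T) ls l (A : Type) (r : seq A) (F : A -> karr l) :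
  kclosed co K ls -> (forall a, kexact fre fim K (F a)) ->
  kexact fre fim K (fun phi x => \sum_(a <- r) F a phi x).
Proof.
move=> KK H; elim: r => [|a r IH].
  apply: kexact_eq (kexact0 fre fim l KK) => phi x; by rewrite big_nil.
apply: kexact_eq (kexact_lin 1 KK (H a) IH) => phi x.
by rewrite big_cons mul1r.
Qed.

Lemma kexact_mono (K K' : kclass R m n T) l (f : karr l) :
  (forall l (g : karr l), K l g -> K' l g) ->
  kexact fre fim K f -> kexact fre fim K' f.
Proof.
by move=> H; case: l f => [|l] f //= [eta Ke Ee]; exists eta => //; exact: H.
Qed.

Definition constant_arr l (k : karr l) : Prop :=
  [/\ ksm k, kalt k, forall phi j x, frame_d j (k phi) x = 0 &
     forall phi x, ~ trivial_set (fibset phi) -> k phi x = 0].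

Theorem cohomology_constant l (f : karr l) : xclass f -> knull (kd f) ->
  exists2 k : karr l, constant_arr k &
    kexact fre fim xclass (fun phi x => f phi x - k phi x).
Proof.
move=> vf cf; have [lf _] := vf; have [sf af pf] := lf.
pose g : karr l := fun phi => P (f phi).
have vg : xclass g by exact: inv_class_P.
have [[sg ag pg] ig] := vg.
have bg : base_class g.
  by split => // phi j x fj; exact: frame_P.
have cg : knull (kd g).
  move=> phi x; rewrite (kop_kd fre fim _ _ (kop_avgs lams)) //.
  have -> : kd f phi = (fun=> 0) by apply/funext => y; exact: cf.
  exact: (kop0 (kop_avgs lams)).
have e1 : kexact fre fim xclass (fun phi x => f phi x - g phi x).
  have := descent (leqnn N) (inv_class_mean_free vf) (mean_zero_free lf).
  move=> H; apply: kexact_mono (H _); first by move=> l' h [].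
  move=> phi x; rewrite kd_mean_free // /mean_free cf.
  have -> : kd f phi = (fun=> 0) by apply/funext => y; exact: cf.
  by rewrite (kop0 (kop_avgs lams)) subr0.
(* The constant representative of the component [I]; a component with nontrivial character is exact
   and is represented by 0. *)
pose h I : karr l := fun phi x => if `[< trivial_set I >] then avgs cvecs (proj_fib I g phi) x else 0.
have bh I : base_class (h I).
  rewrite /h; case: asboolP => tI; last exact: base_zero.
  exact: (avgs_closed base_closed (base_proj I bg) (fun _ => id)).
have e2 I : kexact fre fim base_class (fun phi x => proj_fib I g phi x - h I phi x).
  rewrite /h; case: asboolP => tI.
    apply: (homotopy_avgs coP base_closed); first exact: base_proj.
    move=> phi x; rewrite kd_proj //; last by case: bg.
    by rewrite /proj_fib cg mulr0.
  have [i [iN ci]] : exists i, (i < N)%N /\ chiI i I != 1.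
    apply: contrapT => H; apply: tI => i iN; apply/eqP; apply: contrapT => /negP ci.
    by apply: H; exists i.
  apply: kexact_eq (base_nontrivial iN ci bg cg) => phi x; by rewrite subr0.
pose k : karr l := fun phi x => \sum_I h I phi x.
have hsupp I phi x : fibset phi != I -> h I phi x = 0.
  move=> ne; rewrite /h; case: asboolP => // tI.
  have -> : proj_fib I g phi = (fun=> 0).
    by apply/funext => y; rewrite /proj_fib (negbTE ne) mul0r.
  exact: (kop0 (kop_avgs _)).
exists k.
  split.
  - by move=> phi; apply: (smooth_sum oT) => I _; have [sh _ _ _] := bh I.
  - move=> a b phi x ab; rewrite /k -sumrN; apply: eq_bigr => I _.
    by have [_ ah _ _] := bh I; exact: ah.
  - move=> phi j x; rewrite /k (kop_sum (kop_frame_d _ _ _)) => [|I]; last first.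
      by have [sh _ _ _] := bh I.
    rewrite big1 // => I _; rewrite /h; case: asboolP => tI.
      exact: base_trivial_const.
    exact: (kop0 (kop_frame_d _ _ _)).
  - move=> phi x nt; rewrite /k big1 // => I _.
    have [E|ne] := eqVneq (fibset phi) I; last exact: hsupp.
    by rewrite /h; case: asboolP => // tI; case: nt; rewrite E.
have e3 : kexact fre fim xclass (fun phi x => g phi x - k phi x).
  apply: (kexact_mono base_xclass).
  apply: kexact_eq (kexact_sum (index_enum _) base_closed e2) => phi x.
  rewrite sumrB; congr (_ - _).
  rewrite (bigD1 (fibset phi)) //= big1 ?addr0 /proj_fib ?eqxx ?mul1r // => I ne.
  by rewrite eq_sym (negbTE ne) mul0r.
case: l f vf cf lf sf af pf g vg sg ag pg ig bg cg e1 h bh e2 k hsupp e3 =>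
  [|l] f vf cf lf sf af pf g vg sg ag pg ig bg cg e1 h bh e2 k hsupp /=.
  move=> e3 phi x; rewrite -(subrKA (g phi x)).
  by rewrite (e1 phi x) (e3 phi x) addr0.
(* The primitives of [f - g] and of [g - k] add up. *)
move=> [eta' ve' E']; have [eta ve E] := e1.
exists (fun phi x => 1 * eta phi x + eta' phi x).
  split.
    by apply: (kcl_lin lat_class_closed); [case: ve | case: ve'].
  move=> i phi x iN; rewrite /pull mulrDr mul1r -/(pull i eta phi x) -/(pull i eta' phi x).
  by have [_ ->] := ve => //; have [_ ->] := ve'; rewrite ?mul1r.
move=> phi x; rewrite kd_lin; last 2 first.
- by case: ve => -[].
- by case: ve' => -[].
by rewrite mul1r -E -E' addrA subrK.
Qed.

Theorem constant_exact_zero l (k : karr l) : constant_arr k ->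
  kexact fre fim xclass k -> knull k.
Proof.
case: l k => [//|l] k [sk ak ck tk] [eta ve Ee] phi x.
have [lf ie] := ve; have [se ae pe] := lf.
apply: contrapT => nz.
(* A nonzero value can only occur at a word whose character is trivial, and there averaging over the
   base yields constants. *)
have tI : trivial_set (fibset phi) by apply: contrapT => nt; apply: nz; exact: tk.
pose e1 : karr l := fun phi => P (eta phi).
have ve1 : xclass e1 by exact: inv_class_P.
have [[se1 ae1 pe1] ie1] := ve1.
have be : base_class e1 by split => // psi j y fj; exact: frame_P.
have Ee1 psi y : k psi y = kd e1 psi y.
  rewrite (kop_kd fre fim _ _ (kop_avgs lams)) //.
  have -> : kd eta psi = k psi by apply/funext => z; rewrite Ee.
  by rewrite P_fibre.
pose I := fibset phi.
have [sp ap cp vp] := base_proj I be.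
have Ep : k phi = kd (proj_fib I e1) phi.
  apply/funext => y; rewrite kd_proj //; last by case: be.
  by rewrite /proj_fib /I eqxx mul1r -Ee1.
(* Averaging over the base commutes with [kd] and makes the component of the primitive constant,
   whereas it fixes the constant [k phi]. *)
have : avgs cvecs (k phi) x = 0.
  rewrite Ep -(kop_kd fre fim _ _ (kop_avgs cvecs)) // kdE big1 // => a _.
  by rewrite base_trivial_const // mulr0.
rewrite avgs_const // => lam y _; rewrite coP // big1 // => j _.
by rewrite ck mulr0.
Qed.

End Descent.

(** * Multilinear maps *)

Section BigWords.
Variables (B : finType) (C : nmodType) (l : nat) (i : 'I_l.+1).

Lemma big_ffun_omit (G : B -> ('I_l -> B) -> C) :
  \sum_(beta : {ffun 'I_l.+1 -> B}) G (beta i) (omitw i beta) =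
  \sum_b \sum_(beta : {ffun 'I_l -> B}) G b beta.
Proof.
rewrite pair_bigA /=.
pose f (z : B * {ffun 'I_l -> B}) : {ffun 'I_l.+1 -> B} :=
  [ffun x => if unlift i x is Some a then z.2 a else z.1].
pose g (beta : {ffun 'I_l.+1 -> B}) := (beta i, [ffun a => beta (lift i a)]).
have fK : cancel f g.
  case=> b beta; rewrite /f /g /=; congr (_, _); first by rewrite ffunE unlift_none.
  by apply/ffunP => a; rewrite !ffunE liftK.
have gK : cancel g f.
  move=> beta; apply/ffunP => x; rewrite /f /g ffunE /=.
  by have [a ->|->] := unliftP i x; rewrite ?ffunE.
rewrite (reindex f); last by exists g => z _; [exact: fK | exact: gK].
apply: eq_bigr => -[b beta] _ /=; rewrite ffunE unlift_none; congr (G b _).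
by apply/funext => a; rewrite /omitw ffunE liftK.
Qed.

End BigWords.

Section Multilinear.
Variables (R : realType) (m n : nat).
Notation V := 'M[R]_(m, n).
Notation B := ('I_m * 'I_n)%type.

Definition mlin l (W : ('I_l -> V) -> R[i]) : Prop :=
  forall h i (c : R) y z, W (dfwith h i (c *: y + z)) =
    c%:C * W (dfwith h i y) + W (dfwith h i z).

Lemma dfwith_consS l v (h : 'I_l -> V) i y :
  dfwith (consw v h) (lift ord0 i) y = consw v (dfwith h i y).
Proof.
apply/funext => k; have [a ->|->] := unliftP ord0 k; rewrite ?conswS ?consw0.
  have [->|ai] := eqVneq i a; first by rewrite !dfwithin.
  by rewrite !dfwithout ?conswS // (inj_eq lift_inj).
by rewrite dfwithout ?consw0 // eq_sym neq_lift.
Qed.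

Lemma dfwith_cons0 l v (h : 'I_l -> V) y : dfwith (consw v h) ord0 y = consw y h.
Proof.
apply/funext => k; have [a ->|->] := unliftP ord0 k; rewrite ?conswS ?consw0.
  by rewrite dfwithout ?conswS // neq_lift.
by rewrite dfwithin.
Qed.

Lemma consw_omit0 (A : Type) l (h : 'I_l.+1 -> A) : consw (h ord0) (omitw ord0 h) = h.
Proof.
by apply/funext => k; have [a ->|->] := unliftP ord0 k; rewrite ?conswS ?consw0.
Qed.

Lemma mlin_cons l (W : ('I_l.+1 -> V) -> R[i]) v : mlin W ->
  mlin (fun h => W (consw v h)).
Proof. by move=> mW h i c y z; rewrite -!dfwith_consS mW. Qed.

Lemma mlin_head l (W : ('I_l.+1 -> V) -> R[i]) h (c : R) y z : mlin W ->
  W (consw (c *: y + z) h) = c%:C * W (consw y h) + W (consw z h).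
Proof. by move=> mW; have := mW (consw 0 h) ord0 c y z; rewrite !dfwith_cons0. Qed.

Lemma mlin_head_expand l (W : ('I_l.+1 -> V) -> R[i]) h v : mlin W ->
  W (consw v h) = \sum_(b : B) (v b.1 b.2)%:C * W (consw (delta_mx b.1 b.2) h).
Proof.
move=> mW; have W0 : W (consw 0 h) = 0.
  have := mlin_head h 1 0 0 mW; rewrite scale1r addr0 mul1r => /eqP.
  by rewrite -subr_eq addrN eq_sym => /eqP.
have key (r : seq B) : W (consw (\sum_(b <- r) v b.1 b.2 *: delta_mx b.1 b.2) h) =
    \sum_(b <- r) (v b.1 b.2)%:C * W (consw (delta_mx b.1 b.2) h).
  elim: r => [|b r IH]; first by rewrite !big_nil W0.
  by rewrite !big_cons mlin_head // IH.
rewrite -key; congr (W (consw _ h)).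
by rewrite [LHS]matrix_sum_delta pair_bigA.
Qed.

Lemma mlin_expand l (W : ('I_l -> V) -> R[i]) h : mlin W ->
  W h = \sum_(beta : {ffun 'I_l -> B})
    (\prod_i (h i (beta i).1 (beta i).2)%:C) *
      W (fun i => delta_mx (beta i).1 (beta i).2).
Proof.
elim: l W h => [|l IH] W h mW.
  (* The unique word of length 0. *)
  rewrite (bigD1 [ffun i : 'I_0 => match i with Ordinal _ p => False_rect _ (notF p) end]) //=.
  rewrite big_ord0 mul1r big1 ?addr0; last first.
    by move=> beta /eqP ne; case: ne; apply/ffunP => -[].
  by congr W; apply/funext => -[].
rewrite -[h in LHS]consw_omit0 mlin_head_expand //.
under [RHS]eq_bigr => beta _.
  rewrite big_ord_recl.
  have -> : (fun i => delta_mx (beta i).1 (beta i).2) =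
     consw (delta_mx (beta ord0).1 (beta ord0).2)
       (fun i => delta_mx (omitw ord0 beta i).1 (omitw ord0 beta i).2) :> ('I_l.+1 -> V).
    by rewrite -[LHS]consw_omit0.
  over.
rewrite (big_ffun_omit ord0 (fun b (beta : 'I_l -> B) =>
  (h ord0 b.1 b.2)%:C * (\prod_(i < l) (h (lift ord0 i) (beta i).1 (beta i).2)%:C) *
  W (consw (delta_mx b.1 b.2) (fun i => delta_mx (beta i).1 (beta i).2)))).
apply: eq_bigr => b _.
rewrite (IH (fun h => W (consw _ h))); last exact: mlin_cons.
by rewrite mulr_sumr; apply: eq_bigr => beta _; rewrite mulrA.
Qed.

Lemma dfwith_id l (h : 'I_l -> V) i : dfwith h i (h i) = h.
Proof.
apply/funext => k; have [<-|ik] := eqVneq i k; first by rewrite dfwithin.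
by rewrite dfwithout.
Qed.

Lemma dfwithC l (h : 'I_l -> V) i j y z : i != j ->
  dfwith (dfwith h i y) j z = dfwith (dfwith h j z) i y.
Proof.
move=> ij; apply/funext => k.
have [<-|ik] := eqVneq i k.
  by rewrite dfwithin dfwithout ?dfwithin // eq_sym.
have [<-|jk] := eqVneq j k; first by rewrite dfwithin dfwithout ?dfwithin.
by rewrite !dfwithout.
Qed.

(** Polarization: put [h a + h b] into both slots and expand. *)
Lemma alternating_antisym l (W : ('I_l -> V) -> R[i]) : mlin W ->
  (forall h i j, i != j -> h i = h j -> W h = 0) -> antisym W.
Proof.
move=> mW aW a b h ab.
have nab : a != b by rewrite -val_eqE /= ab; lia.
pose D y z := W (dfwith (dfwith h a y) b z).
have D0 y : D y y = 0.
  apply: (aW _ a b) => //; rewrite dfwithin dfwithout ?dfwithin // eq_sym.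
  by [].
have Dl y y' z : D (y + y') z = D y z + D y' z.
  rewrite /D !(dfwithC _ _ _ nab); have := mW (dfwith h b z) a 1 y y'.
  by rewrite scale1r mul1r.
have Dr y z z' : D y (z + z') = D y z + D y z'.
  by rewrite /D; have := mW (dfwith h a y) b 1 z z'; rewrite scale1r mul1r.
have E1 : W h = D (h a) (h b).
  by rewrite /D dfwith_id; congr W; rewrite -[LHS](dfwith_id _ b).
have -> : W (swapw a b h) = D (h b) (h a).
  rewrite /D; congr W; apply/funext => k; rewrite /swapw.
  have [->|bk] := eqVneq k b; first by rewrite tpermR dfwithin.
  rewrite dfwithout ?[b == k]eq_sym //.
  have [->|ak] := eqVneq k a; first by rewrite tpermL dfwithin.
  by rewrite dfwithout 1?eq_sym // tpermD // eq_sym.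
rewrite E1; apply/eqP; rewrite -addr_eq0; apply/eqP.
have := D0 (h a + h b); rewrite Dl !Dr !D0 add0r addr0 addrC.
by [].
Qed.

Lemma alternating_sum (A : Type) l (F : A -> ('I_l -> A) -> R[i]) :
  (forall v, antisym (F v)) ->
  antisym (fun h : 'I_l.+1 -> A => \sum_(i < l.+1) (-1) ^+ i * F (h i) (omitw i h)).
Proof.
move=> aF a b h ab.
have nab : a != b by rewrite -val_eqE /= ab; lia.
rewrite (bigD1 a) //= (bigD1 b) /=; last by rewrite eq_sym.
rewrite [in RHS](bigD1 a) //= [in RHS](bigD1 b) /=; last by rewrite eq_sym.
have [-> ->] := omitw_swap h ab.
rewrite {1 2}/swapw tpermL tpermR ab exprS.
rewrite !opprD -sumrN !mulN1r !mulNr opprK addrCA; congr (_ + (_ + _)).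
apply: eq_bigr => i /andP[ia ib].
have [a' [b' [ab' E]]] := omitw_swap_other h ab ia ib.
have -> : swapw a b h i = h i by rewrite /swapw tpermD // eq_sym.
by rewrite E aF // mulrN.
Qed.

Lemma mlin_sum l (F : V -> ('I_l -> V) -> R[i]) :
  (forall v, mlin (F v)) ->
  (forall h (c : R) y z, F (c *: y + z) h = c%:C * F y h + F z h) ->
  mlin (fun h : 'I_l.+1 -> V => \sum_(i < l.+1) (-1) ^+ i * F (h i) (omitw i h)).
Proof.
move=> mF lF h k c y z; rewrite mulr_sumr -big_split /=; apply: eq_bigr => i _.
have [->|ik] := eqVneq i k.
  have E v : omitw k (dfwith h k v) = omitw k h.
    by apply/funext => j; rewrite /omitw dfwithout // neq_lift.
  by rewrite !E !dfwithin lF; ring.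
have [k' ek|ek] := unliftP i k; last by rewrite ek eqxx in ik.
have E v : omitw i (dfwith h k v) = dfwith (omitw i h) k' v.
  apply/funext => j; rewrite /omitw ek; have [->|jk] := eqVneq j k'.
    by rewrite !dfwithin.
  by rewrite !dfwithout ?(inj_eq lift_inj) // eq_sym.
by rewrite !E !dfwithout 1?eq_sym // mF; ring.
Qed.

(** The restriction to injective [beta] is what [d_theta_unhat] relies on: the value of [d ln v_k]
    at one coordinate vector does not vary along a different one. *)
Lemma mlin_antisym_eq l (W W' : ('I_l -> V) -> R[i]) :
  mlin W -> mlin W' -> antisym W -> antisym W' ->
  (forall beta : 'I_l -> B, injective beta ->
    W (fun i => delta_mx (beta i).1 (beta i).2) =
    W' (fun i => delta_mx (beta i).1 (beta i).2)) ->
  forall h, W h = W' h.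
Proof.
move=> mW mW' aW aW' H h; rewrite (mlin_expand h mW) (mlin_expand h mW').
apply: eq_bigr => beta _; congr (_ * _).
pose G (U : ('I_l -> V) -> R[i]) (b : 'I_l -> B) := U (fun i => delta_mx (b i).1 (b i).2).
have [/injectiveP ib|nib] := boolP (injectiveb beta); first exact: (H beta).
have Z U : antisym U -> G U beta = 0.
  move=> aU; apply/eqP; apply: contraNT nib => nz; apply/injectiveP.
  by apply: (@antisym_inj _ _ _ (G U)) nz => a b b' ab; exact: aU.
by rewrite -/(G W beta) -/(G W' beta) !Z.
Qed.

End Multilinear.

(** * Logarithmic coordinates *)

Section ComplexExponential.
Variable R : realType.

Definition expcos (al be u : R) : R := expR (al * u) * cos (be * u).
Definition expsin (al be u : R) : R := expR (al * u) * sin (be * u).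
Definition cexp (a : R[i]) (u : R) : R[i] :=
  expcos (complex.Re a) (complex.Im a) u +i* expsin (complex.Re a) (complex.Im a) u.

Lemma is_derive_scalel (c x : R) : is_derive x 1 (fun u : R => c * u) c.
Proof.
have := @is_deriveZ R R R id c x 1 1 (is_derive_id _ _).
by rewrite -[c *: 1]/(c * 1) mulr1.
Qed.

Lemma is_derive_expcos (al be x : R) : is_derive x 1 (expcos al be)
  (al * expcos al be x + - be * expsin al be x).
Proof.
have d1 := is_derive1_comp (is_derive_expR (al * x)) (is_derive_scalel al x).
have d2 := is_derive1_comp (is_derive_cos (be * x)) (is_derive_scalel be x).
have H := is_deriveM d1 d2; apply: is_derive_eq H _.
rewrite -[X in X + _]/(_ * _) -[X in _ + X]/(_ * _) /expcos /expsin /=.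
by ring.
Qed.

Lemma is_derive_expsin (al be x : R) : is_derive x 1 (expsin al be)
  (al * expsin al be x + be * expcos al be x).
Proof.
have d1 := is_derive1_comp (is_derive_expR (al * x)) (is_derive_scalel al x).
have d2 := is_derive1_comp (is_derive_sin (be * x)) (is_derive_scalel be x).
have H := is_deriveM d1 d2; apply: is_derive_eq H _.
rewrite -[X in X + _]/(_ * _) -[X in _ + X]/(_ * _) /expcos /expsin /=.
by ring.
Qed.

Lemma Ck_expcossin k (al be : R) :
  Ck [set: R] k (expcos al be) /\ Ck [set: R] k (expsin al be).
Proof.
elim: k => [|k [IHc IHs]].
  split; first by apply: Ck_scalar0 => x _; exact: is_derive_expcos.
  by apply: Ck_scalar0 => x _; exact: is_derive_expsin.
split.
  apply: (Ck_scalarS openT (fun x _ => is_derive_expcos al be x)).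
  by apply: (CkD openT); apply: CkM => //; exact: openT.
apply: (Ck_scalarS openT (fun x _ => is_derive_expsin al be x)).
by apply: (CkD openT); apply: CkM => //; exact: openT.
Qed.

Lemma cexpE a u : cexp a u = (expR (complex.Re a * u))%:C *
  (cos (complex.Im a * u) +i* sin (complex.Im a * u)).
Proof. by apply: cplx_eq => /=; rewrite mul0r ?subr0 ?addr0. Qed.

Lemma cpowE (x : R) a : cpow x a = cexp a (ln x).
Proof. by rewrite cexpE. Qed.

Lemma cexpD a u v : cexp a (u + v) = cexp a u * cexp a v.
Proof.
by apply: cplx_eq; rewrite ?cReM ?cImM /= /expcos /expsin !mulrDr expRD ?cosD ?sinD; ring.
Qed.

Lemma cexpNK a u : cexp (- a) u * cexp a u = 1.
Proof.
apply: cplx_eq; rewrite ?cReM ?cImM /= /expcos /expsin cReN cImN !mulNr expRN cosN sinN.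
  rewrite mulrN mulNr opprK.
  transitivity ((expR (complex.Re a * u))^-1 * expR (complex.Re a * u) *
    (cos (complex.Im a * u) ^+ 2 + sin (complex.Im a * u) ^+ 2)); first by ring.
  by rewrite cos2Dsin2 mulr1 mulVf // gt_eqF // expR_gt0.
by ring.
Qed.

Lemma cexp_neq0 a u : cexp a u != 0.
Proof.
by apply: contraNneq (oner_neq0 R[i]) => e; rewrite -(cexpNK a u) e mulr0.
Qed.

Section Along.
Variables (m n : nat) (D : set 'M[R]_(m, n)).
Hypothesis oD : open D.

Lemma smooth_cexp a (u : 'M[R]_(m, n) -> R) : (forall k, Ck D k u) ->
  smooth D (fun x => cexp a (u x)).
Proof.
move=> Cu k; have [c s] := Ck_expcossin k (complex.Re a) (complex.Im a).
by split; [exact: (Ck_comp_scalar oD (fun _ _ => I) (Cu k) c) |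
           exact: (Ck_comp_scalar oD (fun _ _ => I) (Cu k) s)].
Qed.

Lemma cderive_cexp a (u : 'M[R]_(m, n) -> R) x h du : is_derive x h u du ->
  cderive (fun x => cexp a (u x)) x h = a * du%:C * cexp a (u x).
Proof.
move=> Hu; have [_ Ec] := derive_comp_scalar (is_derive_expcos (complex.Re a) (complex.Im a) (u x)) Hu.
have [_ Es] := derive_comp_scalar (is_derive_expsin (complex.Re a) (complex.Im a) (u x)) Hu.
rewrite /cderive; apply: cplx_eq => /=; rewrite ?cReM ?cImM ?Ec ?Es /= ?cReM ?cImM /=; ring.
Qed.

Lemma cderive_prod_log (I : Type) (r : seq I) (F : I -> 'M[R]_(m, n) -> R[i]) g x h :
  D x -> (forall i, smooth D (F i)) -> (forall i, cderive (F i) x h = g i * F i x) ->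
  cderive (fun y => \prod_(i <- r) F i y) x h = (\sum_(i <- r) g i) * \prod_(i <- r) F i x.
Proof.
move=> Dx sF H; elim: r => [|i r IH].
  have -> : (fun y => \prod_(i <- [::]) F i y) = (fun=> 1).
    by apply/funext => y; rewrite big_nil.
  by rewrite cderive_cst !big_nil mul0r.
have -> : (fun y => \prod_(j <- i :: r) F j y) = (fun y => F i y * \prod_(j <- r) F j y).
  by apply/funext => y; rewrite big_cons.
rewrite (@cderiveM _ _ _ D) //; last by apply: smooth_prod.
by rewrite IH H !big_cons; ring.
Qed.

Lemma cderive_near (f g : 'M[R]_(m, n) -> R[i]) x h : (forall y, D y -> f y = g y) ->
  D x -> cderive f x h = cderive g x h.
Proof.
move=> fg Dx; apply: cplx_eq => /=; apply: near_eq_derive;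
apply: (@near_eq_D _ _ D oD (fun y => _) (fun y => _)) => // y Dy; by rewrite fg.
Qed.

End Along.

End ComplexExponential.

Section LogCoordinates.
Variables (R : realType) (s t : nat).
Notation V := (pt R s t).
Notation sm := (@smooth R V setT).
Notation B := ('I_(s + t) * 'I_2)%type.
Notation HC := (@HC R s t).
Notation T := ('I_s + 'I_(s + t + t))%type.
Let oT : open [set: V]. Proof. exact: openT. Qed.
Let oHC : open HC := @HC_open R s t.

(** The entries that hold [v_k], the imaginary part of [w_k]; only these are replaced by their
    logarithms. *)
Definition vslot (i : 'I_(s + t)) (c : 'I_2) : bool :=
  (if fintype.split i is inl _ then true else false) && (c == 1).

Definition expmap (p : V) : V :=
  \matrix_(i, c) if vslot i c then expR (p i c) else p i c.
Definition logmap (x : V) : V :=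
  \matrix_(i, c) if vslot i c then ln (x i c) else x i c.
(** The diagonal of the Jacobian of [expmap]. *)
Definition escale (p : V) (b : B) : R := if vslot b.1 b.2 then expR (p b.1 b.2) else 1.
(** The differential of [logmap] at [x]. *)
Definition dlog (x h : V) : V :=
  \matrix_(i, c) if vslot i c then h i c / x i c else h i c.

Lemma vslotP i c : vslot i c -> exists2 k, i = lshift t k & c = 1.
Proof.
rewrite /vslot; case: splitP => // k ek /andP[_ /eqP ->]; exists k => //.
exact: ord_inj.
Qed.

Lemma vslot_l k : vslot (lshift t k) 1.
Proof. by rewrite /vslot (unsplitK (inl k)). Qed.

Lemma HC_vslot x i c : HC x -> vslot i c -> 0 < x i c.
Proof. by move=> Hx /vslotP[k -> ->]; exact: Hx. Qed.

Lemma expmap_HC p : HC (expmap p).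
Proof. by move=> k; rewrite /wcoord /coord /= mxE vslot_l expR_gt0. Qed.

Lemma expmapK : cancel expmap logmap.
Proof. by move=> p; apply/matrixP => i c; rewrite !mxE; case v: (vslot i c); rewrite ?expRK. Qed.

Lemma logmapK x : HC x -> expmap (logmap x) = x.
Proof.
move=> Hx; apply/matrixP => i c; rewrite !mxE; case v: (vslot i c) => //.
by rewrite lnK // posrE; exact: HC_vslot.
Qed.

Lemma Ck_expmap k i c : Ck [set: V] k (fun p => expmap p i c).
Proof.
apply: (@Ck_eq _ _ _ oT k (fun p => if vslot i c then expR (p i c) else p i c)).
  by move=> p _; rewrite mxE.
case: (vslot i c); last exact: Ck_entry.
by apply: (@Ck_comp_scalar _ _ _ setT setT oT k expR (fun p => p i c)) => //;
  [exact: Ck_entry | exact: Ck_expR].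
Qed.

Lemma Ck_escale k b : Ck [set: V] k (fun p => escale p b).
Proof.
rewrite /escale; case: (vslot b.1 b.2); last exact: Ck_cst.
by apply: (@Ck_comp_scalar _ _ _ setT setT oT k expR (fun p => p b.1 b.2)) => //;
  [exact: Ck_entry | exact: Ck_expR].
Qed.

Lemma is_derive_entry (x h : V) i c : is_derive x h (fun y : V => y i c) (h i c).
Proof.
have := @derivable_id R V x h; move=> /derivable_mxP /(_ i c) d.
split => //; have := @derive_id R V x h => /matrixP /(_ i c).
by rewrite derive_mx ?mxE.
Qed.

Lemma is_derive_logmap (x h : V) i c : HC x ->
  is_derive x h (fun y : V => logmap y i c) (dlog x h i c).
Proof.
move=> Hx; rewrite mxE.
have -> : (fun y : V => logmap y i c) = (fun y => if vslot i c then ln (y i c) else y i c).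
  by apply/funext => y; rewrite mxE.
case: ifPn => v; last exact: is_derive_entry.
rewrite mulrC; apply: (@derive_comp_scalar _ _ _ (@ln R) (fun y : V => y i c)).
  by apply: is_derive1_ln; exact: HC_vslot.
exact: is_derive_entry.
Qed.

Lemma Ck_lninv k : Ck [set y : R | 0 < y] k (@ln R).
Proof.
have oP : open [set y : R | 0 < y] by exact: open_gt.
(* Multiples of negative powers are stable under differentiation, so the induction runs on them;
   [ln] lies one derivative above. *)
suff H j (c : R) e : Ck [set y : R | 0 < y] j (fun y => c * y ^- e.+1).
  case: k => [|k].
    exact: (Ck_scalar0 (fun y (y0 : [set y : R | 0 < y] y) => is_derive1_ln y0)).
  apply: (Ck_scalarS oP (fun y (y0 : [set y : R | 0 < y] y) => is_derive1_ln y0)).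
  by apply: (Ck_eq oP _ (H k 1 0%N)) => y _; rewrite mul1r expr1.
have dv (d : R) (e' : nat) (y : R) : 0 < y ->
    is_derive y 1 (fun y : R => d * y ^- e'.+1) ((- d * e'.+1%:R) * y ^- e'.+2).
  move=> y0; have yn0 : y != 0 by rewrite gt_eqF.
  have Hi : is_derive y 1 (fun y : R => y^-1) (- y ^- 2).
    have := @is_deriveV R id y 1 1 yn0 (is_derive_id y 1).
    by rewrite -[_ *: _]/(_ * _) mulr1.
  have -> : (fun y : R => d * y ^- e'.+1) = d *: (fun y : R => y^-1) ^+ e'.+1.
    by apply/funext => z; rewrite -[RHS]/(d * _) exprfctE exprVn.
  have H := is_deriveZ d (is_deriveX e'.+1 Hi); apply: is_derive_eq H _.
  rewrite -[_ *: _]/(_ * _) -[X in _ * X]/(_ * _) /= exprVn.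
  have -> : y ^- e'.+2 = y ^- e' * y ^- 2 by rewrite -addn2 exprD invfM.
  by move: (y ^- e') (y ^- 2) (e'.+1%:R : R) => p q r; ring.
elim: j c e => [|j IH] c e.
  by apply: Ck_scalar0 => y y0; exact: dv.
apply: (Ck_scalarS oP (fun y y0 => dv c e y y0)); exact: IH.
Qed.

Lemma Ck_logmap k i c : Ck HC k (fun x => logmap x i c).
Proof.
apply: (@Ck_eq _ _ _ oHC k (fun p => if vslot i c then ln (p i c) else p i c)).
  by move=> p _; rewrite mxE.
case v: (vslot i c); last exact: Ck_entry.
apply: (@Ck_comp_scalar _ _ _ HC [set y | 0 < y] oHC k (@ln R) (fun p => p i c)).
- by move=> x Hx; exact: HC_vslot.
- exact: Ck_entry.
- exact: Ck_lninv.
Qed.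

Lemma smooth_logmap (f : V -> R[i]) : sm f -> smooth HC (f \o logmap).
Proof.
apply: (@smooth_comp _ _ _ _ _ HC setT) => //.
by move=> k i j; exact: Ck_logmap.
Qed.

Lemma smooth_expmap (f : V -> R[i]) : smooth HC f -> sm (f \o expmap).
Proof.
apply: (@smooth_comp _ _ _ _ _ setT HC) => //.
  by move=> x _; exact: expmap_HC.
by move=> k i j; exact: Ck_expmap.
Qed.

Lemma cderive_logmap (f : V -> R[i]) x h : HC x -> sm f ->
  cderive (f \o logmap) x h = cderive f (logmap x) (dlog x h).
Proof.
move=> Hx sf; rewrite (@cderive_comp _ _ _ _ _ setT) //; last first.
  by move=> i c; have [] := is_derive_logmap h i c Hx.
rewrite (@cderive_partial _ _ _ setT) //; apply: eq_bigr => p _.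
by have [_ ->] := is_derive_logmap h p.1 p.2 Hx.
Qed.

(* The letter [inl k] stands for [d ln v_k] and [inr i] for [e_i]; in the
   coordinates [ln v_k, r_k, z_k] the field [fre j + 'i * fim j] is dual to [j]. *)
Definition fre (j : T) : V :=
  match j with
  | inl k => delta_mx (lshift t k) 1
  | inr i => match fintype.split i with
    | inl j => match fintype.split j with
               | inl k => delta_mx (lshift t k) 0
               | inr k => 2^-1 *: delta_mx (rshift s k) 0
               end
    | inr k => 2^-1 *: delta_mx (rshift s k) 0
    end
  end.

Definition fim (j : T) : V :=
  match j with
  | inl k => 0
  | inr i => match fintype.split i with
    | inl j => match fintype.split j with
               | inl k => 0
               | inr k => - 2^-1 *: delta_mx (rshift s k) 1
               end
    | inr k => 2^-1 *: delta_mx (rshift s k) 1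
    end
  end.

Definition co (j : T) (h : V) : R[i] :=
  match j with inl k => (h (lshift t k) 1)%:C | inr i => e_form i h end.

Definition cof (j : T) (x h : V) : R[i] :=
  match j with inl k => dlnv k x h | inr i => e_form i h end.

Definition yl (k : 'I_s) : T := inl k.
Definition rl (k : 'I_s) : T := inr (lshift t (lshift t k)).
Definition zl (k : 'I_t) : T := inr (lshift t (rshift s k)).
Definition zbl (k : 'I_t) : T := inr (rshift (s + t) k).

Lemma letterP (P : T -> Prop) : (forall k, P (yl k)) -> (forall k, P (rl k)) ->
  (forall k, P (zl k)) -> (forall k, P (zbl k)) -> forall j, P j.
Proof.
move=> Hy Hr Hz Hzb [k|i]; first exact: Hy.
rewrite -(splitK i); case: (fintype.split i) => [j|k] /=; last exact: Hzb.
by rewrite -(splitK j); case: (fintype.split j) => [k|k] /=; [exact: Hr | exact: Hz].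
Qed.

Lemma sum_letters (F : T -> R[i]) : \sum_j F j =
  \sum_k F (yl k) + (\sum_k F (rl k) + \sum_k F (zl k) + \sum_k F (zbl k)).
Proof. by rewrite big_sumType /= big_split_ord /= big_split_ord. Qed.

Lemma split_l m n (k : 'I_m) : fintype.split (lshift n k) = inl k.
Proof. exact: (unsplitK (inl k)). Qed.

Lemma split_r m n (k : 'I_n) : fintype.split (rshift m k) = inr k.
Proof. exact: (unsplitK (inr k)). Qed.

Lemma frameE : ((forall k, fre (yl k) = delta_mx (lshift t k) 1) *
  (forall k, fim (yl k) = 0) *
  (forall k, fre (rl k) = delta_mx (lshift t k) 0) *
  (forall k, fim (rl k) = 0) *
  (forall k, fre (zl k) = 2^-1 *: delta_mx (rshift s k) 0) *
  (forall k, fim (zl k) = - 2^-1 *: delta_mx (rshift s k) 1) *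
  (forall k, fre (zbl k) = 2^-1 *: delta_mx (rshift s k) 0) *
  (forall k, fim (zbl k) = 2^-1 *: delta_mx (rshift s k) 1))%type.
Proof. by (do !split) => k; rewrite /fre /fim /= ?split_l ?split_r ?split_l ?split_r. Qed.

Lemma coE : ((forall k h, co (yl k) h = (h (lshift t k) 1)%:C) *
  (forall k h, co (rl k) h = (h (lshift t k) 0)%:C) *
  (forall k h, co (zl k) h = h (rshift s k) 0 +i* h (rshift s k) 1) *
  (forall k h, co (zbl k) h = h (rshift s k) 0 +i* - h (rshift s k) 1))%type.
Proof. by (do !split) => k h; rewrite /co /e_form /= ?split_l ?split_r ?split_l ?split_r. Qed.

Lemma co_lin j (c : R) h h' : co j (c *: h + h') = c%:C * co j h + co j h'.
Proof.
move: j; apply: letterP => k; rewrite !coE !mxE; apply: cplx_eq;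
  rewrite ?cReD ?cImD ?cReM ?cImM /=; ring.
Qed.

(** In logarithmic coordinates all these one-forms are constant: the dependence of [dlnv] on the
    point comes from the differential of [logmap] alone. *)
Lemma cof_co j x h : cof j x h = co j (dlog x h).
Proof.
move: j; apply: letterP => k; rewrite ?coE; last 3 first.
- by rewrite -[LHS]/(co (rl k) h) coE !mxE /vslot andbF.
- by rewrite -[LHS]/(co (zl k) h) coE !mxE /vslot split_r.
- by rewrite -[LHS]/(co (zbl k) h) coE !mxE /vslot split_r.
by rewrite /= /dlnv !mxE vslot_l.
Qed.

Lemma dlog_lin x (c : R) h h' : dlog x (c *: h + h') = c *: dlog x h + dlog x h'.
Proof.
by apply/matrixP => i k; rewrite !mxE; case: ifP => // _; rewrite mulrDl mulrA.
Qed.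

Lemma cof_lin j x (c : R) h h' : cof j x (c *: h + h') = c%:C * cof j x h + cof j x h'.
Proof. by rewrite !cof_co dlog_lin co_lin. Qed.

Definition shiftE := (eq_lshift, eq_rshift, eq_lrshift, eq_rlshift).

Lemma half2 : 2^-1 + 2^-1 = 1 :> R.
Proof. by field. Qed.

Lemma letter_eqE : ((forall j k, (yl j == yl k) = (j == k)) *
  (forall j k, (rl j == rl k) = (j == k)) * (forall j k, (zl j == zl k) = (j == k)) *
  (forall j k, (zbl j == zbl k) = (j == k)))%type.
Proof.
(do !split) => j k; apply/eqP/eqP => [|-> //].
- by rewrite /zl => -[] /addnI /ord_inj.
- by rewrite /zbl => -[] /addnI /ord_inj.
Qed.

Lemma letter_neqE : ((forall j k, (rl j == zl k) = false) *
  (forall j k, (zl k == rl j) = false) * (forall j k, (rl j == zbl k) = false) *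
  (forall j k, (zbl k == rl j) = false) * (forall j k, (zl j == zbl k) = false) *
  (forall j k, (zbl j == zl k) = false))%type.
Proof.
by (do !split) => j k; apply/negbTE/eqP => -[]; have := ltn_ord j; have := ltn_ord k;
  rewrite /=; lia.
Qed.

Lemma co_frame j k : co j (fre k) + 'i * co j (fim k) = (j == k)%:R.
Proof.
have h2 := half2.
have bC (b : bool) : b%:R = (b%:R)%:C :> R[i] by case: b.
rewrite bC.
move: j; apply: letterP => j; move: k; apply: letterP => k;
rewrite !frameE !coE !mxE ?letter_eqE ?letter_neqE ?shiftE /=; apply: cplx_eq;
rewrite ?cReD ?cImD ?cReM ?cImM /=.
all: try case: (j == k) => /=.
all: rewrite ?mulr0n ?mulr1n ?mulr0 ?mul0r ?mulr1 ?mul1r ?subr0 ?sub0r ?oppr0 ?addr0 ?add0r ?opprK //.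
all: try by rewrite addrN.
all: try by rewrite addNr.
Qed.

(** Completeness of the coframe, the counterpart of the duality in [co_frame]. *)
Lemma co_expand (h : V) b : \sum_j co j h *
  ((fre j b.1 b.2)%:C + 'i * (fim j b.1 b.2)%:C) = (h b.1 b.2)%:C.
Proof.
have h2 := half2.
rewrite sum_letters.
under eq_bigr do rewrite coE !frameE !mxE.
under [X in _ + (X + _ + _)]eq_bigr do rewrite coE !frameE !mxE.
under [X in _ + (_ + X + _)]eq_bigr do rewrite coE !frameE !mxE.
under [X in _ + (_ + _ + X)]eq_bigr do rewrite coE !frameE !mxE.
case: b => i c /=; rewrite -(splitK i); case: (fintype.split i) => [k|k] /=.
  rewrite [X in _ + (_ + X + _)]big1 => [|k' _]; last first.
    by rewrite !shiftE /= !mulr0 addr0 mulr0.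
  rewrite [X in _ + (_ + _ + X)]big1 => [|k' _]; last first.
    by rewrite !shiftE /= !mulr0 addr0 mulr0.
  rewrite !addr0 (bigD1 k) //= big1 ?addr0 => [|k' ne]; last first.
    by rewrite !shiftE eq_sym (negbTE ne) /= mulr0 addr0 mulr0.
  rewrite (bigD1 k) //= big1 ?addr0 => [|k' ne]; last first.
    by rewrite !shiftE eq_sym (negbTE ne) /= mulr0 addr0 mulr0.
  rewrite !eqxx /= !mulr0 !addr0.
  case: c => -[|[|//]] c2 /=; rewrite ?mulr0 ?mulr1 ?addr0 ?add0r.
    by congr ((h _ _)%:C); exact: ord_inj.
  by congr ((h _ _)%:C); exact: ord_inj.
rewrite big1 => [|k' _]; last by rewrite !shiftE /= !(mulr0, addr0).
rewrite [X in _ + (X + _ + _)]big1 => [|k' _]; last first.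
  by rewrite !shiftE /= !(mulr0, addr0).
rewrite !add0r (bigD1 k) //= big1 ?addr0 => [|k' ne]; last first.
  by rewrite !shiftE eq_sym (negbTE ne) /= !(mulr0, addr0).
rewrite (bigD1 k) //= big1 ?addr0 => [|k' ne]; last first.
  by rewrite !shiftE eq_sym (negbTE ne) /= !(mulr0, addr0).
rewrite !eqxx /=; have [->|->] : c = 0 \/ c = 1.
- by case: c => -[|[|//]] c2; [left | right]; exact: ord_inj.
- by apply: cplx_eq; rewrite ?cReD ?cImD ?cReM ?cImM /=; field.
- by apply: cplx_eq; rewrite ?cReD ?cImD ?cReM ?cImM /=; field.
Qed.

Lemma coP (f : V -> R[i]) x lam : sm f ->
  cderive f x lam = \sum_j co j lam * frame_d fre fim j f x.
Proof.
move=> sf; rewrite (@cderive_partial _ _ _ setT) //.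
under eq_bigr do rewrite -co_expand mulr_suml.
rewrite exchange_big /=; apply: eq_bigr => j _.
rewrite /frame_d !(@cderive_partial _ _ _ setT oT f x) // mulr_sumr -big_split /= mulr_sumr.
by apply: eq_bigr => b _; move: (cderive _ _ _) => d; ring.
Qed.

Lemma co0 j : co j 0 = 0.
Proof.
have := co_lin j 1 0 0; rewrite scale1r addr0 mul1r => /eqP.
by rewrite -subr_eq addrN eq_sym => /eqP.
Qed.

Lemma co_delta j (h : V) :
  co j h = \sum_(b : B) (h b.1 b.2)%:C * co j (delta_mx b.1 b.2).
Proof.
have key (r : seq B) : co j (\sum_(b <- r) h b.1 b.2 *: delta_mx b.1 b.2) =
    \sum_(b <- r) (h b.1 b.2)%:C * co j (delta_mx b.1 b.2).
  elim: r => [|b r IH]; first by rewrite !big_nil co0.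
  by rewrite !big_cons co_lin IH.
by rewrite -key; congr (co j _); rewrite [LHS]matrix_sum_delta pair_bigA.
Qed.

Definition fcoef (j : T) (b : B) : R[i] := (fre j b.1 b.2)%:C + 'i * (fim j b.1 b.2)%:C.

Lemma fcoef_dual j k : \sum_b fcoef k b * co j (delta_mx b.1 b.2) = (j == k)%:R.
Proof.
rewrite -co_frame (co_delta j (fre k)) (co_delta j (fim k)) mulr_sumr -big_split /=.
by apply: eq_bigr => b _; rewrite /fcoef mulrDl mulrA.
Qed.

Lemma sm_cof j h : smooth HC (fun x => cof j x h).
Proof.
case: j => [k|i]; last exact: (smooth_cst oHC).
apply: (smooth_real oHC) => e.
have C1 : Ck HC e (fun y => (y (lshift t k) 1)^-1).
  apply: (Ck_inv oHC); last exact: (Ck_entry oHC).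
  by move=> x Hx; rewrite gt_eqF //; exact: (Hx k).
exact: (CkM oHC _ C1).
Qed.

(** [d ln v_k] sees a single entry of the vector and varies only with the same entry of the point,
    so two different coordinate vectors cannot both matter. This takes the place of closedness of
    the coframe. *)
Lemma cof_delta_derive j x (b b' : B) : HC x -> b != b' ->
  cderive (fun y => cof j y (delta_mx b.1 b.2)) x (delta_mx b'.1 b'.2) = 0.
Proof.
move=> Hx bb'; case: j => [k|i]; last by rewrite cderive_cst.
pose d : R := (delta_mx b.1 b.2 : V) (lshift t k) 1.
have xk0 : x (lshift t k) 1 != 0 by rewrite gt_eqF //; exact: (Hx k).
have H := is_derive_entry x (delta_mx b'.1 b'.2) (lshift t k) 1.
have Hd : derivable (fun y : V => y (lshift t k) 1) x (delta_mx b'.1 b'.2) by case: H.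
have E : 'D_(delta_mx b'.1 b'.2) (fun y : V => d / y (lshift t k) 1) x = 0.
  have -> : (fun y : V => d / y (lshift t k) 1) =
      d *: (fun y => (y (lshift t k) 1)^-1) by [].
  rewrite deriveZ ?deriveV //; last exact: derivableV.
  have [_ ->] := H; rewrite /d !mxE.
  rewrite -[_ *: _]/(_ * _) -[X in _ * X]/(_ * _).
  case: (lshift t k =P b.1) => [e1|_] /=; last by rewrite mul0r.
  case: (1 =P b.2) => [e2|_] /=; last by rewrite mul0r.
  case: (lshift t k =P b'.1) => [e3|_] /=; last by rewrite !mulr0.
  case: (1 =P b'.2) => [e4|_] /=; last by rewrite !mulr0.
  move: bb'; rewrite [b]surjective_pairing [b']surjective_pairing.
  by rewrite -e1 -e2 -e3 -e4 eqxx.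
apply: cplx_eq => /=; first exact: E.
by rewrite derive_cst.
Qed.

(** * Passage between forms and coefficient arrays *)

Section Twist.
Variable a : 'I_s -> R[i].

(** The function [v^c] in logarithmic coordinates. *)
Definition vlog (c : 'I_s -> R[i]) (p : V) : R[i] := \prod_k cexp (c k) (p (lshift t k) 1).

Lemma vpowE x : vpow a x = vlog a (logmap x).
Proof.
apply: eq_bigr => k _; rewrite cpowE mxE vslot_l.
by [].
Qed.

Lemma sm_vlog c : sm (vlog c).
Proof.
apply: (smooth_prod oT) => k _; apply: (smooth_cexp oT) => e.
exact: (Ck_entry oT).
Qed.

Lemma vlogNK p : vlog (fun k => - a k) p * vlog a p = 1.
Proof. by rewrite /vlog -big_split /= big1 // => k _; rewrite cexpNK. Qed.

Lemma cderive_vlog p h : cderive (vlog a) p h =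
  (\sum_k a k * (h (lshift t k) 1)%:C) * vlog a p.
Proof.
apply: (@cderive_prod_log _ _ _ setT oT) => // k.
  by apply: (smooth_cexp oT) => e; exact: (Ck_entry oT).
by apply: cderive_cexp; exact: is_derive_entry.
Qed.

Notation karr := (karr R (s + t) 2 T).

Definition words_form l (f : karr l) (x : V) (h : 'I_l -> V) : R[i] :=
  vpow a x * \sum_(phi : {ffun 'I_l -> T})
     (\prod_i cof (phi i) x (h i)) * f phi (logmap x).

(* The factor [v^a] in [words_form] turns [d_theta] into the untwisted [kd]. *)
Definition unhat l (f : karr l) : Defs.form R s t l := fun x h =>
  if x \in HC then words_form f x h else 0.

(** Evaluation of [w] on the complex frame, extended multilinearly: [fcoef] expands a frame field in
    coordinate vectors, [escale] transports these by the differential of [expmap], and the first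
    factor removes [v^a]. *)
Definition hat l (w : Defs.form R s t l) : karr l := fun phi p =>
  vlog (fun k => - a k) p * \sum_(beta : {ffun 'I_l -> B})
    (\prod_i (fcoef (phi i) (beta i) * (escale p (beta i))%:C)) *
      (w (expmap p) (fun i => delta_mx (beta i).1 (beta i).2) : R[i]).

Lemma unhatE l (f : karr l) x h : HC x -> unhat f x h = words_form f x h.
Proof. by move=> Hx; rewrite /unhat mem_set. Qed.

Lemma cof_escale j p (b : B) :
  (escale p b)%:C * cof j (expmap p) (delta_mx b.1 b.2) = co j (delta_mx b.1 b.2).
Proof.
rewrite cof_co -[LHS]addr0 -[X in _ + X](co0 j) -co_lin addr0; congr (co j _).
apply/matrixP => i c; rewrite !mxE /escale.
case: (i =P b.1) => [->|_] /=; last by rewrite mul0r if_same mulr0.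
case: (c =P b.2) => [->|_] /=; last by rewrite mul0r if_same mulr0.
by case: ifP => _; rewrite ?mul1r // mulfV // gt_eqF // expR_gt0.
Qed.

Lemma hat_unhat l (f : karr l) : hat (unhat f) = f.
Proof.
apply/funext => phi; apply/funext => p; rewrite /hat.
under eq_bigr do rewrite (unhatE _ _ (expmap_HC p)).
rewrite /words_form vpowE expmapK.
under eq_bigr do rewrite mulrCA.
rewrite -mulr_sumr mulrA vlogNK mul1r.
under eq_bigr do rewrite mulr_sumr.
rewrite exchange_big /= (bigD1 (finfun phi)) //= [X in _ + X]big1 ?addr0; last first.
  move=> psi ne.
  transitivity ((\prod_i \sum_b fcoef (phi i) b * co (psi i) (delta_mx b.1 b.2)) * f psi p).
    rewrite bigA_distr_bigA /= mulr_suml; apply: eq_bigr => beta _.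
    rewrite mulrA -big_split /=; congr (_ * _); apply: eq_bigr => i _.
    by rewrite -mulrA cof_escale.
  have [i /eqP ni] : exists i, psi i != phi i.
    apply/existsP; apply: contraNT ne; rewrite negb_exists => /forallP H.
    by apply/eqP/ffunP => i; rewrite ffunE; have /negbNE/eqP := H i.
  rewrite (bigD1 i) //= fcoef_dual.
  by rewrite (introF eqP ni) !mul0r.
transitivity ((\prod_i \sum_b fcoef (phi i) b * co (phi i) (delta_mx b.1 b.2)) * f phi p).
  rewrite bigA_distr_bigA /= mulr_suml; apply: eq_bigr => beta _.
  rewrite mulrA -big_split /=; congr (_ * f _ p).
    by apply: eq_bigr => i _; rewrite -mulrA ffunE cof_escale.
  by apply/funext => i; rewrite ffunE.
rewrite big1 ?mul1r // => i _; by rewrite fcoef_dual eqxx.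
Qed.

(** The sum over words factors into one sum over letters per slot, which completeness of the coframe
    evaluates to a coordinate of [h i]. In [hat_unhat] the sum is over coordinates, and duality is
    used instead. *)
Lemma unhat_hat l (w : Defs.form R s t l) : (forall x, ~ HC x -> w x = 0) ->
  (forall x, HC x -> mlin (w x)) -> unhat (hat w) = w.
Proof.
move=> w0 mw; apply/funext => x; apply/funext => h.
have [Hx|nHx] := pselect (HC x); last by rewrite /unhat memNset // w0.
rewrite unhatE // /words_form vpowE /hat logmapK //.
under eq_bigr do rewrite mulrCA.
rewrite -mulr_sumr mulrA [vlog a _ * _]mulrC vlogNK mul1r.
under eq_bigr do rewrite mulr_sumr.
rewrite exchange_big /= (mlin_expand h (mw x Hx)); apply: eq_bigr => beta _.
transitivity ((\prod_i \sum_j cof j x (h i) *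
    (fcoef j (beta i) * (escale (logmap x) (beta i))%:C)) *
    (w x (fun i => delta_mx (beta i).1 (beta i).2) : R[i])).
  rewrite bigA_distr_bigA /= mulr_suml; apply: eq_bigr => phi _.
  by rewrite mulrA -big_split.
congr (_ * _); apply: eq_bigr => i _.
under eq_bigr do rewrite mulrA cof_co.
rewrite -mulr_suml co_expand !mxE /escale !mxE -realCM.
case v: (vslot _ _); last by rewrite mulr1.
have Hv := HC_vslot Hx v.
by rewrite lnK ?posrE // divfK // gt_eqF.
Qed.

End Twist.

End LogCoordinates.

(** * Forms and coefficient arrays *)

Section WordSums.
Variables (R : realType) (A : Type) (B : finType) (c : A -> B -> R[i]).

Definition word_sum l (G : ('I_l -> B) -> R[i]) (h : 'I_l -> A) : R[i] :=
  \sum_(beta : {ffun 'I_l -> B}) (\prod_i c (h i) (beta i)) * G beta.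

Lemma word_sum_antisym l (G : ('I_l -> B) -> R[i]) : antisym G -> antisym (word_sum G).
Proof.
move=> aG a b h ab; rewrite /word_sum -sumrN.
pose sw (beta : {ffun 'I_l -> B}) : {ffun 'I_l -> B} := [ffun i => beta (tperm a b i)].
have swK : involutive sw by move=> beta; apply/ffunP => i; rewrite !ffunE tpermK.
rewrite (reindex_inj (can_inj swK)); apply: eq_bigr => beta _.
rewrite -mulrN -(aG _ _ _ ab); congr (_ * G _); last first.
  by apply/funext => i; rewrite /sw ffunE.
rewrite [RHS](reindex_inj (@perm_inj _ (tperm a b))) /=.
by apply: eq_bigr => i _; rewrite /sw ffunE.
Qed.

End WordSums.

Section WordSumLinear.
Variables (R : realType) (m n : nat) (B : finType) (c : 'M[R]_(m, n) -> B -> R[i]).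
Hypothesis c_lin : forall b (k : R) y z, c (k *: y + z) b = k%:C * c y b + c z b.

Lemma word_sum_mlin l (G : ('I_l -> B) -> R[i]) : mlin (word_sum c G).
Proof.
move=> h i k y z; rewrite /word_sum mulr_sumr -big_split; apply: eq_bigr => beta _.
have E v : \prod_j c (dfwith h i v j) (beta j) =
    c v (beta i) * \prod_(j | j != i) c (h j) (beta j).
  rewrite (bigD1 i) //= dfwithin; congr (_ * _); apply: eq_bigr => j ji.
  by rewrite dfwithout // eq_sym.
by rewrite !E c_lin !mulrDl !mulrA.
Qed.

End WordSumLinear.

Section Correspondence.
Variables (R : realType) (s t : nat) (a : 'I_s -> R[i]).
Notation V := (pt R s t).
Notation sm := (@smooth R V setT).
Notation B := ('I_(s + t) * 'I_2)%type.
Notation HC := (@HC R s t).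
Notation T := ('I_s + 'I_(s + t + t))%type.
Notation karr := (karr R (s + t) 2 T).
Notation fre := (@fre R s t).
Notation fim := (@fim R s t).
Notation logmap := (@logmap R s t).
Notation form := (Defs.form R s t).
Let oT : open [set: V]. Proof. exact: openT. Qed.
Let oHC : open HC := @HC_open R s t.

Lemma form_mlin l (w : form l) x : is_form w -> mlin (w x : ('I_l -> V) -> R[i]).
Proof. by case=> _ _ lw _ h i c y z; rewrite lw. Qed.

Lemma form_antisym l (w : form l) x : is_form w -> antisym (w x : ('I_l -> V) -> R[i]).
Proof.
move=> fw; apply: alternating_antisym; first exact: form_mlin.
by case: fw => _ _ _ aw h i j; exact: aw.
Qed.

Lemma hatE l (w : form l) phi p : hat a w phi p =
  vlog (fun k => - a k) p * word_sum (fun j b => fcoef R j b * (escale p b)%:C)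
    (fun beta => w (expmap p) (fun i => delta_mx (beta i).1 (beta i).2)) phi.
Proof. by []. Qed.

Lemma hat_ksm l (w : form l) : is_form w -> ksm (hat a w).
Proof.
move=> [_ sw _ _] phi; apply: (smooth_mul oT); first exact: sm_vlog.
apply: (smooth_sum oT) => beta _; apply: (smooth_mul oT); last first.
  exact: (smooth_expmap (sw (fun i => delta_mx (beta i).1 (beta i).2))).
apply: (smooth_prod oT) => i _; apply: (smooth_scale oT); apply: (smooth_real oT) => e.
exact: Ck_escale.
Qed.

Lemma hat_kalt l (w : form l) : is_form w -> kalt (hat a w).
Proof.
move=> fw i j phi p ij; rewrite !hatE -mulrN; congr (_ * _).
apply: word_sum_antisym => // i' j' beta ij'.
exact: (form_antisym _ fw (fun k => delta_mx (beta k).1 (beta k).2) ij').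
Qed.

Lemma words_formE l (f : karr l) x h : words_form a f x h =
  vpow a x * word_sum (fun h j => cof j x h) (fun phi => f phi (logmap x)) h.
Proof. by []. Qed.

Lemma words_form_mlin l (f : karr l) x : mlin (words_form a f x).
Proof.
move=> h i c y z; rewrite !words_formE word_sum_mlin; first by ring.
by move=> b k y' z'; exact: cof_lin.
Qed.

Lemma words_form_antisym l (f : karr l) x : kalt f -> antisym (words_form a f x).
Proof.
move=> af i j h ij; rewrite !words_formE -mulrN; congr (_ * _).
by apply: word_sum_antisym => // i' j' phi ij'; exact: af.
Qed.

Lemma words_formP l (f : karr l) h y : words_form a f y h =
  \sum_(phi : {ffun 'I_l -> T}) (\prod_i cof (phi i) y (h i)) *
    ((fun p => vlog a p * f phi p) \o logmap) y.
Proof.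
by rewrite /words_form mulr_sumr; apply: eq_bigr => phi _; rewrite vpowE /=; ring.
Qed.

Lemma sm_words_form l (f : karr l) h : ksm f -> smooth HC (fun x => words_form a f x h).
Proof.
move=> sf; have -> : (fun x => words_form a f x h) = fun y =>
   \sum_(phi : {ffun 'I_l -> T}) (\prod_i cof (phi i) y (h i)) *
    ((fun p => vlog a p * f phi p) \o logmap) y.
  by apply/funext => y; exact: words_formP.
apply: (smooth_sum oHC) => phi _; apply: (smooth_mul oHC).
  by apply: (smooth_prod oHC) => i _; exact: sm_cof.
by apply: smooth_logmap; apply: (smooth_mul oT); [exact: sm_vlog | exact: sf].
Qed.

Lemma is_form_unhat l (f : karr l) : ksm f -> kalt f -> is_form (unhat a f).
Proof.
move=> sf af; split.
- by move=> x nHx; apply/funext => h; rewrite /unhat memNset.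
- move=> h; apply: (smooth_eq oHC) (sm_words_form h sf) => x Hx.
  by rewrite unhatE.
- move=> x h i c y z; rewrite /unhat; case: ifP => _; last by rewrite mulr0 addr0.
  exact: words_form_mlin.
- move=> x h i j ij hij; rewrite /unhat; case: ifP => _ //.
  apply/eqP/contraT => nz; have := antisym_inj (words_form_antisym x af) nz hij.
  by move=> e; rewrite e eqxx in ij.
Qed.

(** The logarithmic derivative of [v^a] is [theta], the origin of the term that [d_theta] subtracts.
    The last hypothesis says that the coframe factors do not vary in the direction of
    differentiation. *)
Lemma cderive_words_form l (f : karr l) x h v : HC x -> ksm f ->
  (forall (phi : 'I_l -> T) i, cderive (fun y => cof (phi i) y (h i)) x v = 0) ->
  cderive (fun y => words_form a f y h) x v =
  theta a x v * words_form a f x h +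
  vpow a x * \sum_(phi : {ffun 'I_l -> T}) (\prod_i cof (phi i) x (h i)) *
     \sum_j cof j x v * frame_d fre fim j (f phi) (logmap x).
Proof.
move=> Hx sf H0.
have -> : (fun y => words_form a f y h) = fun y =>
   \sum_(phi : {ffun 'I_l -> T}) (\prod_i cof (phi i) y (h i)) *
    ((fun p => vlog a p * f phi p) \o logmap) y.
  by apply/funext => y; exact: words_formP.
have sP (phi : {ffun 'I_l -> T}) : smooth HC (fun y => \prod_i cof (phi i) y (h i)).
  by apply: (smooth_prod oHC) => i _; exact: sm_cof.
have sF (phi : {ffun 'I_l -> T}) : sm (fun p => vlog a p * f phi p).
  by apply: (smooth_mul oT); [exact: sm_vlog | exact: sf].
rewrite (cderive_sum oHC) //; last first.
  by move=> phi _; apply: (smooth_mul oHC); [exact: sP | exact: smooth_logmap].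
rewrite words_formP !mulr_sumr -big_split /=; apply: eq_bigr => phi _.
rewrite (@cderiveM _ _ _ HC _ _ _ _ Hx (sP phi) (smooth_logmap (sF phi))).
rewrite (@cderive_prod_log _ _ _ HC oHC _ _ _ (fun=> 0)) //; last 2 first.
- by move=> i; exact: sm_cof.
- by move=> i; rewrite H0 mul0r.
rewrite big1 // mul0r mul0r add0r cderive_logmap //.
rewrite (@cderiveM _ _ _ setT) //; last exact: sm_vlog.
rewrite cderive_vlog coP; last exact: sf.
have -> : \sum_k a k * (dlog x v (lshift t k) 1)%:C = theta a x v.
  by apply: eq_bigr => k _; rewrite mxE vslot_l.
have -> : \sum_j co j (dlog x v) * frame_d fre fim j (f phi) (logmap x) =
   \sum_j cof j x v * frame_d fre fim j (f phi) (logmap x).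
  by apply: eq_bigr => j _; rewrite cof_co.
by rewrite vpowE /=; ring.
Qed.

Definition d_slot l (w : form l) (x v : V) (psi : 'I_l -> V) : R[i] :=
  cderive (fun y => w y psi) x v - theta a x v * w x psi.

Lemma d_thetaE l (w : form l) x h : HC x ->
  d_theta a w x h = \sum_(i < l.+1) (-1) ^+ i * d_slot w x (h i) (omitw i h).
Proof.
move=> Hx; rewrite -[LHS]/(ext_d w x h - wedge1 (theta a) w x h) /ext_d mem_set //.
rewrite /wedge1 -sumrB; apply: eq_bigr => i _.
by rewrite /d_slot mulrBr.
Qed.

Lemma d_theta_out l (w : form l) x : (forall x, ~ HC x -> w x = 0) ->
  ~ HC x -> d_theta a w x = 0.
Proof.
move=> w0 nHx; apply/funext => h.
rewrite -[LHS]/(ext_d w x h - wedge1 (theta a) w x h) /ext_d memNset // sub0r.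
by rewrite /wedge1 big1 ?oppr0 // => i _; rewrite w0 // !mulr0.
Qed.

Lemma theta_lin (x : V) (c : R) (y z : V) : theta a x (c *: y + z) = c%:C * theta a x y + theta a x z.
Proof.
rewrite /theta mulr_sumr -big_split /=; apply: eq_bigr => k _.
have := cof_lin (inl k) x c y z; rewrite /cof => ->.
by move: (dlnv _ _ _) (dlnv _ _ _) => p q; ring.
Qed.

Lemma d_theta_mlin l (w : form l) x : is_form w -> HC x ->
  mlin (d_theta a w x : ('I_l.+1 -> V) -> R[i]).
Proof.
move=> fw Hx; have [_ sw _ _] := fw.
have -> : (d_theta a w x : ('I_l.+1 -> V) -> R[i]) =
    fun h => \sum_(i < l.+1) (-1) ^+ i * d_slot w x (h i) (omitw i h).
  by apply/funext => h; exact: d_thetaE.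
apply: mlin_sum => [v h i c y z|h c y z]; last first.
  by rewrite /d_slot (cderive_linr oHC) // theta_lin; move: (cderive _ _ _) (cderive _ _ _) => p q; ring.
rewrite /d_slot.
have -> : (fun y0 => w y0 (dfwith h i (c *: y + z)) : R[i]) =
    (fun y0 => c%:C * w y0 (dfwith h i y) + w y0 (dfwith h i z)).
  by apply/funext => y0; exact: form_mlin.
by rewrite (@cderive_lin _ _ HC) // (form_mlin x fw); move: (cderive _ _ _) (cderive _ _ _) => p q; ring.
Qed.

Lemma d_theta_antisym l (w : form l) x : is_form w -> HC x ->
  antisym (d_theta a w x : ('I_l.+1 -> V) -> R[i]).
Proof.
move=> fw Hx; have [_ sw _ _] := fw.
have -> : (d_theta a w x : ('I_l.+1 -> V) -> R[i]) =
    fun h => \sum_(i < l.+1) (-1) ^+ i * d_slot w x (h i) (omitw i h).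
  by apply/funext => h; exact: d_thetaE.
apply: alternating_sum => v i j h ij; rewrite /d_slot.
have -> : (fun y => w y (swapw i j h) : R[i]) = (fun y => -1 * w y h + (fun=> 0) y).
  by apply/funext => y; rewrite addr0 mulN1r; exact: form_antisym.
rewrite (@cderive_lin _ _ HC) //; last exact: (smooth_cst oHC).
by rewrite cderive_cst (form_antisym x fw h ij); move: (cderive _ _ _) => p; ring.
Qed.

(** Both sides are alternating and multilinear, so distinct coordinate vectors suffice. For these
    the coframe factors are constant along the omitted vector, the [theta] terms cancel, and [kd] is
    left slot by slot. *)
Lemma d_theta_unhat l (f : karr l) : ksm f -> kalt f ->
  d_theta a (unhat a f) = unhat a (kd fre fim f).
Proof.
move=> sf af; have fw := is_form_unhat sf af.
apply/funext => x; have [Hx|nHx] := pselect (HC x); last first.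
  rewrite d_theta_out //; last by case: fw.
  by apply/funext => h; rewrite /unhat memNset.
apply/funext; apply: mlin_antisym_eq.
- exact: d_theta_mlin.
- by move=> h i c y z; rewrite !unhatE //; exact: words_form_mlin.
- exact: d_theta_antisym.
- move=> i j h ij; rewrite !unhatE //; apply: words_form_antisym => //.
  exact: kd_alt.
move=> beta ib; set h : 'I_l.+1 -> V := fun i => _.
rewrite d_thetaE // unhatE // words_formE /word_sum /kd.
under [X in _ = _ * X]eq_bigr do rewrite mulr_sumr.
rewrite exchange_big /= mulr_sumr; apply: eq_bigr => i _.
rewrite /d_slot (@cderive_near _ _ _ HC oHC _ (fun y => words_form a f y (omitw i h))) //; last first.
  by move=> y Hy; rewrite unhatE.
rewrite cderive_words_form //; last first.
  move=> phi k; apply: cof_delta_derive => //.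
  by rewrite (inj_eq ib) eq_sym neq_lift.
rewrite unhatE // addrAC subrr add0r mulrCA; congr (_ * _).
under [RHS]eq_bigr do rewrite mulrCA.
rewrite -mulr_sumr; congr (_ * _).
under [RHS]eq_bigr do rewrite (bigD1_ord i) //=.
(* A word of length [l.+1] is its letter in slot [i] together with the word that remains after
   omitting it. *)
rewrite (big_ffun_omit i (fun b (phi : 'I_l -> T) => cof b x (h i) *
  (\prod_k cof (phi k) x (h (lift i k))) * frame_d fre fim b (f phi) (logmap x))) exchange_big /=.
apply: eq_bigr => phi _; rewrite mulr_sumr; apply: eq_bigr => j _.
by rewrite mulrCA mulrA.
Qed.

Lemma kd_hat l (w : form l) : is_form w -> kd fre fim (hat a w) = hat a (d_theta a w).
Proof.
move=> fw; rewrite -{2}(@unhat_hat _ _ _ a _ w).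
- by rewrite d_theta_unhat ?hat_unhat //; [exact: hat_ksm | exact: hat_kalt].
- by case: fw.
- by move=> x Hx; exact: form_mlin.
Qed.

End Correspondence.

(** * The action of units and integers *)

Section GroupAction.
Variables (R : realType) (K : fieldExtType rat) (s t : nat).
Variable sigma : 'I_(s + t + t) -> {rmorphism K -> R[i]}.
Notation V := (pt R s t).
Notation sm := (@smooth R V setT).
Notation HC := (@HC R s t).
Notation T := ('I_s + 'I_(s + t + t))%type.
Notation karr := (karr R (s + t) 2 T).
Notation fre := (@fre R s t).
Notation fim := (@fim R s t).
Notation logmap := (@logmap R s t).
Notation coord := (@Defs.coord R s t).
Notation O_Kpos := (O_Kpos sigma).
Let oT : open [set: V]. Proof. exact: openT. Qed.
Let oHC : open HC := @HC_open R s t.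

Hypothesis real_im : forall k x, complex.Im (real_emb sigma k x) = 0.
Hypothesis conj_cplx : forall k x, conj_emb sigma k x = conjc (cplx_emb sigma k x).

Lemma real_embE k x : real_emb sigma k x = (complex.Re (real_emb sigma k x))%:C.
Proof. by apply: cplx_eq => //=; rewrite real_im. Qed.

Definition remb (k : 'I_s) (u : K) : R := complex.Re (real_emb sigma k u).

(* In logarithmic coordinates [dilate u] is the affine map [lgam u], with linear part [dlg u]. *)
Definition dlg (u : K) (h : V) : V :=
  \matrix_(i, c) if vslot i c then h i c else dilate sigma u h i c.
Definition lvec (u : K) : V :=
  \matrix_(i, c) if fintype.split i is inl k then
    (if c == 1 then ln (remb k u) else 0) else 0.
Definition lgam (u : K) (p : V) : V := dlg u p + lvec u.
Definition latv (b : K) : V := mkpt (fun j => sigma (lshift t j) b).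
Definition wt (u : K) (j : T) : R[i] := if j is inr i then sigma i u else 1.

Lemma dlgE u h i c : dlg u h i c = if vslot i c then h i c else dilate sigma u h i c.
Proof. by rewrite mxE. Qed.

Lemma mkptE f j (c : 'I_2) : (mkpt f : V) j c =
  if c == 0 then complex.Re (f j) else complex.Im (f j).
Proof. by rewrite mxE. Qed.

Lemma ord2P (c : 'I_2) : c = 0 \/ c = 1.
Proof. by case: c => -[|[|//]] c2; [left | right]; exact: ord_inj. Qed.

Lemma mkpt_coord f j : coord (mkpt f : V) j = f j.
Proof. by rewrite /coord !mkptE /=; case: (f j). Qed.

Lemma coord_eq (x y : V) : coord x =1 coord y -> x = y.
Proof.
by move=> H; apply/matrixP => i c; have [] := H i; case: (ord2P c) => ->.
Qed.

Lemma coordD (z w : V) j : coord (z + w) j = coord z j + coord w j.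
Proof. by rewrite /Defs.coord !mxE. Qed.

Lemma dilateD u (x y : V) : dilate sigma u (x + y) = dilate sigma u x + dilate sigma u y.
Proof.
apply: coord_eq => j; rewrite mkpt_coord.
by rewrite !coordD !mkpt_coord mulrDr.
Qed.

Lemma translateE b x : translate sigma b x = x + latv b.
Proof.
apply: coord_eq => j; rewrite mkpt_coord.
by rewrite coordD mkpt_coord.
Qed.

Lemma dilate_latv u b : dilate sigma u (latv b) = latv (u * b).
Proof. by apply: coord_eq => j; rewrite !mkpt_coord rmorphM. Qed.

Lemma latv_vslot b i c : vslot i c -> latv b i c = 0.
Proof. by move=> /vslotP[k -> ->]; rewrite mkptE /=; exact: real_im. Qed.

Lemma dlg_latv u b : dlg u (latv b) = latv (u * b).
Proof.
apply/matrixP => i c; rewrite mxE -dilate_latv; case: ifP => // v.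
by rewrite latv_vslot // dilate_latv latv_vslot.
Qed.

Lemma dlgD u p q : dlg u (p + q) = dlg u p + dlg u q.
Proof.
by apply/matrixP => i c; rewrite [RHS]mxE !dlgE dilateD; case: ifP => _; rewrite mxE.
Qed.

Lemma dilateZ u (c : R) (x : V) : dilate sigma u (c *: x) = c *: dilate sigma u x.
Proof.
apply: coord_eq => j; rewrite mkpt_coord.
have E (z : V) : coord (c *: z) j = c%:C * coord z j.
  by rewrite /coord !mxE; apply: cplx_eq => /=; ring.
by rewrite !E mkpt_coord mulrCA.
Qed.

Lemma dlgZ u (c : R) p : dlg u (c *: p) = c *: dlg u p.
Proof. by apply/matrixP => i k; rewrite [RHS]mxE !dlgE dilateZ; case: ifP => _; rewrite mxE. Qed.

Lemma dilate_im u x k : dilate sigma u x (lshift t k) 1 = remb k u * x (lshift t k) 1.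
Proof.
rewrite mkptE /= -[sigma _]/(real_emb sigma k) real_embE /Defs.coord /=; ring.
Qed.

Lemma dilate_nvslot u (x y : V) i c : ~~ vslot i c ->
  (forall i c, ~~ vslot i c -> x i c = y i c) ->
  dilate sigma u x i c = dilate sigma u y i c.
Proof.
move=> v H; rewrite !mkptE /Defs.coord.
case: (split_ordP i) v => k -> v; last first.
  have nv c' : ~~ vslot (rshift s k) c' by rewrite /vslot split_r.
  by rewrite !H.
have c0 : c = 0.
  by move: v; rewrite /vslot split_l /=; case: (ord2P c) => ->.
rewrite c0 /= -[sigma _]/(real_emb sigma k) real_embE /= !mul0r !subr0 H //.
by rewrite /vslot andbF.
Qed.

Lemma logmapE (x : V) i c : logmap x i c = if vslot i c then ln (x i c) else x i c.
Proof. by rewrite mxE. Qed.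

Lemma lvec_l k u : lvec u (lshift t k) 1 = ln (remb k u).
Proof. by rewrite mxE split_l. Qed.

Lemma remb_gt0 k u : O_Kpos u -> 0 < remb k u.
Proof. by move=> [_ _ _ /(_ k)]; rewrite real_embE ltcR. Qed.

Lemma lvec_vslot u i c : ~~ vslot i c -> lvec u i c = 0.
Proof. by rewrite mxE /vslot; case: fintype.split => //= k /negbTE ->. Qed.

Lemma dilate_HC u x : O_Kpos u -> HC x -> HC (dilate sigma u x).
Proof.
by move=> Ou Hx k; rewrite /= dilate_im mulr_gt0 //; [exact: remb_gt0 | exact: Hx].
Qed.

Lemma logmap_act u b x : O_Kpos u -> HC x ->
  logmap (translate sigma b (dilate sigma u x)) = lgam u (logmap x) + latv b.
Proof.
move=> Ou Hx; rewrite translateE; apply/matrixP => i c.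
rewrite logmapE [(dilate _ _ _ + _) i c]mxE [RHS]mxE [lgam _ _ _ _]mxE dlgE.
case: ifPn => v.
  rewrite latv_vslot // !addr0 [logmap x i c]mxE v; have [k -> ->] := vslotP v.
  rewrite dilate_im lvec_l lnM ?posrE 1?addrC //; [exact: remb_gt0 | exact: Hx].
by rewrite lvec_vslot // addr0; congr (_ + _); apply: dilate_nvslot => // i' c' v'; rewrite mxE (negbTE v').
Qed.

Lemma dlg_re u h k : dlg u h (lshift t k) 0 = remb k u * h (lshift t k) 0.
Proof.
rewrite dlgE /vslot andbF mkptE /= -[sigma _]/(real_emb sigma k) real_embE /Defs.coord /=.
by rewrite mul0r subr0.
Qed.

Lemma dlg_coord u h k : coord (dlg u h) (rshift s k) =
  cplx_emb sigma k u * coord h (rshift s k).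
Proof.
rewrite [LHS]/(Defs.coord _ _) !dlgE /vslot split_r /= !mkptE /=.
by rewrite -[sigma _]/(cplx_emb sigma k); case: (_ * _).
Qed.

Lemma co_dlg u j h : co j (dlg u h) = wt u j * co j h.
Proof.
have cE k (z : V) : co (zl s k) z = coord z (rshift s k) by rewrite coE.
have cbE k (z : V) : co (zbl s k) z = conjc (coord z (rshift s k)) by rewrite coE.
move: j; apply: letterP => k.
- by rewrite !coE dlgE vslot_l mul1r.
- by rewrite !coE dlg_re realCM -[wt u _]/(real_emb sigma k u) -real_embE.
- by rewrite !cE dlg_coord.
- by rewrite !cbE dlg_coord rmorphM -[wt u _]/(conj_emb sigma k u) conj_cplx.
Qed.

Lemma dlog_act u b x h : O_Kpos u -> HC x ->
  dlog (translate sigma b (dilate sigma u x)) (dilate sigma u h) = dlg u (dlog x h).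
Proof.
move=> Ou Hx; apply/matrixP => i c; rewrite dlgE mxE; case: ifPn => v.
  rewrite translateE [(dilate _ _ _ + _) i c]mxE latv_vslot // addr0 [dlog x h i c]mxE v.
  have [k -> ->] := vslotP v; rewrite !dilate_im.
  by rewrite -mulf_div mulfV ?mul1r // gt_eqF // remb_gt0.
by apply: dilate_nvslot => // i' c' v'; rewrite mxE (negbTE v').
Qed.

Lemma cof_act u b x h j : O_Kpos u -> HC x ->
  cof j (translate sigma b (dilate sigma u x)) (dilate sigma u h) = wt u j * cof j x h.
Proof. by move=> Ou Hx; rewrite !cof_co dlog_act // co_dlg. Qed.

Lemma translate_HC b x : HC x -> HC (translate sigma b x).
Proof.
move=> Hx k; rewrite translateE /= mxE latv_vslot ?vslot_l // addr0.
exact: (Hx k).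
Qed.

Lemma lgam1 p : lgam 1 p = p.
Proof.
have d1 (x : V) : dilate sigma 1 x = x.
  by apply: coord_eq => j; rewrite mkpt_coord rmorph1 mul1r.
apply/matrixP => i c; rewrite mxE dlgE d1 if_same.
case: (boolP (vslot i c)) => v; last by rewrite lvec_vslot // addr0.
have [k -> ->] := vslotP v.
by rewrite lvec_l /remb rmorph1 ln1 addr0.
Qed.

Lemma lgamM u v p : O_Kpos u -> O_Kpos v -> lgam (u * v) p = lgam u (lgam v p).
Proof.
move=> Ou Ov; rewrite /lgam dlgD.
have dM (x : V) : dilate sigma (u * v) x = dilate sigma u (dilate sigma v x).
  by apply: coord_eq => j; rewrite !mkpt_coord rmorphM mulrA.
have -> : dlg (u * v) p = dlg u (dlg v p).
  apply/matrixP => i c; rewrite !dlgE; case: ifPn => // w; rewrite dM.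
  apply: dilate_nvslot => // i' c' w'; by rewrite dlgE (negbTE w').
rewrite -addrA; congr (_ + _); apply/matrixP => i c; rewrite [RHS]mxE dlgE.
case: (boolP (vslot i c)) => w.
  have [k -> ->] := vslotP w; rewrite !lvec_l addrC -lnM ?posrE //; try exact: remb_gt0.
  by congr ln; rewrite /remb rmorphM [in LHS]real_embE [real_emb _ _ v in LHS]real_embE /= mul0r subr0.
rewrite !lvec_vslot // addr0 (@dilate_nvslot u (lvec v) 0) //; last first.
  by move=> i' c' w'; rewrite lvec_vslot // mxE.
have -> : dilate sigma u 0 = 0 :> V.
  by have := dilateZ u 0 (0 : V); rewrite !scale0r.
by rewrite mxE.
Qed.

Lemma rho_vlog a u p : vlog a (lgam u p) = vlog a p * rho sigma a u.
Proof.
rewrite /vlog /rho -big_split /=; apply: eq_bigr => k _.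
by rewrite cpowE -cexpD mxE dlgE vslot_l lvec_l.
Qed.

Section Pull.
Variable a : 'I_s -> R[i].

(** Pullback by [translate b \o dilate u], expressed on coefficients; the factor [rho] appears
    because [unhat] splits off [v^a]. *)
Definition gpull u b l (f : karr l) : karr l := fun phi p =>
  rho sigma a u * (\prod_i wt u (phi i)) * f phi (lgam u p + latv b).

Lemma unhat_act u b l (f : karr l) x h : O_Kpos u -> HC x ->
  unhat a f (translate sigma b (dilate sigma u x)) (fun j => dilate sigma u (h j)) =
  unhat a (gpull u b f) x h.
Proof.
move=> Ou Hx; rewrite !unhatE //; last by apply: translate_HC; exact: dilate_HC.
rewrite /words_form !vpowE logmap_act //.
have -> : vlog a (lgam u (logmap x) + latv b) = vlog a (logmap x) * rho sigma a u.
  rewrite -rho_vlog; apply: eq_bigr => k _.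
  by congr (cexp _ _); rewrite mxE latv_vslot ?vslot_l // addr0.
rewrite -mulrA mulr_sumr; congr (_ * _); apply: eq_bigr => phi _.
under eq_bigr do rewrite cof_act //.
by rewrite big_split /= /gpull; ring.
Qed.

Lemma gpull_hat u b l (w : Defs.form R s t l) (U : set K) : U `<=` O_Kpos ->
  is_form w -> Defs.invariant sigma U w -> U u -> O_K b -> gpull u b (hat a w) = hat a w.
Proof.
move=> UO fw iw Uu Ob; rewrite -[LHS](hat_unhat a); congr (hat a _).
apply/funext => x; apply/funext => h; have [Hx|nHx] := pselect (HC x); last first.
  by rewrite /unhat memNset //; case: fw => ->.
rewrite -unhat_act //; last exact: UO.
rewrite unhat_hat ?iw //; first by case: fw.
by move=> y Hy; exact: form_mlin.
Qed.

Lemma invariant_unhat l (f : karr l) (U : set K) : U `<=` O_Kpos ->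
  (forall u b, U u -> O_K b -> gpull u b f = f) -> Defs.invariant sigma U (unhat a f).
Proof.
by move=> UO H u b x h Uu Ob Hx; rewrite unhat_act ?H //; exact: UO.
Qed.

End Pull.

End GroupAction.

(** Passes from a family with possible repetitions to the list of its distinct values, adding the
    coefficients of equal vectors. The parameter in [X] will be a function with a point, so that one
    [W] serves them all. *)
Lemma span_family (R : realType) (A C : eqType) (X : Type) (r : seq A) (v : A -> C) (F : X -> C -> R[i])
    (c : A -> R[i]) :
  exists W : C -> R[i], forall x,
    \sum_(k <- r) c k * F x (v k) = \sum_(lam <- undup (map v r)) W lam * F x lam.
Proof.
exists (fun lam => \sum_(k <- r | v k == lam) c k) => x.
under [RHS]eq_bigr do rewrite mulr_suml big_mkcond.
rewrite exchange_big; apply: eq_big_seq => k kr /=.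
rewrite (bigD1_seq (v k)) ?undup_uniq ?mem_undup ?map_f //= eqxx big1 ?addr0 //.
by move=> lam; rewrite eq_sym => /negbTE ->.
Qed.

(** * The affine maps given by the generators *)

Section GeneratedAction.
Variables (R : realType) (K : fieldExtType rat) (s t : nat).
Variable sigma : 'I_(s + t + t) -> {rmorphism K -> R[i]}.
Notation V := (pt R s t).
Notation sm := (@smooth R V setT).
Notation T := ('I_s + 'I_(s + t + t))%type.
Notation karr := (karr R (s + t) 2 T).
Notation fre := (@fre R s t).
Notation fim := (@fim R s t).
Notation O_Kpos := (O_Kpos sigma).
Notation frame_d := (frame_d fre fim).
Let oT : open [set: V]. Proof. exact: openT. Qed.

Hypothesis real_im : forall k x, complex.Im (real_emb sigma k x) = 0.
Hypothesis conj_cplx : forall k x, conj_emb sigma k x = conjc (cplx_emb sigma k x).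

Variables (gen : 'I_s -> K) (B : 'M[R]_s) (d : nat) (lat : 'I_d -> K)
  (L : 'M[R[i]]_(s + t + t, d)) (a : 'I_s -> R[i]).
Hypothesis gen_pos : forall i, O_Kpos (gen i).
Hypothesis unitB : B \in unitmx.
Hypothesis log_gen : forall i, log_emb sigma (gen i) = row i B.
Hypothesis latO : forall k, O_K (lat k).
Hypothesis lat_inv : L *m (\matrix_(k, i) sigma i (lat k)) = 1%:M.

(* [1] for [i >= s] *)
Definition gn (i : nat) : K := oapp gen 1 (insub i : option 'I_s).
Definition fibre (j : T) : bool := if j is inr _ then true else false.
Definition Lat : set V := latv sigma @` O_K (K := K).
Definition lams : seq V := undup [seq latv sigma (lat k) | k <- enum 'I_d].
(** The coordinates of [ln v] in the basis formed by the logarithms of the generators: for indices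
    below [s], [gn i] raises the [i]-th by 1 and fixes the others. *)
Definition ell (i : nat) (p : V) : R :=
  oapp (fun j => (\row_k p (lshift t k) 1 *m invmx B) 0 j) 0 (insub i : option 'I_s).

Lemma O_K1 : O_K (1 : K). Proof. exact: (integral1 intr). Qed.

Lemma O_KM (x y : K) : O_K x -> O_K y -> O_K (x * y).
Proof. exact: (integral_mul (RtoK := intr)). Qed.

Lemma O_Kpos1 : O_Kpos 1.
Proof.
by split; rewrite ?invr1; [exact: oner_neq0 | exact: O_K1 | exact: O_K1 |];
  move=> k; rewrite rmorph1 ltr01.
Qed.

Lemma O_KposV u : O_Kpos u -> O_Kpos u^-1.
Proof.
by move=> [u0 Ou OVu pu]; split; rewrite ?invr_eq0 ?invrK // => k; rewrite fmorphV invr_gt0.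
Qed.

Lemma O_KposM u v : O_Kpos u -> O_Kpos v -> O_Kpos (u * v).
Proof.
move=> [u0 Ou OVu pu] [v0 Ov OVv pv]; split; first exact: mulf_neq0.
- exact: O_KM.
- by rewrite invfM; exact: O_KM.
- by move=> k; rewrite rmorphM mulr_gt0.
Qed.

Lemma gnE (i : 'I_s) : gn i = gen i.
Proof. by rewrite /gn valK. Qed.

Lemma gn_pos i : O_Kpos (gn i).
Proof. by rewrite /gn; case: insub => [j|] /=; [exact: gen_pos | exact: O_Kpos1]. Qed.

Lemma lams_Lat lam : lam \in lams -> Lat lam.
Proof. by rewrite mem_undup => /mapP[k _ ->]; exists (lat k). Qed.

Lemma co_latv k i : co (inr i) (latv sigma (lat k)) = sigma i (lat k).
Proof.
suff H j : co j (latv sigma (lat k)) = if j is inr i then sigma i (lat k) else 0 by exact: H.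
have cE k' (z : V) : co (zl s k') z = Defs.coord z (rshift s k') by rewrite coE.
have cbE k' (z : V) : co (zbl s k') z = conjc (Defs.coord z (rshift s k')) by rewrite coE.
move: j; apply: letterP => k'.
- by rewrite coE latv_vslot // vslot_l.
- by rewrite coE mkptE /= -[sigma _]/(real_emb sigma k') -real_embE.
- by rewrite cE mkpt_coord.
- by rewrite cbE mkpt_coord -[RHS]/(conj_emb sigma k' _) conj_cplx.
Qed.

Lemma Lat_fib b j : Lat b -> ~~ fibre j -> co j b = 0.
Proof.
move=> [x _ <-]; case: j => [k|//] _.
by rewrite /co latv_vslot // vslot_l.
Qed.

(** The row of the left inverse [L] indexed by the letter combines the derivatives along the lattice
    vectors, with complex coefficients, into the frame field. *)
Lemma fib_span j : fibre j -> exists W : V -> R[i],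
  forall (f : V -> R[i]) x, sm f ->
  frame_d j f x = \sum_(lam <- lams) W lam * cderive f x lam.
Proof.
case: j => [//|i] _; set M := \matrix_(k, i) sigma i (lat k).
have [W HW] := @span_family R _ _ ((V -> R[i]) * V)%type (enum 'I_d)
  (fun k => latv sigma (lat k)) (fun fx lam => cderive fx.1 fx.2 lam) (L i).
exists W => f x sf; rewrite -(HW (f, x)) big_enum /=.
under eq_bigr do rewrite (coP _ _ sf) mulr_sumr.
rewrite exchange_big big_sumType /= big1 ?add0r => [|k _]; last first.
  by rewrite big1 // => k' _; rewrite latv_vslot ?mul0r ?mulr0 // vslot_l.
transitivity (\sum_i' (L *m M) i i' * frame_d (inr i') f x).
  rewrite lat_inv (bigD1 i) //= mxE eqxx mul1r big1 ?addr0 // => i' ne.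
  by rewrite mxE eq_sym (negbTE ne) mul0r.
apply: eq_bigr => i' _; rewrite mxE mulr_suml; apply: eq_bigr => k _.
by rewrite -[e_form i' _]/(co (inr i') _) co_latv mxE mulrA.
Qed.

Lemma lgam_cancel u : O_Kpos u -> cancel (lgam sigma u) (lgam sigma u^-1).
Proof.
move=> Ou p; rewrite -lgamM //; last exact: O_KposV.
by rewrite mulVf ?lgam1 //; case: Ou.
Qed.

Lemma lgamK i : cancel (lgam sigma (gn i)) (lgam sigma (gn i)^-1).
Proof. exact: lgam_cancel (gn_pos i). Qed.

Lemma lgamK' i : cancel (lgam sigma (gn i)^-1) (lgam sigma (gn i)).
Proof.
by have := @lgam_cancel (gn i)^-1; rewrite invrK; apply; exact: O_KposV (gn_pos i).
Qed.

Lemma Ck_lgam u k i c : Ck setT k (fun p : V => lgam sigma u p i c).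
Proof.
have E (p : V) : lgam sigma u p i c =
    (if vslot i c then p i c else
     (if c == 0 then complex.Re (sigma (lshift t i) u) * p i 0 +
                     - complex.Im (sigma (lshift t i) u) * p i 1
      else complex.Re (sigma (lshift t i) u) * p i 1 +
                     complex.Im (sigma (lshift t i) u) * p i 0)) + lvec sigma u i c.
  rewrite mxE dlgE; congr (_ + _); case: ifP => // _; rewrite mkptE /Defs.coord.
  case: (sigma _ _) => x y /=; case: ifP => _; ring.
apply: (@Ck_eq _ _ _ oT k (fun p : V => (if vslot i c then p i c else
     (if c == 0 then complex.Re (sigma (lshift t i) u) * p i 0 +
                     - complex.Im (sigma (lshift t i) u) * p i 1
      else complex.Re (sigma (lshift t i) u) * p i 1 +
                     complex.Im (sigma (lshift t i) u) * p i 0)) + lvec sigma u i c)).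
  by move=> p _; rewrite E.
apply: (CkD oT); last exact: (Ck_cst oT).
case: (vslot i c); first exact: (Ck_entry oT).
by case: (c == 0); apply: (CkD oT); apply: (CkM oT); exact: (Ck_entry oT).
Qed.

Lemma sm_lgam u (f : V -> R[i]) : sm f -> sm (f \o lgam sigma u).
Proof. by apply: smooth_compT => k i c; exact: Ck_lgam. Qed.

Lemma frame_lgam u j (f : V -> R[i]) x : sm f ->
  frame_d j (f \o lgam sigma u) x = wt sigma u j * frame_d j f (lgam sigma u x).
Proof.
move=> sf; have E h : cderive (f \o lgam sigma u) x h = cderive f (lgam sigma u x) (dlg sigma u h).
  by apply: cderive_affine => // c; rewrite /lgam dlgD dlgZ addrAC.
rewrite [in LHS]/frame_d !E !coP // mulr_sumr -big_split /=.
transitivity (\sum_j' wt sigma u j' * (j' == j)%:R * frame_d j' f (lgam sigma u x)).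
  by apply: eq_bigr => j' _; rewrite !co_dlg // -co_frame; ring.
rewrite (bigD1 j) //= eqxx mulr1 big1 ?addr0 // => j' /negbTE ->.
by rewrite mulr0 mul0r.
Qed.

Lemma lgam_Lat u b : O_K u -> Lat b -> exists2 b', Lat b' &
  forall p, lgam sigma u (p + b) = lgam sigma u p + b'.
Proof.
move=> Ou [x Ox <-]; exists (latv sigma (u * x)); first by exists (u * x) => //; exact: O_KM.
by move=> p; rewrite /lgam dlgD dlg_latv // addrAC.
Qed.

Lemma lgamC i j p : lgam sigma (gn i) (lgam sigma (gn j) p) = lgam sigma (gn j) (lgam sigma (gn i) p).
Proof. by rewrite -!lgamM ?[gn i * _]mulrC //; exact: gn_pos. Qed.

Lemma Ck_ell i k : Ck setT k (ell i).
Proof.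
rewrite /ell; case: insub => [j|] /=; last exact: (Ck_cst oT).
apply: (@Ck_eq _ _ _ oT k (fun p : V => \sum_k invmx B k j * p (lshift t k) 1)).
  by move=> p _; rewrite mxE; apply: eq_bigr => k' _; rewrite mxE mulrC.
by apply: Ck_sum => // k' _; apply: (CkM oT); exact: (Ck_entry oT).
Qed.

Lemma ell_lgam i j p : (i < s)%N -> (j < s)%N ->
  ell j (lgam sigma (gn i) p) = ell j p + (i == j)%:R.
Proof.
suff H (i' j' : 'I_s) :
    ell j' (lgam sigma (gn i') p) = ell j' p + (i' == j')%:R.
  by move=> si sj; exact: (H (Ordinal si) (Ordinal sj)).
rewrite gnE /ell valK /=.
have -> : \row_k lgam sigma (gen i') p (lshift t k) 1 = \row_k p (lshift t k) 1 + row i' B.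
  apply/rowP => k; rewrite -log_gen [LHS]mxE [in LHS]mxE dlgE vslot_l lvec_l.
  by rewrite !mxE.
by rewrite mulmxDl [LHS]mxE -row_mul mulmxV // !mxE.
Qed.

Lemma ell_Lat i b p : Lat b -> ell i (p + b) = ell i p.
Proof.
move=> [x _ <-]; rewrite /ell; case: insub => [j|] //=; congr ((_ *m _) _ _).
by apply/rowP => k; rewrite mxE [in RHS]mxE mxE latv_vslot ?addr0 // vslot_l.
Qed.

Lemma wt_neq0 i j : wt sigma (gn i) j != 0.
Proof.
case: j => [k|j] /=; first exact: oner_neq0.
by rewrite fmorph_eq0; case: (gn_pos i).
Qed.

Lemma rho_neq0 i : rho sigma a (gn i) != 0.
Proof. by apply/prodf_neq0 => k _; rewrite cpowE cexp_neq0. Qed.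

(** The linear part [dlg] is the identity on the coordinates [ln v], so its difference from the
    identity takes values in the fibre. *)
Lemma lgam_cvec i x : (i < s)%N -> exists2 mu,
  lgam sigma (gn i) x = x + lvec sigma (gn i) + mu & forall j, ~~ fibre j -> co j mu = 0.
Proof.
move=> _; exists (dlg sigma (gn i) x - x); first by rewrite /lgam [RHS]addrC addrA subrK.
case=> [k|//] _; rewrite -scaleN1r addrC co_lin co_dlg //= mul1r.
by apply: cplx_eq; rewrite ?cReD ?cImD ?cReM ?cImM /=; ring.
Qed.

Lemma cvec_base i j : fibre j -> co j (lvec sigma (gn i)) = 0.
Proof.
move: j; apply: letterP => k // _; rewrite coE !mxE ?split_l ?split_r //=; apply: cplx_eq => //=.
by rewrite oppr0.
Qed.

Lemma base_span j : ~~ fibre j -> exists W : V -> R[i],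
  forall (f : V -> R[i]) x, sm f -> frame_d j f x =
   \sum_(lam <- map (fun i => lvec sigma (gn i)) (iota 0 s)) W lam * cderive f x lam.
Proof.
case: j => [k|//] _.
have row_lvec (i : 'I_s) : \row_k lvec sigma (gn i) (lshift t k) 1 = row i B.
  by apply/rowP => k'; rewrite -log_gen mxE lvec_l gnE mxE.
(* Independence of the rows of [B] makes these translations distinct, so [undup] removes nothing
   from their list. *)
have inj : {in iota 0 s &, injective (fun i => lvec sigma (gn i))}.
  move=> i i'; rewrite !mem_iota !add0n => /andP[_ si] /andP[_ si'] E.
  have E' : row (Ordinal si) B = row (Ordinal si') B.
    by rewrite -!row_lvec /= E.
  apply/eqP; apply: contraT => ne.
  have : row (Ordinal si) (1%:M : 'M[R]_s) = row (Ordinal si') 1%:M.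
    by rewrite -(mulmxV unitB) !row_mul E'.
  move=> /rowP /(_ (Ordinal si)) /eqP; rewrite !mxE eqxx [Ordinal si' == _]eq_sym (_ : Ordinal si == _ = false).
    by rewrite oner_eq0.
  exact: negbTE ne.
pose c (i : nat) : R[i] := oapp (fun j => (invmx B k j)%:C) 0 (insub i : option 'I_s).
have [W HW] := @span_family R _ _ ((V -> R[i]) * V)%type (iota 0 s)
  (fun i => lvec sigma (gn i)) (fun fx lam => cderive fx.1 fx.2 lam) c.
rewrite undup_id in HW; last by rewrite map_inj_in_uniq ?iota_uniq.
exists W => f x sf; rewrite -(HW (f, x)) -[s in iota _ s]subn0 big_mkord /=.
under eq_bigr do rewrite (coP _ _ sf) mulr_sumr.
rewrite exchange_big big_sumType /= [X in _ + X]big1 ?addr0 => [|i _]; last first.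
  by rewrite big1 // => i' _; rewrite -[e_form i _]/(co (inr i) _) cvec_base // mul0r mulr0.
transitivity (\sum_k' ((invmx B *m B) k k')%:C * frame_d (inl k') f x).
  rewrite mulVmx // (bigD1 k) //= mxE eqxx mul1r big1 ?addr0 // => k' ne.
  by rewrite mxE eq_sym (negbTE ne) mul0r.
apply: eq_bigr => k' _; rewrite mxE rmorph_sum mulr_suml; apply: eq_bigr => i _.
rewrite mulrA /c valK /= -realCM; congr ((_ * _)%:C * _).
by have /rowP/(_ k') := row_lvec i; rewrite !mxE.
Qed.

Lemma wt_base i j : ~~ fibre j -> wt sigma (gn i) j = 1.
Proof. by case: j. Qed.

End GeneratedAction.

(** * Embeddings of the number field *)

Section EmbeddingIndependence.
Variables (K L : fieldType) (n : nat) (sigma : 'I_n -> {rmorphism K -> L}).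
Hypothesis sigma_inj : forall i j, sigma i =1 sigma j -> i = j.

(* Dedekind's argument: subtracting [sigma j y] times the relation at [x] from
   the relation at [y * x] removes the index [j]. *)
Lemma embeddings_independent (c : 'I_n -> L) :
  (forall x, \sum_i c i * sigma i x = 0) -> forall i, c i = 0.
Proof.
suff H (r : seq 'I_n) : uniq r -> forall c : 'I_n -> L,
    (forall x, \sum_(i <- r) c i * sigma i x = 0) -> {in r, forall i, c i = 0}.
  move=> E i; apply: (H (index_enum 'I_n)) (mem_index_enum i) => //.
  exact: index_enum_uniq.
elim: r => [//|j r IH] /= /andP[jr ur] {}c E.
have cr : {in r, forall i, c i = 0}.
  move=> i ir; apply/eqP; apply: contraT => ci.
  have ij : i != j by apply: contraNneq jr => <-.
  suff : i = j by move/eqP; rewrite (negbTE ij).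
  apply: sigma_inj => y; apply/eqP; rewrite -subr_eq0.
  have F x : \sum_(i <- r) (c i * (sigma i y - sigma j y)) * sigma i x = 0.
    have := E (y * x); have := congr1 (fun z => sigma j y * z) (E x).
    rewrite !big_cons mulr0 => E1 E2.
    transitivity ((c j * sigma j (y * x) + \sum_(j0 <- r) c j0 * sigma j0 (y * x)) -
      sigma j y * (c j * sigma j x + \sum_(j0 <- r) c j0 * sigma j0 x)); last first.
      by rewrite E1 E2 subr0.
    rewrite mulrDr mulr_sumr rmorphM opprD addrACA.
    rewrite [X in _ = X + _](_ : _ = 0) ?add0r; last by ring.
    by rewrite -sumrB; apply: eq_bigr => k _; rewrite rmorphM; ring.
  by have /eqP := IH ur _ F i ir; rewrite mulf_eq0 (negbTE ci).
move=> i; rewrite inE => /orP[/eqP ->|]; last exact: cr.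
have := E 1; rewrite big_cons rmorph1 mulr1 big1_seq ?addr0 // => k /= kr.
by rewrite cr // mul0r.
Qed.

End EmbeddingIndependence.

Section IntegralScaling.
Variable K : fieldExtType rat.

Lemma int_ext_eq0 (z : int) : (z%:~R == 0 :> K) = (z == 0).
Proof. by rewrite -(rmorph_int (in_alg K)) fmorph_eq0 intr_eq0. Qed.

(* If [p] has leading coefficient [c] and degree [d], then [c x] is a root of the
   monic polynomial [c ^ (d - 1) * p ('X / c)], whose coefficients are integers. *)
Lemma integral_multiple (x : K) : exists2 c : int, c != 0 & O_K (c%:~R * x).
Proof.
(* The minimal polynomial over the rationals, with its denominators cleared. *)
have [p p0 px] : exists2 p : {poly int}, p != 0 & root (map_poly intr p) x.
  have /polyOver1P [q Eq] := minPolyOver 1%VS x.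
  have [p [c c0 Ep]] := rat_poly_scale q.
  exists p.
    apply/eqP => p0; have := monic_neq0 (monic_minPoly 1%VS x).
    by rewrite Eq Ep p0 map_poly0 scaler0 map_poly0 eqxx.
  have := root_minPoly 1%VS x; rewrite Eq Ep map_polyZ /= rootZ.
    rewrite -map_poly_comp; congr (root _ _); apply: eq_map_poly => z /=.
    exact: (rmorph_int (in_alg K) z).
  by rewrite scaler_eq0 invr_eq0 intr_eq0 (negbTE c0) oner_eq0.
have sp : (1 < size p)%N.
  have : root (map_poly (intr : int -> K) p) x by [].
  rewrite ltnNge; apply: contraL => /size1_polyC E.
  rewrite E map_polyC rootC /= int_ext_eq0.
  by apply: contraNneq p0 => z; rewrite E z.
exists (lead_coef p); first by rewrite lead_coef_eq0.
move: sp p0 px; case E: (size p) => [//|[//|d]] _ p0 px.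
pose cc := lead_coef p.
pose cf (i : nat) : int := p`_i * cc ^+ (d - i).
pose q : {poly int} := 'X^(d.+1) + \poly_(i < d.+1) cf i.
have sq : (size (\poly_(i < d.+1) cf i) < size ('X^(d.+1) : {poly int}))%N.
  by rewrite size_polyXn ltnS size_poly.
exists q; first by rewrite monicE /q lead_coefDl // lead_coefXn.
move: px; rewrite /root => /eqP px; apply/eqP.
have -> : map_poly intr q = 'X^(d.+1) + \poly_(i < d.+1) ((cf i)%:~R : K).
  rewrite /q rmorphD /= map_polyXn; congr (_ + _); apply/polyP => i.
  by rewrite coef_map_id0 ?mulr0z // !coef_poly; case: ifP => // _; rewrite mulr0z.
rewrite hornerD hornerXn horner_poly.
rewrite -[RHS](mulr0 (cc%:~R ^+ d)) -[X in _ = _ * X]px horner_coef size_map_inj_poly ?E; last 2 first.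
- by move=> y z /eqP; rewrite -subr_eq0 -mulrzBr int_ext_eq0 subr_eq0 => /eqP.
- by [].
rewrite mulr_sumr [in RHS]big_ord_recr /= [LHS]addrC; congr (_ + _).
  apply: eq_bigr => i _; rewrite coef_map_id0 ?mulr0z // /cf exprMn rmorphM rmorphXn /=.
  have -> : (cc%:~R : K) ^+ d = cc%:~R ^+ (d - i) * cc%:~R ^+ i.
    by rewrite -exprD subnK // -ltnS.
  by rewrite /cc; ring.
rewrite coef_map_id0 ?mulr0z //; have -> : p`_d.+1 = cc by rewrite /cc lead_coefE E.
by rewrite exprMn exprS; ring.
Qed.

End IntegralScaling.

Section Lattices.
Variables (R : realType) (K : fieldExtType rat) (s t : nat).
Variable sigma : 'I_(s + t + t) -> {rmorphism K -> R[i]}.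
Notation O_Kpos := (O_Kpos sigma).

(** Scale a rational basis of [K] into [O_K]. A linear relation between the embeddings on this basis
    extends to all of [K], since embeddings agree on the rationals, and is trivial by Dedekind; full
    rank then provides the left inverse. *)
Lemma O_K_spanning : (forall i j, sigma i =1 sigma j -> i = j) ->
  exists d (lat : 'I_d -> K) (L : 'M[R[i]]_(s + t + t, d)),
    (forall k, O_K (lat k)) /\ L *m (\matrix_(k, i) sigma i (lat k)) = 1%:M.
Proof.
move=> sigma_inj; pose b := vbasis {:K}%VS.
have Hb (k : 'I_(\dim {:K})) : exists c : int, c != 0 /\ O_K (c%:~R * b`_k).
  by have [c c0 Oc] := integral_multiple b`_k; exists c.
have [c Hc] := choice Hb.
exists (\dim {:K}), (fun k => (c k)%:~R * b`_k).
set M := \matrix_(k, i) _.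
have free : row_free M^T.
  rewrite -kermx_eq0; apply/rowV0P => u /sub_kermxP uM.
  apply/rowP => i; rewrite mxE; apply: (embeddings_independent sigma_inj) => x.
  rewrite (coord_vbasis (memvf x)).
  under eq_bigr do rewrite rmorph_sum mulr_sumr.
  rewrite exchange_big big1 // => k _ /=; have [c0 _] := Hc k.
  have ck0 : ((c k)%:~R : R[i]) != 0 by rewrite intr_eq0.
  apply: (mulfI ck0); rewrite mulr0 mulr_sumr.
  set q := coord _ _ _.
  transitivity (sigma i q%:A * (u *m M^T) 0 k); last by rewrite uM mxE mulr0.
  rewrite mxE mulr_sumr; apply: eq_bigr => j _; rewrite !mxE.
  have E j' : sigma j' q%:A = ratr q by exact: (fmorph_eq_rat (sigma j' \o in_alg K)).
  have -> : sigma j (q *: (vbasis {:K})`_k) = sigma i q%:A * sigma j b`_k.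
    by rewrite -[q *: _]mulr_algl rmorphM !E.
  by rewrite [sigma j (_ * _)]rmorphM rmorph_int; ring.
have [N MN] := row_freeP free.
exists N^T; split; first by move=> k; case: (Hc k).
by rewrite -[M]trmxK -trmx_mul MN trmx1.
Qed.

Hypothesis real_im : forall k x, complex.Im (real_emb sigma k x) = 0.

Lemma log_embE u k : log_emb sigma u 0 k = ln (remb sigma k u).
Proof. by rewrite mxE. Qed.

Lemma rembM k u v : remb sigma k (u * v) = remb sigma k u * remb sigma k v.
Proof.
rewrite /remb rmorphM; have := real_im k u; have := real_im k v.
by case: (real_emb _ _ u) (real_emb _ _ v) => [p q] [p' q'] /= -> ->; rewrite mulr0 subr0.
Qed.

Lemma log_embM u v : O_Kpos u -> O_Kpos v ->
  log_emb sigma (u * v) = log_emb sigma u + log_emb sigma v.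
Proof.
move=> Ou Ov; apply/rowP => k; rewrite log_embE [RHS]mxE !log_embE rembM.
by rewrite lnM // posrE; exact: remb_gt0.
Qed.

Lemma log_emb1 : log_emb sigma 1 = 0.
Proof. by apply/rowP => k; rewrite log_embE /remb rmorph1 ln1 mxE. Qed.

Lemma log_embV u : O_Kpos u -> log_emb sigma u^-1 = - log_emb sigma u.
Proof.
move=> Ou; apply/eqP; rewrite -addr_eq0 -log_embM //; last exact: O_KposV.
by rewrite mulVf ?log_emb1 //; case: Ou.
Qed.

Section Subgroup.
Variable U : set K.
Hypothesis U_sub : U `<=` O_Kpos.
Hypothesis U1 : U 1.
Hypothesis U_div : forall u v, U u -> U v -> U (u / v).

Lemma UV u : U u -> U u^-1.
Proof. by move=> Uu; have := U_div U1 Uu; rewrite mul1r. Qed.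

Lemma UM u v : U u -> U v -> U (u * v).
Proof. by move=> Uu Uv; rewrite -[v]invrK; apply: U_div => //; exact: UV. Qed.

Lemma UX u n : U u -> U (u ^+ n) /\ log_emb sigma (u ^+ n) = log_emb sigma u *+ n.
Proof.
move=> Uu; elim: n => [|n [Un En]]; first by rewrite expr0 mulr0n log_emb1.
rewrite exprS mulrS; split; first exact: UM.
by rewrite log_embM ?En //; exact: U_sub.
Qed.

Lemma UXz u (z : int) : U u -> U (u ^ z) /\ log_emb sigma (u ^ z) = z%:~R *: log_emb sigma u.
Proof.
move=> Uu; rewrite scaler_int; case: z => n.
  exact: UX.
rewrite NegzE -invr_expz mulrNz -pmulrn -exprnP.
have [Un En] := UX n.+1 Uu; split; first exact: UV.
by rewrite log_embV ?En //; exact: U_sub.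
Qed.

(** Take elements of [U] whose logarithms are the rows of a lattice basis; injectivity of [log_emb]
    on [U] lifts integral combinations of logarithms to products of powers. *)
Lemma lattice_generators : set_inj U (log_emb sigma) ->
  is_lattice (log_emb sigma @` U) ->
  exists (B : 'M[R]_s) (gen : 'I_s -> K),
  [/\ B \in unitmx, forall i, U (gen i), forall i, log_emb sigma (gen i) = row i B &
    forall u, U u -> exists z : 'I_s -> int, u = \prod_i gen i ^ z i].
Proof.
move=> iU [B uB EB].
have Hg i : exists u, U u /\ log_emb sigma u = row i B.
  have : (log_emb sigma @` U) (row i B).
    rewrite EB; exists (delta_mx 0 i) => //.
    by rewrite map_delta_mx -rowE.
  by move=> [u Uu Eu]; exists u.
have [gen Hgen] := choice Hg.
exists B, gen; split=> // [i|i|u Uu]; [by case: (Hgen i) | by case: (Hgen i) |].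
have : (log_emb sigma @` U) (log_emb sigma u) by exists u.
rewrite EB => -[z _ Ez]; exists (fun i => z 0 i).
have [Up Ep] : U (\prod_i gen i ^ z 0 i) /\
    log_emb sigma (\prod_i gen i ^ z 0 i) = \sum_i (z 0 i)%:~R *: row i B.
  elim: (index_enum _) => [|i r [Ur Er]]; first by rewrite !big_nil log_emb1.
  rewrite !big_cons; have [Ug <-] := Hgen i; have [Ux Ex] := UXz (z 0 i) Ug.
  split; first exact: UM.
  by rewrite log_embM ?Ex ?Er //; exact: U_sub.
apply: iU; rewrite ?inE // Ep -Ez mulmx_sum_row.
by apply: eq_bigr => i _; rewrite mxE.
Qed.

End Subgroup.

End Lattices.

(** * Invariant arrays *)

Section InvariantArrays.
Variables (R : realType) (K : fieldExtType rat) (s t : nat).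
Variable sigma : 'I_(s + t + t) -> {rmorphism K -> R[i]}.
Variables (U : set K) (a : 'I_s -> R[i]).
Notation V := (pt R s t).
Notation sm := (@smooth R V setT).
Notation T := ('I_s + 'I_(s + t + t))%type.
Notation karr := (karr R (s + t) 2 T).
Notation fre := (@fre R s t).
Notation fim := (@fim R s t).
Notation O_Kpos := (O_Kpos sigma).
Notation frame_d := (frame_d fre fim).
Notation kd := (kd fre fim).
Let oT : open [set: V]. Proof. exact: openT. Qed.

Definition xform_arr l (f : karr l) : Prop :=
  [/\ ksm f, kalt f & forall u b, U u -> O_K b -> gpull sigma a u b f = f].

Definition zset l (phi : 'I_l -> T) : {set 'I_(s + t + t)} :=
  [set i | [exists k, phi k == inr i]].

Definition const_arr l (k : karr l) : Prop :=
  [/\ ksm k, kalt k, forall phi j x, frame_d j (k phi) x = 0 &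
     forall phi x, ~ trivial_char sigma U a (zset phi) -> k phi x = 0].

Lemma prod_fibset u l (phi : 'I_l -> T) :
  \prod_(j in fibset (@fibre s t) phi) wt sigma u j = sigmaI sigma (zset phi) u.
Proof.
rewrite big_sumType /= [X in X * _]big_pred0 ?mul1r; last by move=> k; rewrite /fibset !inE.
by apply: eq_bigl => k; rewrite /fibset !inE.
Qed.

Section Generators.
Hypothesis real_im : forall k x, complex.Im (real_emb sigma k x) = 0.
Hypothesis conj_cplx : forall k x, conj_emb sigma k x = conjc (cplx_emb sigma k x).
Hypothesis U_sub : U `<=` O_Kpos.
Hypothesis U1 : U 1.
Variables (gen : 'I_s -> K) (B : 'M[R]_s).
Hypothesis gen_U : forall i, U (gen i).
Hypothesis unitB : B \in unitmx.
Hypothesis log_gen : forall i, log_emb sigma (gen i) = row i B.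
Hypothesis U_gen : forall u, U u -> exists z : 'I_s -> int, u = \prod_i gen i ^ z i.

Lemma gen_pos i : O_Kpos (gen i). Proof. exact: U_sub. Qed.

(** The closure conditions are restricted to positive units because [lgam] and [rho] are
    multiplicative there: logarithms are additive on positive numbers. *)
Lemma U_ind (P : K -> Prop) : P 1 -> (forall u v, O_Kpos u -> O_Kpos v -> P u -> P v -> P (u * v)) ->
  (forall u, O_Kpos u -> P u -> P u^-1) -> (forall i, P (gen i)) -> forall u, U u -> P u.
Proof.
move=> P1 PM PV Pg u /U_gen [z ->].
have PX i n : O_Kpos (gen i ^+ n) /\ P (gen i ^+ n).
  elim: n => [|n [On Pn]]; first by rewrite expr0; split; [exact: O_Kpos1 |].
  by rewrite exprS; split; [apply: O_KposM => //; exact: gen_pos | apply: PM => //; exact: gen_pos].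
have PZ i (m : int) : O_Kpos (gen i ^ m) /\ P (gen i ^ m).
  case: m => n; first exact: PX.
  rewrite NegzE -invr_expz; have [On Pn] := PX i n.+1.
  by split; [exact: O_KposV | exact: PV].
suff [] : O_Kpos (\prod_i gen i ^ z i) /\ P (\prod_i gen i ^ z i) by [].
elim: (index_enum _) => [|i r [Or Pr]]; first by rewrite big_nil; split=> //; exact: O_Kpos1.
have [Oz Pz] := PZ i (z i); rewrite big_cons; split; [exact: O_KposM | exact: PM].
Qed.

Lemma rhoM u v : O_Kpos u -> O_Kpos v -> rho sigma a (u * v) = rho sigma a u * rho sigma a v.
Proof.
move=> Ou Ov; rewrite /rho -big_split; apply: eq_bigr => k _ /=.
by rewrite !cpowE -[complex.Re _]/(remb sigma k (u * v)) rembM // lnM ?posrE ?cexpD //; exact: remb_gt0.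
Qed.

Lemma rho1 : rho sigma a 1 = 1.
Proof.
rewrite /rho big1 // => k _; rewrite cpowE rmorph1 ln1.
by apply: cplx_eq; rewrite /= /expcos /expsin !mulr0 expR0 ?cos0 ?sin0 ?mulr1 ?mulr0.
Qed.

Lemma latv0 : latv sigma 0 = 0 :> V.
Proof.
apply/matrixP => i c; rewrite mkptE rmorph0 mxE /=; by case: ifP.
Qed.

Lemma gpull1 b l (f : karr l) phi p : gpull sigma a 1 b f phi p = f phi (p + latv sigma b).
Proof.
rewrite /gpull rho1 lgam1 // big1 ?mul1r // => k _.
by case: (phi k) => //= i; rewrite rmorph1.
Qed.

Lemma gpullM u v l (f : karr l) phi p : O_Kpos u -> O_Kpos v ->
  gpull sigma a (u * v) 0 f phi p = gpull sigma a v 0 (gpull sigma a u 0 f) phi p.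
Proof.
move=> Ou Ov; rewrite /gpull latv0 !addr0 lgamM // rhoM //.
have -> : \prod_i wt sigma (u * v) (phi i) =
    (\prod_i wt sigma u (phi i)) * \prod_i wt sigma v (phi i).
  rewrite -big_split /=; apply: eq_bigr => k _.
  by case: (phi k) => [j|i] /=; rewrite ?mulr1 ?rmorphM.
by ring.
Qed.

Lemma pull_gpull i l (f : karr l) : pull (fun i => lgam sigma (gn gen i))
   (fun i => wt sigma (gn gen i)) (fun i => rho sigma a (gn gen i)) i f =
  gpull sigma a (gn gen i) 0 f.
Proof. by apply/funext => phi; apply/funext => p; rewrite /gpull latv0 addr0. Qed.

Notation xcl := (xclass (Lat sigma) s (fun i => lgam sigma (gn gen i))
   (fun i => wt sigma (gn gen i)) (fun i => rho sigma a (gn gen i))).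

Lemma xclass_xform l (f : karr l) : xcl f -> xform_arr f.
Proof.
move=> [[sf af pf] vf]; split=> // u b Uu Ob.
have H0 : gpull sigma a u 0 f = f.
  apply: (U_ind (P := fun u => gpull sigma a u 0 f = f)) Uu.
  - by apply/funext => phi; apply/funext => p; rewrite gpull1 latv0 addr0.
  - move=> v w Ov Ow Ev Ew; apply/funext => phi; apply/funext => p.
    by rewrite gpullM // Ev Ew.
  - move=> v Ov Ev; apply/funext => phi; apply/funext => p.
    have OVv := O_KposV Ov.
    rewrite -{1}Ev -gpullM // mulfV ?gpull1 ?latv0 ?addr0 //; by case: Ov.
  - move=> i; apply/funext => phi; apply/funext => p.
    by have := vf i phi p (ltn_ord i); rewrite pull_gpull gnE.
rewrite -[RHS]H0; apply/funext => phi; apply/funext => p.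
rewrite /gpull pf; last by exists b.
by rewrite latv0 addr0.
Qed.

Lemma xform_xclass l (f : karr l) : xform_arr f -> xcl f.
Proof.
move=> [sf af gf]; split; first split=> //.
  by move=> phi _ p [b Ob <-]; rewrite -gpull1 gf.
move=> i phi p si; rewrite pull_gpull (gf (gn gen i)) //.
  by rewrite /gn; case: insub => [j|] //=; exact: gen_U.
exact: (mxpoly.integral0 intr).
Qed.

Lemma trivial_zset l (phi : 'I_l -> T) :
  trivial_set s (fun i => wt sigma (gn gen i)) (fun i => rho sigma a (gn gen i))
    (fibset (@fibre s t) phi) <-> trivial_char sigma U a (zset phi).
Proof.
have E i : chiI (fun i => wt sigma (gn gen i)) (fun i => rho sigma a (gn gen i)) i
    (fibset (@fibre s t) phi) = rho sigma a (gn gen i) * sigmaI sigma (zset phi) (gn gen i).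
  by rewrite /chiI prod_fibset.
split=> H; last first.
  move=> i si; rewrite E H // (gnE gen (Ordinal si)); exact: gen_U.
have sM u v : sigmaI sigma (zset phi) (u * v) = sigmaI sigma (zset phi) u * sigmaI sigma (zset phi) v.
  by rewrite /sigmaI -big_split; apply: eq_bigr => k _; rewrite rmorphM.
have s1 : sigmaI sigma (zset phi) 1 = 1.
  by rewrite /sigmaI big1 // => k _; rewrite rmorph1.
apply: U_ind.
- by rewrite rho1 s1 mulr1.
- by move=> u v Ou Ov Eu Ev; rewrite rhoM // sM mulrACA Eu Ev mulr1.
- move=> u Ou Eu; rewrite -[LHS]mul1r -{1}Eu mulrACA -rhoM //; last exact: O_KposV.
  by rewrite -sM mulfV ?rho1 ?s1 ?mulr1 //; case: Ou.
- by move=> i; rewrite -gnE -E H.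
Qed.

Variables (d : nat) (lat : 'I_d -> K) (L : 'M[R[i]]_(s + t + t, d)).
Hypothesis latO : forall k, O_K (lat k).
Hypothesis lat_inv : L *m (\matrix_(k, i) sigma i (lat k)) = 1%:M.

Lemma constant_arrP l (k : karr l) :
  constant_arr fre fim (@fibre s t) s (fun i => wt sigma (gn gen i))
   (fun i => rho sigma a (gn gen i)) k <-> const_arr k.
Proof.
split=> -[sk ak ck tk]; split=> // phi x nt; apply: tk => H; apply: nt; exact/trivial_zset.
Qed.

Lemma arr_cohomology_gen l (f : karr l) : xform_arr f -> knull (kd f) ->
  exists2 k : karr l, const_arr k &
    kexact fre fim xform_arr (fun phi x => f phi x - k phi x).
Proof.
move=> xf cf; have gp := gen_pos.
have [k ck ek] := @cohomology_constant R (s + t) 2 T fre fim (@co R s t) (@coP R s t)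
  (@fibre s t) (Lat sigma) (lams sigma lat) (lams_Lat latO) (Lat_fib real_im)
  (fib_span real_im conj_cplx lat_inv) s (fun i => lgam sigma (gn gen i))
  (fun i => lgam sigma (gn gen i)^-1) (fun i => wt sigma (gn gen i))
  (fun i => rho sigma a (gn gen i)) (@ell R s t B) (lgamK real_im gp) (lgamK' real_im gp)
  (fun i => sm_lgam sigma (gn gen i)) (fun i => sm_lgam sigma (gn gen i)^-1)
  (fun i => frame_lgam real_im conj_cplx (gn gen i))
  (fun i b => lgam_Lat real_im (let: And4 _ o _ _ := gn_pos gp i in o))
  (fun i b => lgam_Lat real_im (let: And4 _ _ o _ := gn_pos gp i in o))
  (lgamC real_im gp) (Ck_ell t B) (fun i j p => ell_lgam unitB log_gen p)
  (fun i b p => ell_Lat real_im B i p) (wt_neq0 gp) (rho_neq0 sigma gen a)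
  (fun i => lvec sigma (gn gen i)) (fun i x => lgam_cvec real_im conj_cplx gen x)
  (fun i j fj => cvec_base sigma gen i fj) (fun j nf => base_span unitB log_gen nf)
  (fun i j nf => wt_base sigma gen i nf) l f (xform_xclass xf) cf.
exists k; first exact/constant_arrP.
by apply: kexact_mono ek => l' g; exact: xclass_xform.
Qed.

Lemma arr_constant_exact_gen l (k : karr l) : const_arr k ->
  kexact fre fim xform_arr k -> knull k.
Proof.
move=> /constant_arrP ck ek; have gp := gen_pos.
have ek' : kexact fre fim xcl k by apply: kexact_mono ek => l' g; exact: xform_xclass.
exact: (@constant_exact_zero R (s + t) 2 T fre fim (@co R s t) (@coP R s t)
  (@fibre s t) (Lat sigma) (lams sigma lat) (lams_Lat latO) (Lat_fib real_im)
  (fib_span real_im conj_cplx lat_inv) s (fun i => lgam sigma (gn gen i))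
  (fun i => wt sigma (gn gen i))
  (fun i => rho sigma a (gn gen i))
  (fun i => sm_lgam sigma (gn gen i))
  (fun i => frame_lgam real_im conj_cplx (gn gen i))
  (fun i b => lgam_Lat real_im (let: And4 _ o _ _ := gn_pos gp i in o))
  (wt_neq0 gp)
  (fun i => lvec sigma (gn gen i)) (fun i x => lgam_cvec real_im conj_cplx gen x)
  (fun j nf => base_span unitB log_gen nf)
  (fun i j nf => wt_base sigma gen i nf) l k ck ek').
Qed.

End Generators.

Hypotheses (Hsigma : ordered_embeddings sigma) (HU : admissible sigma U).

Lemma arr_cohomology l (f : karr l) : xform_arr f -> knull (kd f) ->
  exists2 k : karr l, const_arr k &
    kexact fre fim xform_arr (fun phi x => f phi x - k phi x).
Proof.
have [inj _ re _ cj] := Hsigma; have [[Us U1 Ud] _ iU lU] := HU.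
have [d [lat [L [latO lat_inv]]]] := O_K_spanning inj.
have [B [gen [uB gU lg Ug]]] := lattice_generators re Us U1 Ud iU lU.
exact: (arr_cohomology_gen re cj Us U1 gU uB lg Ug latO lat_inv).
Qed.

Lemma arr_constant_exact l (k : karr l) : const_arr k ->
  kexact fre fim xform_arr k -> knull k.
Proof.
have [inj _ re _ cj] := Hsigma; have [[Us U1 Ud] _ iU lU] := HU.
have [d [lat [L [latO lat_inv]]]] := O_K_spanning inj.
have [B [gen [uB gU lg Ug]]] := lattice_generators re Us U1 Ud iU lU.
exact: (arr_constant_exact_gen re cj Us U1 gU uB lg Ug latO lat_inv).
Qed.

End InvariantArrays.

(** * Basic forms *)

Section WordDeterminants.
Variable R : realType.

Lemma antisym_perm (A : Type) l (W : ('I_l -> A) -> R[i]) (h : 'I_l -> A) (p : {perm 'I_l}) :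
  antisym W -> W (fun i => h (p i)) = (-1) ^+ p * W h.
Proof.
move=> aW; have [ts -> dts] := prod_tpermP p; elim: ts h dts => [|z ts IH] h /=.
  move=> _; rewrite big_nil odd_perm1 expr0 mul1r; congr W.
  by apply/funext => i; rewrite perm1.
move=> /andP[dz dts]; rewrite big_cons odd_permM odd_tperm dz signr_addb expr1 -mulrA -IH //.
rewrite mulN1r -(antisym_swap aW _ dz); congr W; apply/funext => i.
by rewrite /swapw permM.
Qed.

(** The determinant of Kronecker deltas is the coefficient array of the wedge product of the letters
    of [S]. In its Leibniz expansion the sum over words factors slot by slot, and each slot selects
    one letter. *)
Lemma word_sum_det (A : Type) (T : finType) (c : A -> T -> R[i]) l (S : 'I_l -> T) h :
  word_sum c (fun phi => \det (\matrix_(i < l, j < l) (S i == phi j)%:R)) h =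
  \det (\matrix_(i < l, j < l) c (h j) (S i)).
Proof.
rewrite /word_sum /determinant; under eq_bigr do rewrite mulr_sumr.
rewrite exchange_big; apply: eq_bigr => p _ /=.
transitivity ((-1) ^+ p * \sum_(phi : {ffun 'I_l -> T})
    \prod_j (c (h j) (phi j) * (S ((p^-1)%g j) == phi j)%:R)).
  rewrite mulr_sumr; apply: eq_bigr => phi _; rewrite big_split /= mulrCA; congr (_ * (_ * _)).
  rewrite [RHS](reindex_inj (@perm_inj _ p)) /=.
  by apply: eq_bigr => i _; rewrite mxE permK.
rewrite -(bigA_distr_bigA (fun j b => c (h j) b * (S ((p^-1)%g j) == b)%:R)); congr (_ * _).
rewrite [LHS](reindex_inj (@perm_inj _ p)) /=; apply: eq_bigr => i _; rewrite mxE permK.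
rewrite (bigD1 (S i)) //= eqxx mulr1 big1 ?addr0 // => b /negbTE.
by rewrite eq_sym => ->; rewrite mulr0.
Qed.

Lemma det_words_antisym (T : finType) l (S : 'I_l -> T) :
  antisym (fun phi : 'I_l -> T => \det (\matrix_(i < l, j < l) (S i == phi j)%:R) : R[i]).
Proof.
move=> a b phi ab; have nab : a != b by rewrite -val_eqE /= ab; lia.
have -> : \matrix_(i, j) (S i == swapw a b phi j)%:R =
    col_perm (tperm a b) (\matrix_(i, j) (S i == phi j)%:R) :> 'M[R[i]]_l.
  by apply/matrixP => i j; rewrite !mxE.
by rewrite col_permE det_mulmx det_perm odd_permV odd_tperm nab expr1 mulrN1.
Qed.

(** A letter of [S] missing from [phi] would give a zero row, and [phi] has no repetition because
    the determinant is antisymmetric; the images then agree by cardinality. *)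
Lemma det_words_image (T : finType) l (S phi : 'I_l -> T) : injective S ->
  \det (\matrix_(i < l, j < l) (S i == phi j)%:R) != 0 :> R[i] ->
  forall x, [exists i, S i == x] = [exists j, phi j == x].
Proof.
move=> iS nz.
have sub i : exists j, phi j == S i.
  apply/existsP; apply: contraNT nz; rewrite negb_exists => /forallP H.
  rewrite (expand_det_row _ i) big1 // => j _; rewrite mxE.
  by rewrite eq_sym (negbTE (H j)) mul0r.
have iphi : injective phi := antisym_inj (det_words_antisym S) nz.
have E : [set S i | i : 'I_l] = [set phi j | j : 'I_l].
  apply/eqP; rewrite eqEcard !card_imset // leqnn andbT.
  by apply/fintype.subsetP => _ /imsetP[i _ ->]; have [j /eqP <-] := sub i; exact: imset_f.
move=> x; have F (f : 'I_l -> T) : [exists i, f i == x] = (x \in [set f i | i : 'I_l]).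
  apply/existsP/imsetP => [[i /eqP <-]|[i _ ->]]; first by exists i.
  by exists i.
by rewrite !F E.
Qed.

(** The word [phi] is a rearrangement of [S], and the determinant is the sign of the permutation. *)
Lemma antisym_word (T : finType) l (W : ('I_l -> T) -> R[i]) (S phi : 'I_l -> T) :
  antisym W -> injective S -> injective phi ->
  (forall x, [exists i, S i == x] = [exists j, phi j == x]) ->
  W phi = \det (\matrix_(i < l, j < l) (S i == phi j)%:R) * W S.
Proof.
move=> aW iS iphi H.
have Hj j : exists i, S i == phi j.
  by apply/existsP; rewrite H; apply/existsP; exists j.
have [f Hf] := choice Hj.
have fi : injective f.
  by move=> j j' E; apply: iphi; rewrite -(eqP (Hf j)) -(eqP (Hf j')) E.
have Ep : phi = fun j => S (perm fi j) by apply/funext => j; rewrite permE (eqP (Hf j)).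
rewrite Ep antisym_perm //; congr (_ * _); rewrite -det_perm -det_tr; congr (\det _).
by apply/matrixP => i j; rewrite !mxE (inj_eq iS) eq_sym.
Qed.

End WordDeterminants.

Section BasicForms.
Variables (R : realType) (s t : nat).
Notation V := (pt R s t).
Notation HC := (@HC R s t).
Notation T := ('I_s + 'I_(s + t + t))%type.
Notation P := ({set 'I_s} * {set 'I_(s + t + t)})%type.
Notation karr := (karr R (s + t) 2 T).
Notation form := (Defs.form R s t).
Notation frame_d := (frame_d (@fre R s t) (@fim R s t)).
Let oT : open [set: V]. Proof. exact: openT. Qed.

Variable t0 : T.

Definition letters (A : P) : seq T := map inl (enum A.1) ++ map inr (enum A.2).
Definition degree (A : P) : nat := #|A.1| + #|A.2|.
(** [t0] is the default value of [nth], never reached when [degree A = l]. *)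
Definition letter l (A : P) (i : 'I_l) : T := nth t0 (letters A) i.
Arguments letter l A i : clear implicits.

Lemma size_letters A : size (letters A) = degree A.
Proof. by rewrite size_cat !size_map -!cardE. Qed.

Lemma uniq_letters A : uniq (letters A).
Proof.
rewrite cat_uniq !map_inj_uniq ?enum_uniq ?andbT /=; try by move=> x y [].
by apply/hasPn => _ /mapP[i _ ->]; apply/mapP => -[].
Qed.

Lemma mem_letters A j : (j \in letters A) =
  match j with inl k => k \in A.1 | inr i => i \in A.2 end.
Proof.
rewrite mem_cat; case: j => x.
  rewrite mem_map ?mem_enum; last by move=> y z [].
  by rewrite orbC; case: mapP => // -[].
rewrite [X in _ || X]mem_map ?mem_enum; last by move=> y z [].
by case: mapP => // -[].
Qed.

Lemma letter_inj l A : degree A = l -> injective (letter l A).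
Proof.
move=> dA i j /eqP; rewrite /letter nth_uniq ?uniq_letters ?size_letters ?dA //.
by move=> /eqP; exact: ord_inj.
Qed.

Lemma letter_image l A j : degree A = l -> [exists i, letter l A i == j] = (j \in letters A).
Proof.
move=> dA; apply/existsP/idP => [[i /eqP <-]|jA].
  by apply: mem_nth; rewrite size_letters dA.
have [i il E] := nthP t0 jA; rewrite size_letters dA in il; exists (Ordinal il); exact/eqP.
Qed.

Lemma letters_inj A A' : letters A =i letters A' -> A = A'.
Proof.
case: A A' => [J I] [J' I'] E; congr (_, _); apply/setP => x.
  by have := E (inl x); rewrite !mem_letters.
by have := E (inr x); rewrite !mem_letters.
Qed.

(** The coefficient array of the wedge product of the letters of [A]. *)
Definition word_det l (A : P) (phi : 'I_l -> T) : R[i] :=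
  \det (\matrix_(i < l, j < l) (letter l A i == phi j)%:R).

Definition comb l (c : P -> R[i]) : karr l := fun phi _ =>
  \sum_(A : P | degree A == l) c A * word_det A phi.

Lemma word_det_letter l A A' : degree A = l -> degree A' = l ->
  word_det A (letter l A') = (A == A')%:R.
Proof.
move=> dA dA'; have [<-|ne] := eqVneq A A'.
  rewrite /word_det (_ : \matrix_(i, j) _ = 1%:M) ?det1 //.
  by apply/matrixP => i j; rewrite !mxE (inj_eq (letter_inj dA)).
apply/eqP; apply: contraNT ne => nz; apply/eqP/letters_inj => j.
rewrite -!(letter_image _ dA) -(letter_image _ dA').
exact: (det_words_image (letter_inj dA) nz).
Qed.

Lemma comb_letter l c A x : degree A = l -> comb c (letter l A) x = c A.
Proof.
move=> dA; rewrite /comb (bigD1 A) ?dA //= word_det_letter // eqxx mulr1.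
rewrite big1 ?addr0 // => A' /andP[/eqP dA' /negbTE ne].
by rewrite word_det_letter // ne mulr0.
Qed.

Lemma comb_ksm l c : ksm (@comb l c).
Proof. by move=> phi; exact: (smooth_cst oT). Qed.

Lemma comb_kalt l c : kalt (@comb l c).
Proof.
move=> a b phi x ab; rewrite /comb -sumrN; apply: eq_bigr => A _.
by rewrite /word_det (@det_words_antisym R _ _ _ _ _ _ ab) mulrN.
Qed.

(** Antisymmetry determines the array from its values on one enumeration of each set of letters, and
    gives 0 on words with repetitions; vanishing frame derivatives allow evaluation at the
    origin. *)
Lemma kalt_comb l (k : karr l) : kalt k -> (forall phi j x, frame_d j (k phi) x = 0) -> ksm k ->
  k = comb (fun A => k (letter l A) 0).
Proof.
move=> ak ck sk; have cst phi x : k phi x = k phi 0.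
  rewrite -[x in LHS]add0r -[x in LHS]scale1r; apply: const_along => // y.
  by rewrite coP // big1 // => j _; rewrite ck mulr0.
have aW : antisym (fun phi => k phi 0) by move=> i j h ij; exact: ak.
apply/funext => phi; apply/funext => x; rewrite cst.
have [/injectiveP iphi|nphi] := boolP (injectiveb phi); last first.
  have Z (W : ('I_l -> T) -> R[i]) : antisym W -> W phi = 0.
    move=> aW'; apply/eqP; apply: contraNT nphi => nz.
    by apply/injectiveP; exact: antisym_inj nz.
  rewrite [LHS](Z _ aW) /comb big1 // => A _.
  by rewrite /word_det (Z _ (@det_words_antisym R _ _ _)) mulr0.
pose A : P := (finset (fun j => [exists a, phi a == inl j]),
  finset (fun j => [exists a, phi a == inr j])).
have EA j : [exists a, phi a == j] = (j \in letters A).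
  by rewrite mem_letters; case: j => j; rewrite inE.
have dA : degree A = l.
  rewrite -size_letters -(card_uniqP (uniq_letters A)) -[RHS]card_ord -(card_imset _ iphi).
  apply: eq_card => j; rewrite -EA; apply/existsP/imsetP => [[a /eqP <-]|[a _ ->]].
    by exists a.
  by exists a.
have H j : [exists i, letter l A i == j] = [exists a, phi a == j].
  by rewrite letter_image // EA.
rewrite (antisym_word aW (letter_inj dA) iphi H) /comb (bigD1 A) ?dA //= mulrC.
rewrite big1 ?addr0 // => A' /andP[/eqP dA' ne].
have [z|nz] := eqVneq (word_det A' phi) 0; first by rewrite z mulr0.
case/eqP: ne; apply: letters_inj => j; rewrite -(letter_image _ dA') -(letter_image _ dA) H.
exact: (det_words_image (letter_inj dA') nz).
Qed.

Lemma word_det_zset l (A : P) (phi : 'I_l -> T) : degree A = l -> word_det A phi != 0 ->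
  zset phi = A.2.
Proof.
move=> dA nz; apply/setP => i; rewrite inE -(det_words_image (letter_inj dA) nz).
by rewrite letter_image // mem_letters.
Qed.

Variable a : 'I_s -> R[i].

Lemma basic_form_unhat l (A : P) : degree A = l ->
  basic_form a (l := l) A.1 A.2 = unhat a (fun phi _ => word_det A phi).
Proof.
move=> dA; apply/funext => x; apply/funext => h; rewrite /basic_form /unhat.
case: ifP => // _; rewrite words_formE word_sum_det; congr (_ * \det _).
apply/matrixP => i j; rewrite !mxE /letter.
rewrite -[RHS]/((fun T' => cof T' x (h j)) _).
have -> : [seq dlnv k x | k <- enum A.1] ++ [seq @e_form R s t i | i <- enum A.2] =
   [seq (fun h => cof T' x h) | T' <- letters A].
  by rewrite map_cat -!map_comp.
by rewrite (nth_map t0) // size_letters dA.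
Qed.

Lemma unhat_comb l (c : P -> R[i]) :
  unhat a (comb c) = \sum_(A : P | degree A == l) c A *: basic_form a (l := l) A.1 A.2.
Proof.
apply/funext => x; apply/funext => h.
have E (r : seq P) (Q : pred P) (F : P -> form l) :
    (\sum_(A <- r | Q A) F A) x h = \sum_(A <- r | Q A) (F A x h : R[i]).
  elim: r => [|A r IH]; first by rewrite !big_nil.
  by rewrite !big_cons; case: (Q A) => //; rewrite -IH.
rewrite E; under [RHS]eq_bigr => A /eqP dA.
  rewrite -[(_ *: _) x h]/(c A * basic_form a (l := l) A.1 A.2 x h) basic_form_unhat //; over.
rewrite /unhat; case: ifP => _; last by rewrite big1 // => A _; rewrite mulr0.
rewrite /words_form.
under [RHS]eq_bigr do rewrite mulrCA.
rewrite -mulr_sumr; congr (_ * _).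
under [RHS]eq_bigr do rewrite mulr_sumr.
rewrite exchange_big; apply: eq_bigr => phi _; rewrite mulr_sumr.
by apply: eq_bigr => A _; rewrite mulrCA.
Qed.

End BasicForms.

(** * Twisted cohomology *)

Lemma has_dim_bij (F : fieldType) (V W : lmodType F) (f : {linear V -> W}) n :
  bijective f -> has_dim V n -> has_dim W n.
Proof.
move=> [g gK fK] [b Hb]; exists (fun i => f (b i)) => y.
have E (c : {ffun 'I_n -> F}) : \sum_i c i *: f (b i) = f (\sum_i c i *: b i).
  by rewrite linear_sum; apply: eq_bigr => i _; rewrite [RHS]linearZ_LR.
have [c [Ec Uc]] := Hb (g y); exists c; split; first by rewrite E -Ec fK.
by move=> c' Ec'; apply: Uc; rewrite Ec' E gK.
Qed.

Lemma inj_surj_bij (A B : Type) (f : A -> B) : injective f -> (forall y, exists x, f x = y) ->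
  bijective f.
Proof.
move=> fi fs; have [g Hg] := choice fs.
by exists g => [x|y]; [apply: fi; exact: Hg | exact: Hg].
Qed.

Section TwistedCohomologyOfOT.
Variables (R : realType) (K : fieldExtType rat) (s t : nat).
Variable sigma : 'I_(s + t + t) -> {rmorphism K -> R[i]}.
Variables (U : set K) (a : 'I_s -> R[i]) (l : nat).
Hypotheses (Hsigma : ordered_embeddings sigma) (HU : admissible sigma U).
Notation V := (pt R s t).
Notation T := ('I_s + 'I_(s + t + t))%type.
Notation P := ({set 'I_s} * {set 'I_(s + t + t)})%type.
Notation karr := (karr R (s + t) 2 T).
Notation form := (Defs.form R s t).
Notation fre := (@fre R s t).
Notation fim := (@fim R s t).
Notation frame_d := (frame_d fre fim).
Notation kd := (kd fre fim).
Notation const_arr := (const_arr sigma U a).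
Notation xform_arr := (xform_arr sigma U a).
Notation S := (sum_of_forms sigma U a l).
Notation H := (twisted_cohomology sigma U a l).
Let oT : open [set: V]. Proof. exact: openT. Qed.

Variable t0 : T.

Let U_sub : U `<=` O_Kpos sigma.
Proof. by have [[]] := HU. Qed.

Let real_im k x : complex.Im (real_emb sigma k x) = 0.
Proof. by have [_ _ re _ _] := Hsigma. Qed.

Let conj_cplx k x : conj_emb sigma k x = conjc (cplx_emb sigma k x).
Proof. by have [_ _ _ _ cj] := Hsigma. Qed.

Lemma xform_unhat l' (f : karr l') : xform_arr f -> is_Xform sigma U (unhat a f).
Proof.
move=> [sf af gf]; split; first exact: is_form_unhat.
exact: invariant_unhat.
Qed.

Lemma xform_hat l' (w : form l') : is_Xform sigma U w -> xform_arr (hat a w).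
Proof.
move=> [fw iw]; split; [exact: hat_ksm | exact: hat_kalt |].
by move=> u b Uu Ob; apply: gpull_hat Uu Ob.
Qed.

(** The affine action on points does not affect a constant coefficient, and the multiplier of its
    word is the value of the character of [zset phi], which is trivial wherever the coefficient is
    nonzero. *)
Lemma const_xform l' (k : karr l') : const_arr k -> xform_arr k.
Proof.
move=> [sk ak ck tk]; split=> // u b Uu Ob; apply/funext => phi; apply/funext => p.
have cst x : k phi x = k phi 0.
  rewrite -[x in LHS]add0r -[x in LHS]scale1r; apply: const_along => // y.
  by rewrite coP // big1 // => j _; rewrite ck mulr0.
rewrite /gpull cst [RHS]cst; have [->|nz] := eqVneq (k phi 0) 0; first by rewrite mulr0.
have iphi : injective phi by exact: kalt_inj nz.
have tr : trivial_char sigma U a (zset phi).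
  by apply: contrapT => nt; rewrite tk ?eqxx in nz.
have E : \prod_i wt sigma u (phi i) = sigmaI sigma (zset phi) u.
  have wb (i : nat) j : ~~ @fibre s t j -> wt sigma u j = 1 by case: j.
  (* Only the count of the letters is wanted from [chi_fibset], so the factor [rho] is set to 1. *)
  have := chi_fibset (fun=> 1) wb 0 iphi; rewrite /chi /chiI !mul1r => ->.
  exact: prod_fibset.
by rewrite E tr // mul1r.
Qed.

Lemma frame_cst j (z : R[i]) (x : V) : frame_d j (fun=> z) x = 0.
Proof. by rewrite frame_dE !cderive_cst mulr0 addr0. Qed.

Lemma const_kd l' (k : karr l') : const_arr k -> kd k = (fun _ _ => 0).
Proof.
move=> [_ _ ck _]; apply/funext => phi; apply/funext => x.
by rewrite kdE big1 // => i _; rewrite ck mulr0.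
Qed.

Lemma unhat0 l' : unhat a ((fun _ _ => 0) : karr l') = 0.
Proof.
apply/funext => x; apply/funext => h; rewrite /unhat; case: ifP => // _.
by rewrite /words_form big1 ?mulr0 // => phi _; rewrite mulr0.
Qed.

Lemma hat0 l' : hat a (0 : form l') = (fun _ _ => 0).
Proof. by rewrite -unhat0 hat_unhat. Qed.

Definition admits (A : P) : bool := (degree A == l) && `[< trivial_char sigma U a A.2 >].

Definition supported (c : P -> R[i]) : Prop := forall A, ~~ admits A -> c A = 0.

Lemma comb_const c : supported c -> const_arr (comb t0 (l := l) c).
Proof.
move=> sc; split; [exact: comb_ksm | exact: comb_kalt | |].
  by move=> phi j x; exact: frame_cst.
move=> phi x nt; rewrite /comb big1 // => A /eqP dA.
have [->|nz] := eqVneq (word_det R t0 A phi) 0; first by rewrite mulr0.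
rewrite sc ?mul0r // /admits negb_and; apply/orP; right; apply/negP => /asboolP tr.
by apply: nt; rewrite (word_det_zset dA nz).
Qed.

Lemma const_comb (k : karr l) : const_arr k -> exists2 c, supported c & k = comb t0 c.
Proof.
move=> [sk ak ck tk]; exists (fun A => if degree A == l then k (letter t0 (l := l) A) 0 else 0).
  move=> A; rewrite /admits; case: eqP => //= dA /asboolPn nt; apply: tk.
  suff -> : zset (letter t0 (l := l) A) = A.2 by [].
  by apply/setP => i; rewrite inE letter_image // mem_letters.
rewrite {1}(kalt_comb t0 ak ck sk); apply/funext => phi; apply/funext => x.
by apply: eq_bigr => A ->.
Qed.

Lemma const_closed (k : karr l) : const_arr k -> unhat a k \in @closed_form R K s t sigma U a l.
Proof.
move=> ck; apply/asboolP; have [sk ak _ _] := ck.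
split; first by apply: xform_unhat; exact: const_xform.
by rewrite d_theta_unhat // const_kd // unhat0.
Qed.

Definition fam (c : P -> R[i]) : form_family R s t l := fun I =>
  \sum_(J : {set 'I_s} | (#|J| + #|I| == l)%N) c (J, I) *: basic_form a (l := l) J I.

Lemma sum_fam c : \sum_I fam c I = unhat a (comb t0 c).
Proof.
rewrite unhat_comb pair_big_dep /=.
rewrite [RHS](reindex (fun IJ : {set 'I_(s + t + t)} * {set 'I_s} => (IJ.2, IJ.1))) /=.
  by apply: eq_bigl => -[I J].
by exists (fun A => (A.2, A.1)) => -[].
Qed.

Lemma fam_mem c : supported c -> fam c \in @in_sum R K s t sigma U a l.
Proof.
move=> sc; apply/asboolP => I; split; first by exists (fun J => c (J, I)).
move=> nt; rewrite /fam big1 // => J _; rewrite sc ?scale0r //.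
by rewrite /admits negb_and; apply/orP; right; apply/negP => /asboolP.
Qed.

Lemma famP (w : form_family R s t l) : w \in @in_sum R K s t sigma U a l ->
  exists2 c, supported c & w = fam c.
Proof.
move=> /asboolP Hw; have [cI HcI] := choice (fun I => (Hw I).1).
exists (fun A => if admits A then cI A.2 A.1 else 0); first by move=> A /negbTE ->.
apply/funext => I; rewrite /fam.
have [tr|nt] := pselect (trivial_char sigma U a I).
  rewrite HcI; apply: eq_bigr => J dJ; congr (_ *: _).
  by rewrite /admits dJ /=; case: asboolP.
rewrite (Hw I).2 // big1 // => J dJ.
by rewrite /admits /= [X in _ && X](_ : _ = false) ?andbF ?scale0r //; apply/asboolP.
Qed.

Lemma sum_closed (w : S) : \sum_I val w I \in @closed_form R K s t sigma U a l.
Proof.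
have [c sc ->] := famP (valP w); rewrite sum_fam; apply: const_closed; exact: comb_const.
Qed.

Definition total_form (w : S) : submodule (closed_form sigma U a (l := l)) :=
  exist _ (\sum_I val w I) (sum_closed w).

Definition total_class (w : S) : H := qclass _ (total_form w).

Lemma total_class_linear : linear total_class.
Proof.
move=> x u v; rewrite /total_class -[x *: qclass _ _]qclassZ -qclassD; congr qclass.
have Ev : val (x *: u + v) = x *: val u + val v :> form_family R s t l by rewrite linearP.
apply: val_inj; rewrite linearP /= scaler_sumr -big_split /=.
by apply: eq_bigr => I _; exact: (congr1 (fun f : form_family R s t l => f I) Ev).
Qed.

HB.instance Definition _ := GRing.isLinear.Build R[i] S H _ total_class total_class_linear.

Lemma exact_kexact l' (k : karr l') : is_exact sigma U a (unhat a k) ->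
  kexact fre fim xform_arr k.
Proof.
case: l' k => [|l'] k /=; first by move=> E phi x; rewrite -(hat_unhat a k) E hat0.
move=> [eta Xeta E]; exists (hat a eta); first exact: xform_hat.
move=> phi x; rewrite kd_hat -?E ?hat_unhat //; by case: Xeta.
Qed.

Lemma kexact_exact l' (k : karr l') : kexact fre fim xform_arr k ->
  is_exact sigma U a (unhat a k).
Proof.
case: l' k => [|l'] k /=.
  move=> k0; rewrite -(@unhat0 0); congr (unhat a _).
  by apply/funext => phi; apply/funext => x; exact: k0.
move=> [eta Xeta E]; exists (unhat a eta); first exact: xform_unhat.
have [se ae _] := Xeta; rewrite d_theta_unhat //; congr (unhat a _).
by apply/funext => phi; apply/funext => x; exact: E.
Qed.

Lemma unhatB l' (f g : karr l') : unhat a (fun phi x => f phi x - g phi x) = unhat a f - unhat a g.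
Proof.
apply/funext => x; apply/funext => h.
rewrite -[RHS]/(unhat a f x h - unhat a g x h) /unhat; case: ifP => _; last by rewrite subr0.
rewrite /words_form -mulrBr -sumrB; congr (_ * _).
by apply: eq_bigr => phi _; rewrite mulrBr.
Qed.

Lemma fam0 : fam (fun=> 0) = 0.
Proof. by apply/funext => I; rewrite /fam big1 // => J _; rewrite scale0r. Qed.

(** A constant array that is exact vanishes, and its coefficients are its values at the words
    [letter t0 A]. *)
Lemma total_class_inj : injective total_class.
Proof.
apply: raddf_inj => w /eqP; rewrite -(raddf0 total_class) qclass_eq => /asboolP.
have -> : val (total_form w - total_form 0) = \sum_I val w I.
  by rewrite raddfB /= [X in _ - X]big1 ?subr0.
have [c sc Ec] := famP (valP w); rewrite Ec sum_fam => /exact_kexact E.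
have Z := arr_constant_exact Hsigma HU (comb_const sc) E.
apply: val_inj; rewrite Ec raddf0 -fam0; congr fam; apply/funext => A.
have [dA|ndA] := eqVneq (degree A) l; first by rewrite -(comb_letter t0 c 0 dA) Z.
by apply: sc; rewrite /admits (negbTE ndA).
Qed.

(** Pass to the coefficient array of a representative, replace it by a constant array in the same
    class, and read off the coefficients of the latter. *)
Lemma total_class_surj (y : H) : exists w, total_class w = y.
Proof.
elim/qclassW: y => z; have /asboolP [Xz dz] := valP z.
have [fz _] := Xz; have z0 : forall x, ~ HC x -> val z x = 0 by case: fz.
have kz : knull (kd (hat a (val z))) by rewrite kd_hat // dz hat0 => phi x.
have [k ck ek] := arr_cohomology Hsigma HU (xform_hat Xz) kz.
have [c sc Ek] := const_comb ck.
exists (exist _ (fam c) (fam_mem sc)); apply/esym/eqP; rewrite qclass_eq; apply/asboolP.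
rewrite raddfB /= sum_fam -Ek -[X in is_exact _ _ _ (X - _)](@unhat_hat R s t a l) //.
  by rewrite -unhatB; exact: kexact_exact.
by move=> x Hx; exact: form_mlin.
Qed.

Lemma fam_lin (x : R[i]) c d : fam (fun A => x * c A + d A) = x *: fam c + fam d.
Proof.
apply/funext => I; rewrite -[RHS]/(x *: fam c I + fam d I) /fam scaler_sumr -big_split /=.
by apply: eq_bigr => J _; rewrite scalerDl scalerA.
Qed.

Lemma fam_sum (I : Type) (r : seq I) (x : I -> R[i]) (c : I -> P -> R[i]) :
  \sum_(i <- r) x i *: fam (c i) = fam (fun A => \sum_(i <- r) x i * c i A).
Proof.
elim: r => [|i r IH]; first by rewrite big_nil -fam0; congr fam; apply/funext => A; rewrite big_nil.
rewrite big_cons IH -fam_lin; congr fam; apply/funext => A; by rewrite big_cons.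
Qed.

Lemma fam_inj c d A : degree A = l -> fam c = fam d -> c A = d A.
Proof.
move=> dA E; rewrite -(comb_letter t0 c 0 dA) -(comb_letter t0 d 0 dA).
by rewrite -[comb t0 c](hat_unhat a) -sum_fam E sum_fam hat_unhat.
Qed.

Definition admitted : {set P} := finset admits.

Lemma delta_supported A : A \in admitted -> supported (fun A' => (A' == A)%:R).
Proof. by rewrite inE => aA A' naA'; case: eqP naA' => // ->; rewrite aA. Qed.

Lemma sum_has_dim : has_dim S #|admitted|.
Proof.
pose b (i : 'I_#|admitted|) : S :=
  exist _ (fam (fun A => (A == enum_val i)%:R)) (fam_mem (delta_supported (enum_valP i))).
have E (c : {ffun 'I_#|admitted| -> R[i]}) :
    val (\sum_i c i *: b i) = fam (fun A => \sum_i c i * (A == enum_val i)%:R).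
  have Z x (u : S) : val (x *: u) = x *: val u :> form_family R s t l.
    by rewrite -[x *: u]addr0 linearP raddf0 addr0.
  by rewrite -fam_sum raddf_sum; apply: eq_bigr => i _; exact: Z.
have D (c : 'I_#|admitted| -> R[i]) j : \sum_i c i * (enum_val j == enum_val i)%:R = c j.
  rewrite (bigD1 j) //= eqxx mulr1 big1 ?addr0 // => i ne.
  by rewrite (inj_eq enum_val_inj) eq_sym (negbTE ne) mulr0.
have deg i : degree (@enum_val _ (mem admitted) i) = l.
  by have := enum_valP i; rewrite inE => /andP[/eqP].
exists b => w; have [e se Ee] := famP (valP w).
exists [ffun i => e (enum_val i)]; split.
  apply: val_inj; rewrite [LHS]Ee E; congr fam; apply/funext => A.
  have [aA|naA] := boolP (A \in admitted).
    rewrite -[A](enum_rankK_in aA aA) -[LHS](D (fun i => e (enum_val i))).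
    by apply: eq_bigr => i _; rewrite ffunE.
  rewrite se; last by rewrite inE in naA.
  rewrite big1 // => i _; case: eqP => [EA|_]; last by rewrite mulr0.
  by rewrite EA (enum_valP i) in naA.
move=> c' Ec'; apply/ffunP => j; rewrite ffunE -[RHS](D c').
by apply: (@fam_inj e (fun A => \sum_i c' i * (A == enum_val i)%:R) _ (deg j)); rewrite -Ee Ec' E.
Qed.

Lemma card_admitted : #|admitted| =
  (\sum_(p < l.+1) 'C(s, p) * rho_card sigma U a (l - p))%N.
Proof.
rewrite -sum1_card (eq_bigl (fun A => xpredT A.1 && admits (A.1, A.2))); last first.
  by case=> J I; rewrite inE.
rewrite -(pair_big_dep xpredT (fun J I => admits (J, I)) (fun _ _ => 1%N)) /=.
(* Sorts the pairs by [p = #|J|]. Sets [J] with more than [l] elements contribute nothing on either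
   side, and [p < l.+1] keeps [l - p] from truncating. *)
transitivity (\sum_(J : {set 'I_s}) \sum_(p < l.+1 | #|J| == p) rho_card sigma U a (l - p))%N.
  apply: eq_bigr => J _; have [Jl|lJ] := leqP #|J| l.
    rewrite (big_pred1 (inord #|J|)); last first.
      by move=> p; rewrite /= -[in RHS]val_eqE /= inordK ?ltnS // eq_sym.
    rewrite inordK ?ltnS // sum1_card /rho_card; apply: eq_card => I.
    rewrite [LHS]unfold_in [RHS]unfold_in /in_set asboolb /degree /=; congr (_ && _).
    by rewrite -[RHS](eqn_add2l #|J|) subnKC.
  rewrite !big_pred0 // => [p|I]; last first.
    by rewrite /admits /degree /=; case: eqP => // E; move: lJ; rewrite -E ltnNge leq_addr.
  by apply/negbTE; rewrite neq_ltn (leq_trans (ltn_ord p)) // orbT.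
rewrite (exchange_big_dep xpredT) //=; apply: eq_bigr => p _.
rewrite sum_nat_const; congr (_ * _)%N.
by rewrite -[X in 'C(X, _)](card_ord s) -card_draws; apply: eq_card => J; rewrite inE.
Qed.

End TwistedCohomologyOfOT.

Theorem theorem5p1 (R : realType) (K : fieldExtType rat) (s t : nat)
    (sigma : 'I_(s + t + t) -> {rmorphism K -> R[i]}) (U : set K)
    (a : 'I_s -> R[i]) (l : nat)
    (s_gt0 : (0 < s)%N) (t_gt0 : (0 < t)%N)
    (Hsigma : ordered_embeddings sigma) (HU : admissible sigma U)
    (Hl : (l <= 2 * (s + t))%N) :
  (exists phi : {linear sum_of_forms sigma U a l ->
                        twisted_cohomology sigma U a l},
     bijective phi /\
     forall w : sum_of_forms sigma U a l,
       exists2 z : submodule (closed_form sigma U a (l := l)),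
         val z = \sum_I val w I & phi w = qclass _ z) /\
  has_dim (twisted_cohomology sigma U a l)
    (\sum_(p < l.+1) 'C(s, p) * rho_card sigma U a (l - p))%N.
Proof.
(* The default letter required by [nth], available because [s > 0]. *)
pose t0 : 'I_s + 'I_(s + t + t) := inl (Ordinal s_gt0).
have bij : bijective (total_class (a := a) (l := l) Hsigma HU t0).
  by apply: inj_surj_bij; [exact: total_class_inj | exact: total_class_surj].
split.
  exists (total_class (a := a) (l := l) Hsigma HU t0); split=> // w.
  by exists (total_form Hsigma HU t0 w).
rewrite -card_admitted; apply: has_dim_bij bij _; exact: (sum_has_dim sigma U a l t0).
Qed.
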